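(* Let $b_2>0$, $0<b_1<b_1^*:=\frac{4}{27}b_2^3$, let $m(x)=\frac{b_1}{x^8}-x-\frac{b_2}{x^2}$ for $x>0$, with local minimum point $x_l$ and local maximum point $x_r$ on $(0,\infty)$, and let $a\in(-m(x_r),-m(x_l))$. Let $B,C,\Omega>0$ and consider $$\ddot x=m(x)+a+\epsilon\Big(B\cos(\Omega t)-\frac{C}{x^3}\dot x\Big),\qquad x>0,\ \epsilon\ge 0 .$$ Let $\Gamma$ be a homoclinic loop ($\Gamma_l$ or $\Gamma_r$) of the unperturbed system ($\epsilon=0$), parametrized by the solution $(x_1(t),x_2(t))$, $t\in\mathbb{R}$, with $x_2=\dot x_1$ and $x_2(0)=0$, and set $$\xi_1=-2\int_0^\infty \sin(\Omega t)\,x_2(t)\,dt,\qquad \xi_2=-\int_{-\infty}^{\infty}\frac{x_2(t)^2}{x_1(t)^3}\,dt,$$ where $\xi_1\neq 0$. If $$\frac{B}{C}>\left|\frac{\xi_2}{\xi_1}\right|,$$ then the homoclinic orbit $\Gamma$ persists for the perturbed equation for all sufficiently small $\epsilon>0$.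
   Context: When $0<b_1<b_1^*$, $m$ has exactly one local minimum point $x_l$ and exactly one local maximum point $x_r$ on $(0,\infty)$, with $m(x_l)<m(x_r)<0$. For $a\in(-m(x_r),-m(x_l))$ the unperturbed system $\dot x_1=x_2$, $\dot x_2=m(x_1)+a$ has exactly three equilibria: two centers and, between them, one saddle $(x_{sa},0)$. Its energy is $$E(x_1,x_2)=\frac{x_2^2}{2}+\frac{x_1^2}{2}+\frac{b_1}{7x_1^7}-\frac{b_2}{x_1}-a x_1 .$$ With $\beta=E(x_{sa},0)$, the level set $E=\beta$ consists of the saddle together with two orbits homoclinic to it: $\Gamma_l$, lying in $x_1<x_{sa}$, and $\Gamma_r$, lying in $x_1>x_{sa}$. On each, $x_2$ vanishes at exactly one point, which is taken as the position at $t=0$, so $x_1$ is even and $x_2$ is odd in $t$. Persistence of $\Gamma$ means that there is $\epsilon_0>0$ such that for every $0<\epsilon<\epsilon_0$ the perturbed $2\pi/\Omega$-periodic equation has a homoclinic orbit generated by $\Gamma$: a solution that is homoclinic to the hyperbolic $2\pi/\Omega$-periodic solution continuing the saddle $(x_{sa},0)$ (i.e. asymptotic to it as $t\to\pm\infty$), and whose orbit in the $(x,\dot x)$-plane tends to $\Gamma$ as $\epsilon\to0$. *)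

(* Defs.v *)
From Stdlib Require Import Reals.
From Coquelicot Require Import Coquelicot.
Open Scope R_scope.

Definition m (b1 b2 x : R) : R := b1 / x ^ 8 - x - b2 / x ^ 2.

Definition b1_star (b2 : R) : R := 4 / 27 * b2 ^ 3.

Definition local_min_point (f : R -> R) (x : R) : Prop :=
  0 < x /\
  exists d, 0 < d /\ forall y, 0 < y -> Rabs (y - x) < d -> f x <= f y.

Definition local_max_point (f : R -> R) (x : R) : Prop :=
  0 < x /\
  exists d, 0 < d /\ forall y, 0 < y -> Rabs (y - x) < d -> f y <= f x.

Definition E (b1 b2 a x1 x2 : R) : R :=
  x2 ^ 2 / 2 + x1 ^ 2 / 2 + b1 / (7 * x1 ^ 7) - b2 / x1 - a * x1.

(* Real eigenvalues of the Jacobian matrix at (p, q) of the planar system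
   x' = f x y, y' = g x y. *)
Definition jacobian_eigenvalue (f g : R -> R -> R) (p q l : R) : Prop :=
  exists v1 v2 : R,
    (v1, v2) <> (0, 0) /\
    Derive (fun x => f x q) p * v1 + Derive (fun y => f p y) q * v2 = l * v1 /\
    Derive (fun x => g x q) p * v1 + Derive (fun y => g p y) q * v2 = l * v2.

Definition saddle (f g : R -> R -> R) (p q : R) : Prop :=
  f p q = 0 /\ g p q = 0 /\
  exists l1 l2 : R,
    l1 < 0 < l2 /\
    jacobian_eigenvalue f g p q l1 /\ jacobian_eigenvalue f g p q l2.

(* Solutions, on the whole time axis and in the half-plane x > 0, of
   x'' = F t x x', written as a first order system in (x, y) = (x, x'). *)
Definition solution (F : R -> R -> R -> R) (x y : R -> R) : Prop :=
  forall t, 0 < x t /\ is_derive x t (y t) /\ is_derive y t (F t (x t) (y t)).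

Definition unperturbed (b1 b2 a t x y : R) : R := m b1 b2 x + a.

Definition perturbed (b1 b2 a B C Omega eps t x y : R) : R :=
  m b1 b2 x + a + eps * (B * cos (Omega * t) - C / x ^ 3 * y).

Definition unperturbed_saddle (b1 b2 a xsa : R) : Prop :=
  0 < xsa /\
  saddle (fun x1 x2 => x2) (fun x1 x2 => m b1 b2 x1 + a) xsa 0.

(* The first alternative of the last conjunct gives Gamma_l, the second one
   Gamma_r. *)
Definition homoclinic_loop (b1 b2 a xsa : R) (x1 x2 : R -> R) : Prop :=
  solution (unperturbed b1 b2 a) x1 x2 /\
  (forall t, E b1 b2 a (x1 t) (x2 t) = E b1 b2 a xsa 0) /\
  is_lim x1 p_infty xsa /\ is_lim x2 p_infty 0 /\
  is_lim x1 m_infty xsa /\ is_lim x2 m_infty 0 /\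
  ((forall t, x1 t < xsa) \/ (forall t, xsa < x1 t)).

Definition xi1 (Omega : R) (x2 : R -> R) : R :=
  - 2 * RInt_gen (fun t => sin (Omega * t) * x2 t)
          (at_point 0) (Rbar_locally p_infty).

Definition xi2 (x1 x2 : R -> R) : R :=
  - RInt_gen (fun t => x2 t ^ 2 / x1 t ^ 3)
      (Rbar_locally m_infty) (Rbar_locally p_infty).

(* The linearization of x'' = F t x x' along (x, y), in the unknown (u, v). *)
Definition variational_solution (F : R -> R -> R -> R) (x y u v : R -> R)
    : Prop :=
  forall t,
    is_derive u t (v t) /\
    is_derive v t (Derive (fun s => F t s (y t)) (x t) * u t
                   + Derive (fun s => F t (x t) s) (y t) * v t).

(* The matrix with rows (u1 t, u2 t) and (v1 t, v2 t) is the fundamental matrix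
   of the variational equation that is the identity at t = 0; its value at
   t = T is the monodromy matrix, whose complex eigenvalues are the Floquet
   multipliers. *)
Definition hyperbolic (F : R -> R -> R -> R) (T : R) (x y : R -> R) : Prop :=
  exists u1 v1 u2 v2 : R -> R,
    variational_solution F x y u1 v1 /\ u1 0 = 1 /\ v1 0 = 0 /\
    variational_solution F x y u2 v2 /\ u2 0 = 0 /\ v2 0 = 1 /\
    forall mu c1 c2 : C,
      (c1, c2) <> (RtoC 0, RtoC 0) ->
      (RtoC (u1 T) * c1 + RtoC (u2 T) * c2 = mu * c1)%C ->
      (RtoC (v1 T) * c1 + RtoC (v2 T) * c2 = mu * c2)%C ->
      Cmod mu <> 1.

(* A branch of hyperbolic T-periodic solutions (p eps, q eps) of
   x'' = F eps t x x', continuous in eps uniformly in time, that starts at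
   eps = 0 from the equilibrium (xsa, 0). *)
Definition saddle_continuation (F : R -> R -> R -> R -> R) (T xsa eps0 : R)
    (p q : R -> R -> R) : Prop :=
  (forall t, p 0 t = xsa /\ q 0 t = 0) /\
  (forall eps, 0 <= eps < eps0 ->
     solution (F eps) (p eps) (q eps) /\
     (forall t, p eps (t + T) = p eps t /\ q eps (t + T) = q eps t) /\
     hyperbolic (F eps) T (p eps) (q eps)) /\
  (forall eps, 0 <= eps < eps0 ->
     forall eta, 0 < eta ->
     exists d, 0 < d /\
       forall eps', 0 <= eps' < eps0 -> Rabs (eps' - eps) < d ->
       forall t, Rabs (p eps' t - p eps t) < eta /\
                 Rabs (q eps' t - q eps t) < eta).

Definition homoclinic_to (F : R -> R -> R -> R) (p q z w : R -> R) : Prop :=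
  solution F z w /\
  (exists t, (z t, w t) <> (p t, q t)) /\
  is_lim (fun t => z t - p t) p_infty 0 /\
  is_lim (fun t => w t - q t) p_infty 0 /\
  is_lim (fun t => z t - p t) m_infty 0 /\
  is_lim (fun t => w t - q t) m_infty 0.

(* Convergence of the orbits of (z eps, w eps) to the orbit of (x1, x2) in the
   Hausdorff distance of the (x, x')-plane, as eps tends to 0 from the right. *)
Definition orbits_tend_to (z w : R -> R -> R) (x1 x2 : R -> R) : Prop :=
  forall eta, 0 < eta ->
  exists d, 0 < d /\
    forall eps, 0 < eps < d ->
      (forall t, exists s, Rabs (z eps t - x1 s) < eta /\
                           Rabs (w eps t - x2 s) < eta) /\
      (forall s, exists t, Rabs (z eps t - x1 s) < eta /\
                           Rabs (w eps t - x2 s) < eta).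

Definition persists (F : R -> R -> R -> R -> R) (T xsa : R) (x1 x2 : R -> R)
    : Prop :=
  exists (eps0 : R) (p q z w : R -> R -> R),
    0 < eps0 /\
    saddle_continuation F T xsa eps0 p q /\
    (forall eps, 0 < eps < eps0 ->
       homoclinic_to (F eps) (p eps) (q eps) (z eps) (w eps)) /\
    orbits_tend_to z w x1 x2.

(* Main.v *)
(* The linearization along Gamma has a bounded one-sided inverse on the
   half-line, so a contraction yields, for every phase th of the forcing, the
   orbit of the stable manifold of the continued saddle that crosses the axis
   x' = 0 at time 0, at (z_s(th), 0), within O(eps) of Gamma. Time reversal,
   which maps (C, th) to (- C, - th) and preserves the even loop, gives the
   unstable counterpart z_u. To first order in eps the distance z_s - z_u is a
   nonzero multiple of eps times the Melnikov function B sin th xi1 + C xi2. The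
   hypothesis makes its signs at th = pi/2 and th = - pi/2 opposite, and
   z_s - z_u is continuous in th, so it vanishes for some th; there the two
   half-orbits glue to a homoclinic solution.

   Near the saddle, the squared difference V of two solutions satisfies
   V'' >= lam^2 V. Hence bounded solutions on the whole line are unique, so the
   continued saddle is periodic, and solutions that stay near it are asymptotic
   to it. Its Floquet exponents are the means of the two bounded solutions of the
   Riccati equation of the variational equation, one positive and one negative. *)
Require Import Defs.
From Stdlib Require Import Reals Lra Lia Psatz ClassicalEpsilon.
From Coquelicot Require Import Coquelicot.
Open Scope R_scope.

(** * Continuity and differential inequalities *)

(** A single contraction on the whole line cannot produce the homoclinic orbit: the linearization
    along the loop is self-adjoint with bounded kernel spanned by [x2], so it is solvable only under
    an orthogonality condition against [x2]. On a half-line the condition disappears, because the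
    value at 0 absorbs it, and the kernel is removed by the crossing condition at time 0, a valid
    normalization since [x2] has nonzero slope there. The obstruction survives as the position at 0,
    which variation of constants expresses through the integral of [x2] against the forcing. No
    flow, Poincare map or invariant manifold theorem enters.

    The unknown of the contraction is the inhomogeneity [h] of the linear equation, not the
    displacement, so sup norms of continuous functions suffice. One abstract statement covers the
    equilibrium on the whole line and the loop on the half-line; the half-line is encoded by
    functions of [Rabs t], which keeps everything continuous on the whole line. The phase [th] sits
    in the forcing while the loop stays fixed; a translation of time by [th / Omega] restores phase
    0 at the end. *)

Lemma continuous_add (f g : R -> R) x :
  continuous f x -> continuous g x -> continuous (fun t => f t + g t) x.
Proof. intros; now apply (continuous_plus f g x). Qed.

Lemma continuous_sub (f g : R -> R) x :
  continuous f x -> continuous g x -> continuous (fun t => f t - g t) x.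
Proof. intros; now apply (continuous_minus f g x). Qed.

Lemma continuous_neg (f : R -> R) x :
  continuous f x -> continuous (fun t => - f t) x.
Proof. intros; now apply (continuous_opp f x). Qed.

Lemma continuous_mul (f g : R -> R) x :
  continuous f x -> continuous g x -> continuous (fun t => f t * g t) x.
Proof. intros; now apply (continuous_mult f g x). Qed.

Lemma continuous_power (f : R -> R) n x :
  continuous f x -> continuous (fun t => f t ^ n) x.
Proof.
intros Hf; induction n as [|n IH]; simpl.
- apply continuous_const.
- now apply continuous_mul.
Qed.

Lemma continuous_div (f g : R -> R) x :
  continuous f x -> continuous g x -> g x <> 0 ->
  continuous (fun t => f t / g t) x.
Proof.
intros Hf Hg Hx; apply continuous_mul; trivial.
now apply continuous_Rinv_comp.
Qed.

Lemma derive_continuous (f : R -> R) x l : is_derive f x l -> continuous f x.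
Proof. intros H; apply (ex_derive_continuous f); now exists l. Qed.

Lemma continuous_cont_pt (f : R -> R) x : continuous f x -> continuity_pt f x.
Proof. intros; now apply continuity_pt_filterlim. Qed.

Lemma continuous_exp_comp (f : R -> R) x :
  continuous f x -> continuous (fun t => exp (f t)) x.
Proof.
intros H; apply (continuous_comp f exp); trivial.
apply (derive_continuous _ _ (exp (f x))); apply is_derive_exp.
Qed.

Lemma continuous_cos_comp (f : R -> R) x :
  continuous f x -> continuous (fun t => cos (f t)) x.
Proof. intros H; apply (continuous_comp f cos); trivial; apply continuous_cos. Qed.

Ltac real_equation := match goal with |- ?a = ?b => change (@eq R a b) end.

Ltac continuous_tac :=
  lazymatch goal with
  | |- continuous (fun _ => ?c) _ => apply continuous_const
  | |- continuous (fun x => x) _ => apply continuous_id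
  | |- continuous (fun x => @?f x + @?g x) _ => apply (continuous_add f g); continuous_tac
  | |- continuous (fun x => @?f x - @?g x) _ => apply (continuous_sub f g); continuous_tac
  | |- continuous (fun x => - @?f x) _ => apply (continuous_neg f); continuous_tac
  | |- continuous (fun x => @?f x * @?g x) _ => apply (continuous_mul f g); continuous_tac
  | |- continuous (fun x => @?f x ^ ?n) _ => apply (continuous_power f n); continuous_tac
  | |- continuous (fun x => @?f x / @?g x) _ => apply (continuous_div f g); [continuous_tac | continuous_tac | ]
  | |- continuous (fun x => exp (@?f x)) _ => apply (continuous_exp_comp f); continuous_tac
  | |- continuous (fun x => cos (@?f x)) _ => apply (continuous_cos_comp f); continuous_tac
  | H : forall t, continuous ?f t |- continuous ?f _ => apply H
  | H : forall t, continuous ?f t |- continuous (fun x => ?f x) _ => apply H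
  | H : forall t, continuous ?f t |- continuous (fun x => ?f (@?g x)) _ =>
      apply (continuous_comp g f); [continuous_tac | apply H]
  | |- _ => idtac
  end.

Lemma exp_le_mono x y : x <= y -> exp x <= exp y.
Proof. intros [H | ->]; [now apply Rlt_le, exp_increasing | apply Rle_refl]. Qed.

Lemma derive_ge0_le (f df : R -> R) a b :
  (forall x, a <= x <= b -> is_derive f x (df x)) ->
  (forall x, a <= x <= b -> 0 <= df x) -> a <= b -> f a <= f b.
Proof.
intros Hd Hp Hab.
destruct (MVT_gen f a b df) as [c [Hc E]].
- intros x; rewrite Rmin_left, Rmax_right by lra; intros; apply Hd; lra.
- intros x; rewrite Rmin_left, Rmax_right by lra; intros.
  apply continuous_cont_pt, (derive_continuous _ _ (df x)), Hd; lra.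
- rewrite Rmin_left, Rmax_right in Hc by lra.
  assert (0 <= df c) by (apply Hp; lra). nra.
Qed.

Lemma derive_bound_lipschitz (f df : R -> R) a b L :
  (forall x, Rmin a b <= x <= Rmax a b -> is_derive f x (df x)) ->
  (forall x, Rmin a b <= x <= Rmax a b -> Rabs (df x) <= L) ->
  Rabs (f b - f a) <= L * Rabs (b - a).
Proof.
intros Hd Hb.
destruct (MVT_gen f a b df) as [c [Hc E]].
- intros x Hx; apply Hd; lra.
- intros x Hx; apply continuous_cont_pt, (derive_continuous _ _ (df x)), Hd, Hx.
- rewrite E, Rabs_mult. apply Rmult_le_compat_r; [apply Rabs_pos|auto].
Qed.

Lemma derive_weighted_exp (f : R -> R) k x l :
  is_derive f x l ->
  is_derive (fun t => f t * exp (k * t)) x ((l + k * f x) * exp (k * x)).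
Proof.
intros H.
evar_last.
- apply (is_derive_mult (K := R_AbsRing) f (fun t => exp (k * t)) x l (k * exp (k * x))); trivial.
  + auto_derive; trivial; ring.
  + intros; apply Rmult_comm.
- unfold plus, mult; simpl; ring.
Qed.

(* With [S = V' + k V] one has [S' >= k S]; were [S] positive anywhere, [S],
   and then [V], would grow exponentially. *)
Lemma bounded_convex_derive_le (V V1 V2 : R -> R) k tau M :
  0 < k ->
  (forall t, tau <= t -> is_derive V t (V1 t)) ->
  (forall t, tau <= t -> is_derive V1 t (V2 t)) ->
  (forall t, tau <= t -> k ^ 2 * V t <= V2 t) ->
  (forall t, tau <= t -> Rabs (V t) <= M) ->
  forall t, tau <= t -> V1 t <= - k * V t.
Proof.
intros Hk H1 H2 H3 HM t0 Ht0.
destruct (Rle_or_lt (V1 t0) (- k * V t0)) as [|Hlt]; trivial; exfalso.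
set (s0 := (V1 t0 + k * V t0) * exp (- k * t0)).
assert (s0pos : 0 < s0) by (apply Rmult_lt_0_compat; [lra | apply exp_pos]).
assert (HS : forall t, t0 <= t -> s0 <= (V1 t + k * V t) * exp (- k * t)).
{ intros t Ht; unfold s0.
  apply (derive_ge0_le (fun t => (V1 t + k * V t) * exp (- k * t))
    (fun t => ((V2 t + k * V1 t) + (- k) * (V1 t + k * V t)) * exp (- k * t))); trivial.
  - intros x Hx; apply (derive_weighted_exp (fun t => V1 t + k * V t)).
    apply (is_derive_plus V1 (fun t => k * V t)); [apply H2; lra|].
    apply (is_derive_scal V x k (V1 x)), H1; lra.
  - intros x Hx; apply Rmult_le_pos; [|apply Rlt_le, exp_pos].
    assert (k ^ 2 * V x <= V2 x) by (apply H3; lra). nra. }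
(* Integrating [(V exp (k t))' = S exp (k t)] with [S >= s0 exp (k t)] bounds [V] below by a growing
   exponential. *)
assert (HV : forall t, t0 <= t ->
   V t0 * exp (k * t0) - s0 / (2 * k) * exp (2 * k * t0) <= V t * exp (k * t) - s0 / (2 * k) * exp (2 * k * t)).
{ intros t Ht.
  apply (derive_ge0_le (fun t => V t * exp (k * t) - s0 / (2 * k) * exp (2 * k * t))
     (fun t => (V1 t + k * V t) * exp (k * t) - s0 * exp (2 * k * t))); trivial.
  - intros x Hx.
    apply (is_derive_minus (fun t => V t * exp (k * t)) (fun t => s0 / (2 * k) * exp (2 * k * t))).
    + apply (derive_weighted_exp V), H1; lra.
    + auto_derive; trivial; field; lra.
  - intros x Hx. assert (Hs := HS x (proj1 Hx)).
    assert (E1 : exp (2 * k * x) = exp (k * x) * exp (k * x)) by (rewrite <- exp_plus; f_equal; ring).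
    assert (E2 : exp (- k * x) * exp (k * x) = 1) by (rewrite <- exp_plus, <- exp_0; f_equal; ring).
    assert (Hp := exp_pos (k * x)).
    assert (s0 * exp (k * x) <= V1 x + k * V x).
    { replace (V1 x + k * V x) with ((V1 x + k * V x) * (exp (- k * x) * exp (k * x))) by (rewrite E2; ring).
      nra. }
    rewrite E1; nra. }
set (c := V t0 * exp (k * t0) - s0 / (2 * k) * exp (2 * k * t0)) in HV.
assert (sk : 0 < s0 / (2 * k)) by (apply Rdiv_lt_0_compat; lra).
assert (Hbig : forall t, t0 <= t -> 0 <= t -> s0 / (2 * k) * exp (k * t) <= M + Rabs c).
{ intros t Ht Ht'. specialize (HV t Ht).
  assert (E1 : exp (2 * k * t) = exp (k * t) * exp (k * t)) by (rewrite <- exp_plus; f_equal; ring).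
  rewrite E1 in HV.
  assert (1 <= exp (k * t)) by (rewrite <- exp_0; apply exp_le_mono; nra).
  assert (HM' := HM t ltac:(lra)). apply Rabs_le_between in HM'.
  assert (Hc := Rabs_maj2 c). assert (Hc' := Rabs_pos c).
  assert (Hp := exp_pos (k * t)).
  apply Rmult_le_reg_r with (exp (k * t)); trivial. nra. }
(* Since [exp (k t) >= 1 + k t], any nonnegative [t >= t0] with [k t >= A] contradicts the bound. *)
set (A := (M + Rabs c) / (s0 / (2 * k)) ).
set (t := Rmax (Rmax t0 0) (A / k)).
assert (Ht : t0 <= t /\ 0 <= t /\ A / k <= t).
{ unfold t; repeat split; (eapply Rle_trans; [|apply Rmax_l]; apply Rmax_l || apply Rmax_r) || apply Rmax_r. }
specialize (Hbig t (proj1 Ht) (proj1 (proj2 Ht))).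
assert (HA : A <= k * t).
{ destruct Ht as (_ & _ & Ht). apply (Rmult_le_compat_l k) in Ht; [|lra].
  replace (k * (A / k)) with A in Ht by (field; lra). exact Ht. }
assert (HE := exp_ineq1_le (k * t)).
assert (s0 / (2 * k) * A = M + Rabs c) by (unfold A; field; lra).
nra.
Qed.

(** Gronwall: [V exp (k t)] is nonincreasing. The sign of [k] is free; a negative [k] gives the
    growth bounds used for the symmetry of the loop and for the norm of its tangent vector. *)
Lemma decay_of_derive_le (V V1 : R -> R) k tau :
  (forall t, tau <= t -> is_derive V t (V1 t)) ->
  (forall t, tau <= t -> V1 t <= - k * V t) ->
  forall t, tau <= t -> V t <= V tau * exp (- k * (t - tau)).
Proof.
intros H1 H2 t Ht.
assert (H : - (V tau * exp (k * tau)) <= - (V t * exp (k * t))).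
{ apply (derive_ge0_le (fun t => - (V t * exp (k * t))) (fun t => - ((V1 t + k * V t) * exp (k * t)))); trivial.
  - intros x Hx; apply (is_derive_opp (fun t => V t * exp (k * t))), (derive_weighted_exp V), H1; lra.
  - intros x Hx. assert (Hp := exp_pos (k * x)). specialize (H2 x (proj1 Hx)). nra. }
assert (E1 : exp (- k * (t - tau)) * exp (k * t) = exp (k * tau)) by (rewrite <- exp_plus; f_equal; ring).
assert (Hp := exp_pos (k * t)).
apply Rmult_le_reg_r with (exp (k * t)); trivial.
rewrite Rmult_assoc, E1; lra.
Qed.

Lemma bounded_by_all_decay_le0 x M k :
  0 < k -> (forall s, 0 <= s -> x <= M * exp (- k * s)) -> x <= 0.
Proof.
intros Hk H.
destruct (Rle_or_lt x 0) as [|Hx]; trivial; exfalso.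
assert (HM : 0 < M).
{ specialize (H 0 (Rle_refl 0)). replace (- k * 0) with 0 in H by ring. rewrite exp_0 in H; lra. }
(* At [s = M / (k x)] the bound reads [x exp (M / x) <= M], against [exp (M / x) >= 1 + M / x]. *)
assert (Hs : 0 <= M / (k * x)) by (apply Rlt_le, Rdiv_lt_0_compat; nra).
specialize (H _ Hs).
assert (HE := exp_ineq1_le (k * (M / (k * x)))).
assert (E1 : exp (- k * (M / (k * x))) * exp (k * (M / (k * x))) = 1) by (rewrite <- exp_plus, <- exp_0; f_equal; ring).
assert (E2 : k * (M / (k * x)) = M / x) by (field; lra).
assert (E3 : M / x * x = M) by (field; lra).
rewrite E2 in *.
assert (Hp := exp_pos (M / x)).
assert (x * exp (M / x) <= M).
{ apply (Rmult_le_compat_r (exp (M / x))) in H; [|lra]. rewrite Rmult_assoc, E1 in H. lra. }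
nra.
Qed.

(** Decay is run forward from [t - s] with a bound independent of [s]; letting [s] grow leaves
    nothing at [t]. *)
Lemma bounded_contracting_zero (W W1 : R -> R) k M :
  0 < k ->
  (forall t, is_derive W t (W1 t)) -> (forall t, W1 t <= - k * W t) ->
  (forall t, 0 <= W t <= M) -> forall t, W t = 0.
Proof.
intros Hk H1 H2 H3 t.
apply Rle_antisym; [|apply H3].
apply (bounded_by_all_decay_le0 _ M k Hk); intros s Hs.
eapply Rle_trans; [apply (decay_of_derive_le W W1 k (t - s)); auto; lra|].
replace (t - (t - s)) with s by ring.
apply Rmult_le_compat_r; [apply Rlt_le, exp_pos | apply H3].
Qed.

(* Landau: a bounded second derivative transfers the decay to the first one. *)
Lemma derive_tends_to_0 (d d1 d2 : R -> R) tau K :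
  (forall t, tau <= t -> is_derive d t (d1 t)) ->
  (forall t, tau <= t -> is_derive d1 t (d2 t)) ->
  (forall t, tau <= t -> Rabs (d2 t) <= K) ->
  is_lim d p_infty 0 -> is_lim d1 p_infty 0.
Proof.
intros H1 H2 HK Hl.
apply is_lim_spec; apply is_lim_spec in Hl; intros [eps Heps]; simpl in *.
set (K' := Rabs K + 1).
assert (HK0 : 0 < K') by (unfold K'; pose proof (Rabs_pos K); lra).
assert (HKK : K <= K') by (unfold K'; pose proof (RRle_abs K); lra).
(* Over a step [h] the derivative varies by at most [eps / 2], and its mean is below [eps / 4] once
   [d] is below [eps h / 8] at both ends. *)
set (h := eps / (2 * K')).
assert (Hh : 0 < h) by (apply Rdiv_lt_0_compat; lra).
assert (He : 0 < eps * h / 8) by nra.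
destruct (Hl (mkposreal _ He)) as [T HT]; simpl in HT.
exists (Rmax T tau); intros t Ht.
assert (T < t) by (eapply Rle_lt_trans; [apply Rmax_l | exact Ht]).
assert (tau < t) by (eapply Rle_lt_trans; [apply Rmax_r | exact Ht]).
destruct (MVT_gen d t (t + h) d1) as [c [Hc E]].
{ intros x; rewrite Rmin_left by lra; intros; apply H1; lra. }
{ intros x; rewrite Rmin_left by lra; intros.
  apply continuous_cont_pt, (derive_continuous _ _ (d1 x)), H1; lra. }
rewrite Rmin_left, Rmax_right in Hc by lra.
replace (t + h - t) with h in E by ring.
assert (HL : Rabs (d1 c - d1 t) <= K' * Rabs (c - t)).
{ apply (derive_bound_lipschitz d1 d2);
  intros x; rewrite Rmin_left, Rmax_right by lra; intros.
  - apply H2; lra.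
  - apply Rle_trans with K; trivial. apply HK; lra. }
rewrite (Rabs_pos_eq (c - t)) in HL by lra.
assert (K' * (c - t) <= eps / 2).
{ replace (eps / 2) with (K' * h) by (unfold h; field; lra). apply Rmult_le_compat_l; lra. }
assert (A1 := HT t ltac:(lra)). assert (A2 := HT (t + h) ltac:(lra)).
rewrite Rminus_0_r in *.
apply Rabs_lt_between in A1. apply Rabs_lt_between in A2.
apply Rabs_le_between in HL.
apply Rabs_lt_between.
assert (- (eps / 4) < d1 c < eps / 4).
{ split; apply Rmult_lt_reg_r with h; nra. }
lra.
Qed.

(** * Improper integrals and contractions *)

Definition improper (F : R -> R) : R := real (Lim (fun t => RInt F 0 t) p_infty).

(* [tail F t] is [- int_t^oo F], the primitive of [F] that vanishes at
   infinity. *)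
Definition tail (F : R -> R) (t : R) : R := RInt F 0 t - improper F.

(** The base point is a parameter because the estimate of a tail at time [t] uses domination from
    [t] on, with a constant [A] that may itself decay in [t]. *)
Definition exp_dominated (F : R -> R) (t0 A k : R) : Prop :=
  0 < k /\ (forall t, continuous F t) /\
  forall s, t0 <= s -> Rabs (F s) <= A * exp (- k * (s - t0)).

Lemma continuous_ex_RInt (F : R -> R) a b :
  (forall t, continuous F t) -> ex_RInt F a b.
Proof. intros H; apply (ex_RInt_continuous (V := R_CompleteNormedModule)); auto. Qed.

Lemma RInt_chasles (F : R -> R) a b c :
  (forall t, continuous F t) -> RInt F a b + RInt F b c = RInt F a c.
Proof. intros H; apply (RInt_Chasles (V := R_CompleteNormedModule) F); now apply continuous_ex_RInt. Qed.

Lemma RInt_diff (F : R -> R) a b c :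
  (forall t, continuous F t) -> @eq R (RInt F b c) (RInt F a c - RInt F a b).
Proof. intros H. pose proof (RInt_chasles F a b c H). lra. Qed.

Lemma derive_RInt (F : R -> R) a t :
  (forall s, continuous F s) -> is_derive (fun t => RInt F a t) t (F t).
Proof.
intros H; apply (is_derive_RInt F _ a); trivial.
apply filter_forall; intros x; apply (RInt_correct (V := R_CompleteNormedModule)).
now apply continuous_ex_RInt.
Qed.

Lemma RInt_exp_dominated F t0 A k u v :
  exp_dominated F t0 A k -> t0 <= u <= v ->
  Rabs (RInt F u v) <= A / k * (exp (- k * (u - t0)) - exp (- k * (v - t0))).
Proof.
intros (Hk & Hc & Hb) Huv.
assert (HI : is_RInt (fun s => A * exp (- k * (s - t0))) u v
   (minus ((fun s => - (A / k) * exp (- k * (s - t0))) v) ((fun s => - (A / k) * exp (- k * (s - t0))) u))).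
{ apply (is_RInt_derive (fun s => - (A / k) * exp (- k * (s - t0))) (fun s => A * exp (- k * (s - t0)))).
  - intros x _; auto_derive; trivial. unfold Rminus; field; lra.
  - intros x _; continuous_tac. }
eapply Rle_trans.
- apply (norm_RInt_le F (fun s => A * exp (- k * (s - t0))) u v).
  + apply (proj2 Huv).
  + intros x Hx; apply Hb; lra.
  + apply (RInt_correct (V := R_CompleteNormedModule)); now apply continuous_ex_RInt.
  + exact HI.
- unfold minus, plus, opp; simpl. right; ring.
Qed.

Lemma exp_dominated_A_ge0 F t0 A k : exp_dominated F t0 A k -> 0 <= A.
Proof.
intros (_ & _ & H). specialize (H t0 (Rle_refl _)).
replace (- k * (t0 - t0)) with 0 in H by ring. rewrite exp_0 in H.
pose proof (Rabs_pos (F t0)); lra.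
Qed.

Lemma exp_decay_lt k A eps :
  0 < k -> 0 <= A -> 0 < eps -> exists s0, 0 <= s0 /\ forall s, s0 <= s -> A * exp (- k * s) < eps.
Proof.
intros Hk HA He.
exists (A / (k * eps)); split.
{ apply Rmult_le_pos; trivial. apply Rlt_le, Rinv_0_lt_compat; nra. }
intros s Hs.
assert (A <= k * eps * s).
{ apply (Rmult_le_compat_l (k * eps)) in Hs; [|nra].
  replace (k * eps * (A / (k * eps))) with A in Hs by (field; lra). lra. }
assert (HE := exp_ineq1_le (k * s)). assert (Hp := exp_pos (k * s)).
assert (E1 : exp (- k * s) * exp (k * s) = 1) by (rewrite <- exp_plus, <- exp_0; f_equal; ring).
apply Rmult_lt_reg_r with (exp (k * s)); trivial.
rewrite Rmult_assoc, E1; nra.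
Qed.

Lemma improper_is_lim F t0 A k :
  exp_dominated F t0 A k -> is_lim (fun t => RInt F 0 t) p_infty (improper F).
Proof.
intros HF. assert (HA := exp_dominated_A_ge0 _ _ _ _ HF). destruct (HF) as (Hk & Hc & Hb).
assert (Hex : exists y : R, filterlim (fun t => RInt F 0 t) (Rbar_locally p_infty) (locally y)).
{ apply (filterlim_locally_cauchy (U := R_CompleteSpace)).
  intros [eps Heps]; simpl.
  destruct (exp_decay_lt k (A / k) eps) as [s0 [Hs0 Hs]]; trivial.
  { apply Rmult_le_pos; trivial. now apply Rlt_le, Rinv_0_lt_compat. }
  assert (Hle : forall u v, t0 + s0 < u -> u <= v -> Rabs (RInt F 0 v - RInt F 0 u) < eps).
  { intros u v Hu Huv.
    rewrite <- (RInt_diff F 0 u v Hc).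
    eapply Rle_lt_trans; [apply (RInt_exp_dominated F t0 A k); trivial; lra|].
    eapply Rle_lt_trans; [|apply (Hs (u - t0)); lra].
    assert (Hp := exp_pos (- k * (v - t0))).
    assert (0 <= A / k) by (apply Rmult_le_pos; [trivial|now apply Rlt_le, Rinv_0_lt_compat]). nra. }
  exists (fun t => t0 + s0 < t); split.
  - exists (t0 + s0); trivial.
  - intros u v Hu Hv. change (Rabs (RInt F 0 v - RInt F 0 u) < eps).
    destruct (Rle_or_lt u v); [now apply Hle|].
    rewrite Rabs_minus_sym; apply Hle; lra. }
destruct Hex as [y Hy].
unfold improper; rewrite (is_lim_unique _ _ (Finite y)); exact Hy.
Qed.

Lemma tail_derive F t : (forall s, continuous F s) -> is_derive (tail F) t (F t).
Proof.
intros H; unfold tail. evar_last.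
- apply (is_derive_minus (fun t => RInt F 0 t) (fun _ => improper F)).
  + now apply derive_RInt.
  + apply (is_derive_const (V := R_NormedModule)).
- unfold minus, plus, opp, zero; simpl; ring.
Qed.

Lemma tail_bound F t A k : exp_dominated F t A k -> Rabs (tail F t) <= A / k.
Proof.
intros HF. assert (Hl := improper_is_lim _ _ _ _ HF). assert (HA := exp_dominated_A_ge0 _ _ _ _ HF).
destruct (HF) as (Hk & Hc & Hb).
apply Rnot_lt_le; intros Hlt.
apply is_lim_spec in Hl.
assert (He : 0 < Rabs (tail F t) - A / k) by lra.
destruct (Hl (mkposreal _ He)) as [T HT]; simpl in HT.
set (v := Rmax (T + 1) t).
assert (v1 : T < v) by (assert (H := Rmax_l (T + 1) t); fold v in H; lra).
assert (v2 : t <= v) by apply Rmax_r.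
specialize (HT v v1).
assert (H1 := RInt_exp_dominated F t A k t v HF ltac:(lra)).
replace (- k * (t - t)) with 0 in H1 by ring. rewrite exp_0 in H1.
assert (Hp := exp_pos (- k * (v - t))).
assert (0 <= A / k) by (apply Rmult_le_pos; [trivial|now apply Rlt_le, Rinv_0_lt_compat]).
assert (tail F t = (RInt F 0 v - improper F) - RInt F t v).
{ unfold tail. rewrite (RInt_diff F 0 t v Hc); ring. }
assert (Rabs (tail F t) <= Rabs (RInt F 0 v - improper F) + Rabs (RInt F t v)).
{ rewrite H0. unfold Rminus at 1. eapply Rle_trans; [apply Rabs_triang|]. rewrite Rabs_Ropp; lra. }
nra.
Qed.

Lemma improper_linear F G t0 A k t1 B l c :
  exp_dominated F t0 A k -> exp_dominated G t1 B l ->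
  improper (fun t => F t + c * G t) = improper F + c * improper G.
Proof.
intros HF HG. assert (LF := improper_is_lim _ _ _ _ HF). assert (LG := improper_is_lim _ _ _ _ HG).
unfold improper at 1.
rewrite (is_lim_unique _ _ (Finite (improper F + c * improper G))); trivial.
apply (is_lim_ext (fun t => RInt F 0 t + c * RInt G 0 t)).
- intros t; symmetry.
  rewrite (RInt_plus (V := R_CompleteNormedModule) F (fun t => c * G t)).
  + rewrite (RInt_scal (V := R_CompleteNormedModule) G); [reflexivity|].
    apply continuous_ex_RInt, HG.
  + apply continuous_ex_RInt, HF.
  + apply continuous_ex_RInt; intros s. destruct HG as (_ & HG & _). continuous_tac.
- apply (is_lim_plus _ _ _ (Finite (improper F)) (Finite (c * improper G))); trivial.
  + apply (is_lim_scal_l (fun t => RInt G 0 t) c p_infty (improper G)); trivial.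
  + reflexivity.
Qed.

Lemma tail_sub F G t0 A k t1 B l t :
  exp_dominated F t0 A k -> exp_dominated G t1 B l ->
  tail F t - tail G t = tail (fun s => F s - G s) t.
Proof.
intros HF HG. unfold tail.
assert (HI := improper_linear F G t0 A k t1 B l (-1) HF HG).
assert (CF := proj1 (proj2 HF)). assert (CG := proj1 (proj2 HG)).
rewrite (RInt_minus (V := R_CompleteNormedModule) F G); try now apply continuous_ex_RInt.
assert (E : improper (fun s => F s - G s) = improper (fun t => F t + -1 * G t)).
{ unfold improper. rewrite (Lim_ext (fun t => RInt (fun s => F s - G s) 0 t) (fun t => RInt (fun s => F s + -1 * G s) 0 t)); trivial.
  intros y. apply RInt_ext; intros x _. change (F x - G x = F x + -1 * G x). ring. }
rewrite E, HI. change (RInt F 0 t - improper F - (RInt G 0 t - improper G) = RInt F 0 t - RInt G 0 t - (improper F + -1 * improper G)). ring.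
Qed.

Lemma improper_RInt_gen F t0 A k :
  exp_dominated F t0 A k ->
  is_RInt_gen F (at_point 0) (Rbar_locally p_infty) (improper F).
Proof.
intros HF P HP. assert (LF := improper_is_lim _ _ _ _ HF).
specialize (LF P HP). destruct HF as (_ & Hc & _).
apply (Filter_prod _ _ _ (fun x => x = 0) (fun t => P (RInt F 0 t))); trivial.
- reflexivity.
- intros x y -> Hy; simpl. exists (RInt F 0 y); split; trivial.
  apply (RInt_correct (V := R_CompleteNormedModule)); now apply continuous_ex_RInt.
Qed.

Lemma even_RInt_gen F t0 A k :
  exp_dominated F t0 A k -> (forall t, F (- t) = F t) ->
  is_RInt_gen F (Rbar_locally m_infty) (Rbar_locally p_infty) (2 * improper F).
Proof.
intros HF He.
replace (2 * improper F) with (plus (improper F) (improper F)) by (unfold plus; simpl; ring).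
apply (is_RInt_gen_Chasles (V := R_NormedModule) F 0 (improper F) (improper F)); [|now apply improper_RInt_gen with t0 A k].
intros P HP. assert (LF := improper_is_lim _ _ _ _ HF).
specialize (LF P HP). destruct HF as (_ & Hc & _).
destruct LF as [T HT].
apply (Filter_prod _ _ _ (fun t => t < - T) (fun x => x = 0)).
- now exists (- T).
- reflexivity.
(* By evenness the integral from [x < 0] to 0 equals the one from 0 to [- x], whose limit is
   known. *)
- intros x y Hx ->; simpl. exists (RInt F 0 (- x)); split; [|apply HT; lra].
  apply (is_RInt_ext (fun y => opp (opp (F (- y))))).
  { intros y _. rewrite opp_opp. apply He. }
  assert (H1 : is_RInt F (- 0) (- x) (RInt F 0 (- x))).
  { rewrite Ropp_0. apply (RInt_correct (V := R_CompleteNormedModule)); now apply continuous_ex_RInt. }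
  apply (is_RInt_comp_opp F) in H1.
  apply is_RInt_opp in H1. apply is_RInt_swap in H1.
  rewrite opp_opp in H1. exact H1.
Qed.

Lemma halving_iterate_limit (u : nat -> R) r :
  (forall n, Rabs (u (S n) - u n) <= r * (/ 2) ^ n) ->
  exists l, forall n, Rabs (l - u n) <= 2 * r * (/ 2) ^ n.
Proof.
intros H.
assert (Hpos : forall n, 0 < (/ 2) ^ n) by (intros; apply pow_lt; lra).
(* The subtracted geometric remainder makes the induction on [k] close. *)
assert (Hd : forall n k, Rabs (u (n + k)%nat - u n) <= 2 * r * (/ 2) ^ n - 2 * r * (/ 2) ^ (n + k)).
{ intros n k; induction k as [|k IH].
  - rewrite Nat.add_0_r, Rminus_diag, Rabs_R0; lra.
  - rewrite Nat.add_succ_r.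
    replace (u (S (n + k)) - u n) with ((u (S (n + k)) - u (n + k)%nat) + (u (n + k)%nat - u n)) by ring.
    eapply Rle_trans; [apply Rabs_triang|].
    specialize (H (n + k)%nat). simpl pow. lra. }
assert (Hr : 0 <= r).
{ specialize (H 0%nat); simpl in H. pose proof (Rabs_pos (u 1%nat - u 0%nat)); lra. }
assert (Hd' : forall n m, (n <= m)%nat -> Rabs (u m - u n) <= 2 * r * (/ 2) ^ n).
{ intros n m Hm. replace m with (n + (m - n))%nat by lia.
  eapply Rle_trans; [apply Hd|]. specialize (Hpos (n + (m - n))%nat). nra. }
assert (Hlim : ex_finite_lim_seq u).
{ apply ex_lim_seq_cauchy_corr. intros [eps He]; simpl.
  destruct (pow_lt_1_zero (/ 2) ltac:(rewrite Rabs_pos_eq; lra) (eps / (4 * r + 1)) ltac:(apply Rdiv_lt_0_compat; lra)) as [N HN].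
  assert (HNN : forall m, (N <= m)%nat -> Rabs (u m - u N) < eps / 2).
  { intros m Hm. eapply Rle_lt_trans; [apply Hd'; trivial|].
    specialize (HN N (le_n N)). specialize (Hpos N). rewrite Rabs_pos_eq in HN by lra.
    apply (Rmult_lt_compat_l (4 * r + 1)) in HN; [|lra].
    replace ((4 * r + 1) * (eps / (4 * r + 1))) with eps in HN by (field; lra). nra. }
  exists N; intros n m Hn Hm.
  replace (u n - u m) with ((u n - u N) - (u m - u N)) by ring.
  unfold Rminus at 1. eapply Rle_lt_trans; [apply Rabs_triang|]. rewrite Rabs_Ropp.
  assert (H1 := HNN n Hn); assert (H2 := HNN m Hm); lra. }
destruct Hlim as [l Hl]. exists l; intros n.
apply (is_lim_seq_le_loc (fun m => Rabs (u m - u n)) (fun _ => 2 * r * (/ 2) ^ n) (Rabs (l - u n)) (2 * r * (/ 2) ^ n)).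
- exists n; intros m Hm; now apply Hd'.
- apply (is_lim_seq_abs _ (Finite (l - u n))).
  apply (is_lim_seq_minus _ _ l (u n)); trivial; [apply is_lim_seq_const | reflexivity].
- apply is_lim_seq_const.
Qed.

Definition in_ball (r : R) (h : R -> R) : Prop :=
  (forall t, continuous h t) /\ forall t, Rabs (h t) <= r.

(** Banach's theorem for the sup norm, phrased with bounds [eta] valid at all times instead of
    suprema. The iterates start at 0; their geometric rate, uniform in [t], carries continuity and
    the radius over to the pointwise limit. *)
Lemma contraction_fixed_point (Phi : (R -> R) -> R -> R) r :
  0 <= r ->
  (forall h, in_ball r h -> in_ball r (Phi h)) ->
  (forall h g eta, in_ball r h -> in_ball r g ->
     (forall t, Rabs (h t - g t) <= eta) -> forall t, Rabs (Phi h t - Phi g t) <= / 2 * eta) ->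
  exists h, in_ball r h /\ forall t, h t = Phi h t.
Proof.
intros Hr Hself Hcontr.
assert (Hpos : forall n, 0 < (/ 2) ^ n) by (intros; apply pow_lt; lra).
set (u := fun n : nat => Nat.iter n Phi (fun _ => 0)).
assert (Hu : forall n, in_ball r (u n)).
{ induction n as [|n IH]; [|now apply Hself].
  split; intros t; simpl; [apply continuous_const | now rewrite Rabs_R0]. }
assert (Hstep : forall n t, Rabs (u (S n) t - u n t) <= r * (/ 2) ^ n).
{ induction n as [|n IH]; intros t.
  - replace (u 0%nat t) with 0 by reflexivity. rewrite Rminus_0_r; simpl. rewrite Rmult_1_r. apply (Hu 1%nat).
  - eapply Rle_trans.
    + apply (Hcontr (u (S n)) (u n) (r * (/ 2) ^ n)); auto.
    + simpl; lra. }
destruct (choice (fun t l => forall n, Rabs (l - u n t) <= 2 * r * (/ 2) ^ n)) as [h Hh].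
{ intros t; apply (halving_iterate_limit (fun n => u n t)); intros n; apply Hstep. }
assert (Hsmall : forall eps, 0 < eps -> exists n, 2 * r * (/ 2) ^ n < eps).
{ intros eps He.
  destruct (pow_lt_1_zero (/ 2) ltac:(rewrite Rabs_pos_eq; lra) (eps / (2 * r + 1)) ltac:(apply Rdiv_lt_0_compat; lra)) as [N HN].
  exists N. specialize (HN N (le_n N)). specialize (Hpos N). rewrite Rabs_pos_eq in HN by lra.
  apply (Rmult_lt_compat_l (2 * r + 1)) in HN; [|lra].
  replace ((2 * r + 1) * (eps / (2 * r + 1))) with eps in HN by (field; lra). nra. }
assert (Hball : in_ball r h).
{ split; intros t.
  - apply filterlim_locally; intros [eps He].
    destruct (Hsmall (eps / 3) ltac:(lra)) as [n Hn].
    assert (Hcn := proj1 (filterlim_locally _ _) (proj1 (Hu n) t) (mkposreal (eps / 3) ltac:(lra))).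
    apply (filter_imp (F := locally t)) with (2 := Hcn).
    intros y Hy. change (Rabs (u n y - u n t) < eps / 3) in Hy.
    change (Rabs (h y - h t) < eps).
    assert (H1 := Hh y n). assert (H2 := Hh t n).
    apply Rabs_le_between in H1. apply Rabs_le_between in H2. apply Rabs_lt_between in Hy.
    apply Rabs_lt_between. lra.
  - apply Rnot_lt_le; intros Hlt.
    destruct (Hsmall (Rabs (h t) - r) ltac:(lra)) as [n Hn].
    assert (H1 := Hh t n). assert (H2 := proj2 (Hu n) t).
    assert (Rabs (h t) <= Rabs (h t - u n t) + Rabs (u n t)).
    { replace (h t) with ((h t - u n t) + u n t) at 1 by ring. apply Rabs_triang. }
    lra. }
exists h; split; trivial. intros t.
apply Rminus_diag_uniq.
destruct (Req_dec (h t - Phi h t) 0) as [|Hne]; trivial; exfalso.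
assert (0 < Rabs (h t - Phi h t)) by now apply Rabs_pos_lt.
destruct (Hsmall (Rabs (h t - Phi h t) / 2) ltac:(lra)) as [n Hn].
assert (H1 := Hh t (S n)).
assert (H2 := Hcontr h (u n) (2 * r * (/ 2) ^ n) Hball (Hu n) (fun t => Hh t n) t).
change (Phi (u n) t) with (u (S n) t) in H2.
simpl pow in H1.
assert (Rabs (h t - Phi h t) <= Rabs (h t - u (S n) t) + Rabs (Phi h t - u (S n) t)).
{ rewrite (Rabs_minus_sym (Phi h t)).
  replace (h t - Phi h t) with ((h t - u (S n) t) + (u (S n) t - Phi h t)) by ring. apply Rabs_triang. }
lra.
Qed.

(** * The perturbation as a fixed point *)

Definition dm (b1 b2 x : R) : R := - 8 * b1 / x ^ 9 - 1 + 2 * b2 / x ^ 3.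

Lemma is_derive_m b1 b2 x : 0 < x -> is_derive (m b1 b2) x (dm b1 b2 x).
Proof.
intros Hx; unfold m, dm; auto_derive.
- repeat split; trivial; apply Rgt_not_eq; apply (pow_lt x 8 Hx) || apply (pow_lt x 2 Hx).
- field; lra.
Qed.

Lemma is_derive_dm b1 b2 x :
  0 < x -> is_derive (dm b1 b2) x (72 * b1 / x ^ 10 - 6 * b2 / x ^ 4).
Proof.
intros Hx; unfold dm; auto_derive.
- repeat split; trivial; apply Rgt_not_eq; apply (pow_lt x 9 Hx) || apply (pow_lt x 3 Hx).
- field; lra.
Qed.

Lemma is_derive_inv_cube x : 0 < x -> is_derive (fun x => / x ^ 3) x (- 3 / x ^ 4).
Proof.
intros Hx; auto_derive.
- apply Rgt_not_eq, (pow_lt x 3 Hx).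
- field; lra.
Qed.

Lemma inv_pow_le lo x n : 0 < lo <= x -> 0 < / x ^ n <= / lo ^ n.
Proof.
intros [H1 H2]; split.
- apply Rinv_0_lt_compat, pow_lt; lra.
- apply Rinv_le_contravar; [apply pow_lt; lra | apply pow_incr; lra].
Qed.

Lemma abs_scaled_inv_le c lo x n : 0 < lo <= x -> Rabs (c / x ^ n) <= Rabs c * / lo ^ n.
Proof.
intros H; unfold Rdiv; rewrite Rabs_mult; apply Rmult_le_compat_l; [apply Rabs_pos|].
destruct (inv_pow_le lo x n H); rewrite Rabs_pos_eq; lra.
Qed.

Lemma Rabs_diff_bound x y z w : Rabs x <= z -> Rabs y <= w -> Rabs (x - y) <= z + w.
Proof.
intros; unfold Rminus; eapply Rle_trans; [apply Rabs_triang|]; rewrite Rabs_Ropp; lra.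
Qed.

Lemma Rabs_sum_bound x y z w : Rabs x <= z -> Rabs y <= w -> Rabs (x + y) <= z + w.
Proof. intros; eapply Rle_trans; [apply Rabs_triang|]; lra. Qed.

Lemma Rabs_prod_bound x y z w : Rabs x <= z -> Rabs y <= w -> Rabs (x * y) <= z * w.
Proof. intros; rewrite Rabs_mult; apply Rmult_le_compat; trivial; apply Rabs_pos. Qed.

(** The derivatives involved are constants plus multiples of negative powers of [x], so a lower
    bound on [x] alone controls them, and the segment between two points above [lo] stays above
    [lo]. *)
Lemma lipschitz_bounds b1 b2 lo : 0 < lo ->
  exists L, 0 < L /\
    (forall x, lo <= x -> Rabs (dm b1 b2 x) <= L /\ Rabs (/ x ^ 3) <= L) /\
    (forall x y, lo <= x -> lo <= y ->
       Rabs (m b1 b2 x - m b1 b2 y) <= L * Rabs (x - y) /\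
       Rabs (dm b1 b2 x - dm b1 b2 y) <= L * Rabs (x - y) /\
       Rabs (/ x ^ 3 - / y ^ 3) <= L * Rabs (x - y)).
Proof.
intros Hlo.
set (L1 := Rabs (- 8 * b1) * / lo ^ 9 + 1 + Rabs (2 * b2) * / lo ^ 3).
set (L2 := Rabs (72 * b1) * / lo ^ 10 + Rabs (6 * b2) * / lo ^ 4).
set (L3 := 1 * / lo ^ 3). set (L4 := 3 * / lo ^ 4).
assert (P : forall c n, 0 <= Rabs c * / lo ^ n).
{ intros; apply Rmult_le_pos; [apply Rabs_pos | left; apply Rinv_0_lt_compat, pow_lt, Hlo]. }
assert (P1 : 0 < L1) by (unfold L1; pose proof (P (- 8 * b1) 9%nat); pose proof (P (2 * b2) 3%nat); lra).
assert (P2 : 0 <= L2) by (unfold L2; pose proof (P (72 * b1) 10%nat); pose proof (P (6 * b2) 4%nat); lra).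
assert (P3 : 0 < L3) by (apply Rmult_lt_0_compat; [lra | apply Rinv_0_lt_compat, pow_lt, Hlo]).
assert (P4 : 0 < L4) by (apply Rmult_lt_0_compat; [lra | apply Rinv_0_lt_compat, pow_lt, Hlo]).
assert (D1 : forall x, lo <= x -> Rabs (dm b1 b2 x) <= L1).
{ intros x Hx; unfold dm, L1. apply Rabs_sum_bound; [apply Rabs_diff_bound|].
  - now apply abs_scaled_inv_le.
  - rewrite Rabs_R1; lra.
  - now apply abs_scaled_inv_le. }
assert (D2 : forall x, lo <= x -> Rabs (72 * b1 / x ^ 10 - 6 * b2 / x ^ 4) <= L2).
{ intros x Hx; unfold L2. apply Rabs_diff_bound; now apply abs_scaled_inv_le. }
assert (D3 : forall x, lo <= x -> Rabs (/ x ^ 3) <= L3).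
{ intros x Hx; unfold L3. destruct (inv_pow_le lo x 3 ltac:(lra)); rewrite Rabs_pos_eq; lra. }
assert (D4 : forall x, lo <= x -> Rabs (- 3 / x ^ 4) <= L4).
{ intros x Hx; unfold L4. eapply Rle_trans; [now apply (abs_scaled_inv_le (- 3) lo)|].
  unfold L4; rewrite (Rabs_left (- 3)); lra. }
exists (L1 + L2 + L3 + L4); split; [lra|]; split.
{ intros x Hx; specialize (D1 x Hx); specialize (D3 x Hx); split; lra. }
intros x y Hx Hy.
assert (Hr : forall z, Rmin y x <= z -> lo <= z).
{ intros z Hz; eapply Rle_trans; [|exact Hz]; now apply Rmin_glb. }
assert (Hxy := Rabs_pos (x - y)).
repeat split.
- apply (derive_bound_lipschitz (m b1 b2) (dm b1 b2)); intros z [Hz _]; apply Hr in Hz.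
  + apply is_derive_m; lra.
  + specialize (D1 z Hz); lra.
- apply (derive_bound_lipschitz (dm b1 b2) (fun x => 72 * b1 / x ^ 10 - 6 * b2 / x ^ 4));
  intros z [Hz _]; apply Hr in Hz.
  + apply is_derive_dm; lra.
  + specialize (D2 z Hz); lra.
- apply (derive_bound_lipschitz (fun x => / x ^ 3) (fun x => - 3 / x ^ 4)); intros z [Hz _]; apply Hr in Hz.
  + apply is_derive_inv_cube; lra.
  + specialize (D4 z Hz); lra.
Qed.

Lemma cos_lipschitz x y : Rabs (cos x - cos y) <= Rabs (x - y).
Proof.
rewrite <- (Rmult_1_l (Rabs (x - y))).
apply (derive_bound_lipschitz cos (fun x => - sin x)).
- intros z _; apply is_derive_cos.
- intros z _; rewrite Rabs_Ropp; apply Rabs_le; apply SIN_bound.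
Qed.

(** The derivative of the second-order remainder is [dm (x + u) - dm x], of size [L rho]; this small
    factor is what makes the fixed point map contract. *)
Lemma m_taylor b1 b2 lo L x u u' rho :
  0 < lo -> (forall x y, lo <= x -> lo <= y -> Rabs (dm b1 b2 x - dm b1 b2 y) <= L * Rabs (x - y)) ->
  0 <= L -> lo <= x - rho -> Rabs u <= rho -> Rabs u' <= rho ->
  Rabs ((m b1 b2 (x + u) - dm b1 b2 x * u) - (m b1 b2 (x + u') - dm b1 b2 x * u')) <= L * rho * Rabs (u - u').
Proof.
intros Hlo Hd HL Hx Hu Hu'.
apply Rabs_le_between in Hu. apply Rabs_le_between in Hu'.
assert (Hr : forall z, Rmin u' u <= z <= Rmax u' u -> - rho <= z <= rho).
{ intros z [H1 H2]; split; eapply Rle_trans; [|exact H1|exact H2|].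
  - apply Rmin_glb; lra.
  - apply Rmax_lub; lra. }
apply (derive_bound_lipschitz (fun u => m b1 b2 (x + u) - dm b1 b2 x * u)
  (fun u => dm b1 b2 (x + u) - dm b1 b2 x)).
- intros z Hz; apply Hr in Hz. apply (is_derive_minus (fun u => m b1 b2 (x + u)) (fun u => dm b1 b2 x * u)).
  + evar_last. apply (is_derive_comp (m b1 b2) (fun u => x + u)).
    * apply is_derive_m; lra.
    * auto_derive; trivial.
    * unfold scal; simpl; unfold mult; simpl; ring.
  + auto_derive; trivial; ring.
- intros z Hz; apply Hr in Hz.
  eapply Rle_trans; [apply Hd; lra|].
  apply Rmult_le_compat_l; trivial. replace (x + z - x) with z by ring. apply Rabs_le; lra.
Qed.

Definition force (B C Om th s x y : R) : R := B * cos (Om * s + th) - C / x ^ 3 * y.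

(** What is left after linearizing at a reference solution [(x, y)] of the unperturbed system: the
    displacement [(u, v)] satisfies [u'' = m'(x) u + remainder]. *)
Definition remainder (b1 b2 B C Om eps th s x y u v : R) : R :=
  m b1 b2 (x + u) - m b1 b2 x - dm b1 b2 x * u
  + eps * force B C Om th s (x + u) (y + v).

Lemma remainder_0 b1 b2 B C Om eps th s x y :
  remainder b1 b2 B C Om eps th s x y 0 0 = eps * force B C Om th s x y.
Proof. unfold remainder; rewrite !Rplus_0_r; ring. Qed.

(** The three estimates serve the contraction (Lipschitz constant of order [rho + eps]), the
    invariant ball (size of order [eps] at zero displacement) and the dependence of the fixed point
    on [eps] and [th]. *)
Lemma remainder_bounds b1 b2 B C Om lo Ymax : 0 < lo -> 0 <= Ymax ->
  exists L, 0 < L /\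
    (forall eps th s x y u v u' v' rho delta, 0 <= eps -> lo <= x - rho -> rho <= 1 ->
       Rabs y <= Ymax -> Rabs u <= rho -> Rabs v <= rho -> Rabs u' <= rho -> Rabs v' <= rho ->
       Rabs (u - u') <= delta -> Rabs (v - v') <= delta ->
       Rabs (remainder b1 b2 B C Om eps th s x y u v - remainder b1 b2 B C Om eps th s x y u' v')
         <= L * (rho + eps) * delta) /\
    (forall eps th s x y, 0 <= eps -> lo <= x -> Rabs y <= Ymax ->
       Rabs (remainder b1 b2 B C Om eps th s x y 0 0) <= L * eps) /\
    (forall eps th eps' th' s x y u v rho, 0 <= eps' <= 1 -> lo <= x - rho -> rho <= 1 ->
       Rabs y <= Ymax -> Rabs u <= rho -> Rabs v <= rho ->
       Rabs (remainder b1 b2 B C Om eps th s x y u v - remainder b1 b2 B C Om eps' th' s x y u v)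
         <= L * (Rabs (eps - eps') + Rabs (th - th'))).
Proof.
intros Hlo HY.
destruct (lipschitz_bounds b1 b2 lo Hlo) as (L & HL & Hb & Hl).
set (L1 := L + Rabs C * (L * (Ymax + 1) + L) + Rabs B).
assert (HB := Rabs_pos B). assert (HC := Rabs_pos C).
assert (Q1 : 0 <= Rabs C * L) by (apply Rmult_le_pos; lra).
assert (Q2 : 0 <= Rabs C * L * Ymax) by (apply Rmult_le_pos; lra).
assert (Hforce : forall th s x y, lo <= x -> Rabs y <= Ymax + 1 -> Rabs (force B C Om th s x y) <= L1).
{ intros th s x y Hx Hy; unfold force.
  apply Rle_trans with (Rabs B * 1 + Rabs C * (L * (Ymax + 1))); [|unfold L1; nra].
  apply Rabs_diff_bound.
  - apply Rabs_prod_bound; [lra|]. apply Rabs_le, COS_bound.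
  - unfold Rdiv; rewrite Rmult_assoc. apply Rabs_prod_bound; [lra|]. apply Rabs_prod_bound; trivial. now apply Hb. }
exists L1; repeat split.
- unfold L1; nra.
- intros eps th s x y u v u' v' rho delta He Hx Hrho Hy Hu Hv Hu' Hv' Hdu Hdv.
  assert (Hu0 := Hu). assert (Hu0' := Hu'). apply Rabs_le_between in Hu0. apply Rabs_le_between in Hu0'.
  assert (Hrho0 : 0 <= rho) by (pose proof (Rabs_pos u); lra).
  assert (Hd0 : 0 <= delta) by (pose proof (Rabs_pos (u - u')); lra).
  unfold remainder, force.
  match goal with |- Rabs ?X <= _ => replace X with
    (((m b1 b2 (x + u) - dm b1 b2 x * u) - (m b1 b2 (x + u') - dm b1 b2 x * u'))
     - eps * (C * ((/ (x + u) ^ 3 - / (x + u') ^ 3) * (y + v) + / (x + u') ^ 3 * (v - v')))) by (unfold Rdiv; ring) end.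
  apply Rle_trans with (L * rho * delta + eps * (Rabs C * ((L * delta) * (Ymax + 1) + L * delta))).
  + apply Rabs_diff_bound.
    * eapply Rle_trans; [apply (m_taylor b1 b2 lo L x u u' rho); trivial; try lra|].
      -- intros x' y' Hx' Hy'; now apply Hl.
      -- apply Rmult_le_compat_l; trivial; nra.
    * apply Rabs_prod_bound; [rewrite Rabs_pos_eq; lra|].
      apply Rabs_prod_bound; [lra|].
      apply Rabs_sum_bound; apply Rabs_prod_bound; trivial.
      -- eapply Rle_trans; [apply Hl; lra|]. apply Rmult_le_compat_l; [lra|].
         replace (x + u - (x + u')) with (u - u') by ring; trivial.
      -- apply Rabs_sum_bound; lra.
      -- apply Hb; lra.
  + unfold L1.
    assert (0 <= rho * delta) by nra. assert (0 <= eps * delta) by nra.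
    replace ((L + Rabs C * (L * (Ymax + 1) + L) + Rabs B) * (rho + eps) * delta) with
      (L * rho * delta + eps * (Rabs C * ((L * delta) * (Ymax + 1) + L * delta)) + (Rabs C * (L * (Ymax + 1) + L) + Rabs B) * (rho * delta) + (L + Rabs B) * (eps * delta)) by ring.
    assert (0 <= Rabs C * (L * (Ymax + 1) + L) + Rabs B) by nra.
    assert (0 <= L + Rabs B) by nra.
    assert (0 <= (Rabs C * (L * (Ymax + 1) + L) + Rabs B) * (rho * delta)) by (apply Rmult_le_pos; trivial).
    assert (0 <= (L + Rabs B) * (eps * delta)) by (apply Rmult_le_pos; trivial).
    lra.
- intros eps th s x y He Hx Hy. rewrite remainder_0, Rmult_comm.
  apply Rabs_prod_bound; [|rewrite Rabs_pos_eq; lra]. apply Hforce; lra.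
- intros eps th eps' th' s x y u v rho He Hx Hrho Hy Hu Hv.
  assert (Hu0 := Hu). apply Rabs_le_between in Hu0.
  unfold remainder.
  match goal with |- Rabs ?X <= _ => replace X with
    ((eps - eps') * force B C Om th s (x + u) (y + v) + eps' * (B * (cos (Om * s + th) - cos (Om * s + th')))) by (unfold force; ring) end.
  rewrite Rmult_plus_distr_l.
  apply Rabs_sum_bound.
  + rewrite Rmult_comm. apply Rabs_prod_bound; [|lra]. apply Hforce; [lra|].
    apply Rabs_sum_bound; lra.
  + apply Rle_trans with (1 * (Rabs B * Rabs (th - th'))).
    * apply Rabs_prod_bound; [rewrite Rabs_pos_eq; lra|].
      apply Rabs_prod_bound; [lra|].
      eapply Rle_trans; [apply cos_lipschitz|]. right; f_equal; ring.
    * assert (Ht := Rabs_pos (th - th')). unfold L1.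
      rewrite Rmult_1_l. apply Rmult_le_compat_r; trivial.
      assert (0 <= Rabs C * (L * (Ymax + 1) + L)) by nra. lra.
Qed.

(** The supremum [s] of [Rabs (d t)] is finite by the a priori bound and satisfies
    [s <= s / 2 + delta]. *)
Lemma self_improving_bound (d : R -> R) eta0 delta :
  (forall t, Rabs (d t) <= eta0) ->
  (forall eta, (forall t, Rabs (d t) <= eta) -> forall t, Rabs (d t) <= / 2 * eta + delta) ->
  forall t, Rabs (d t) <= 2 * delta.
Proof.
intros H0 H t.
destruct (completeness (fun x => exists t, x = Rabs (d t))) as [s [Hs1 Hs2]].
- exists eta0; intros x [t' ->]; apply H0.
- now exists (Rabs (d t)), t.
- assert (Hs : forall t, Rabs (d t) <= s) by (intros t'; apply Hs1; now exists t').
  assert (s <= / 2 * s + delta).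
  { apply Hs2; intros x [t' ->]; now apply H. }
  specialize (Hs t); lra.
Qed.

(* [G1 h] is a solution of [u'' = c u + h] and [G2 h] its derivative. The
   estimates are only required on the range of [pi], which is the whole line for
   [pi = id] and the half-line [t >= 0] for [pi = Rabs]. *)
Record linear_solver (c pi : R -> R) (K : R) (G1 G2 : (R -> R) -> R -> R) : Prop := {
  solver_derive1 : forall h r, in_ball r h -> forall t, is_derive (G1 h) t (G2 h t);
  solver_derive2 : forall h r, in_ball r h ->
    forall t, is_derive (G2 h) t (c t * G1 h t + h t);
  solver_bound : forall h r, in_ball r h ->
    forall t, Rabs (G1 h (pi t)) <= K * r /\ Rabs (G2 h (pi t)) <= K * r;
  solver_lipschitz : forall h g r eta, in_ball r h -> in_ball r g ->
    (forall t, Rabs (h t - g t) <= eta) ->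
    forall t, Rabs (G1 h (pi t) - G1 g (pi t)) <= K * eta /\
              Rabs (G2 h (pi t) - G2 g (pi t)) <= K * eta }.

(** For [pi = Rabs] the fixed point [h] is even, and the displacement it generates is a solution
    only at nonnegative times, where [pi t = t]. *)
Definition forcing_fixed_point b1 b2 B C Om (X Y pi : R -> R) G1 G2 r eps th (h : R -> R) : Prop :=
  in_ball r h /\
  forall t, h t = remainder b1 b2 B C Om eps th (pi t) (X (pi t)) (Y (pi t)) (G1 h (pi t)) (G2 h (pi t)).

Lemma continuous_comp_m b1 b2 (f : R -> R) t :
  continuous f t -> 0 < f t -> continuous (fun s => m b1 b2 (f s)) t.
Proof.
intros Hf Hp; apply (continuous_comp f (m b1 b2)); trivial.
now apply (derive_continuous _ _ (dm b1 b2 (f t))), is_derive_m.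
Qed.

Lemma continuous_comp_dm b1 b2 (f : R -> R) t :
  continuous f t -> 0 < f t -> continuous (fun s => dm b1 b2 (f s)) t.
Proof.
intros Hf Hp; apply (continuous_comp f (dm b1 b2)); trivial.
now eapply derive_continuous; apply is_derive_dm.
Qed.

Lemma forcing_fixed_points b1 b2 B C Om lo Ymax X Y pi K G1 G2 :
  0 < lo -> 0 <= Ymax -> 0 < K ->
  (forall t, continuous X t) -> (forall t, continuous Y t) -> (forall t, continuous pi t) ->
  (forall t, 2 * lo <= X (pi t)) -> (forall t, Rabs (Y (pi t)) <= Ymax) ->
  linear_solver (fun t => dm b1 b2 (X t)) pi K G1 G2 ->
  exists eps0 M, 0 < eps0 <= 1 /\ 0 < M /\ K * (M * eps0) <= lo /\
    (forall eps th, 0 <= eps < eps0 ->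
       exists h, forcing_fixed_point b1 b2 B C Om X Y pi G1 G2 (M * eps) eps th h) /\
    (forall eps th h eps' th' h', 0 <= eps < eps0 -> 0 <= eps' < eps0 ->
       forcing_fixed_point b1 b2 B C Om X Y pi G1 G2 (M * eps) eps th h ->
       forcing_fixed_point b1 b2 B C Om X Y pi G1 G2 (M * eps') eps' th' h' ->
       forall t, Rabs (h t - h' t) <= M * (Rabs (eps - eps') + Rabs (th - th'))) /\
    (exists M', forall eps th h, 0 <= eps < eps0 ->
       forcing_fixed_point b1 b2 B C Om X Y pi G1 G2 (M * eps) eps th h ->
       forall t, Rabs (h t - eps * force B C Om th (pi t) (X (pi t)) (Y (pi t))) <= M' * eps ^ 2).
Proof.
intros Hlo HY HK HcX HcY Hcpi HX HYb HG.
destruct (remainder_bounds b1 b2 B C Om lo Ymax Hlo HY) as (L & HL & Hlip & Hzero & Hpar).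
(* The map sends 0 to a function of size [L eps] and halves distances, so the ball of radius
   [2 L eps] is invariant. *)
set (M := 2 * L).
set (Q := L * (K * M + 1) * K).
assert (HM : 0 < M) by (unfold M; lra).
assert (HKM : 0 < K * M) by nra.
assert (HQ : 0 < Q) by (unfold Q; repeat apply Rmult_lt_0_compat; lra).
(* The four bounds: [eps0 <= 1], contraction factor at most one half, displacement at most 1, and
   displacement at most [lo], which keeps the perturbed orbit above [lo]. *)
set (eps0 := Rmin (Rmin 1 (/ (2 * Q))) (Rmin (/ (K * M)) (lo / (K * M)))).
assert (He0 : 0 < eps0).
{ unfold eps0; repeat apply Rmin_glb_lt; try lra; try apply Rinv_0_lt_compat; try lra.
  apply Rdiv_lt_0_compat; lra. }
assert (He1 : eps0 <= 1) by (unfold eps0; eapply Rle_trans; apply Rmin_l).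
assert (He2 : Q * eps0 <= / 2).
{ apply Rle_trans with (Q * / (2 * Q)); [|right; field; lra].
  apply Rmult_le_compat_l; [lra|]. unfold eps0; eapply Rle_trans; [apply Rmin_l | apply Rmin_r]. }
assert (He3 : K * M * eps0 <= 1).
{ apply Rle_trans with (K * M * / (K * M)); [|right; field; lra].
  apply Rmult_le_compat_l; [lra|]. unfold eps0; eapply Rle_trans; [apply Rmin_r | apply Rmin_l]. }
assert (He4 : K * M * eps0 <= lo).
{ apply Rle_trans with (K * M * (lo / (K * M))); [|right; field; lra].
  apply Rmult_le_compat_l; [lra|]. unfold eps0; eapply Rle_trans; [apply Rmin_r | apply Rmin_r]. }
assert (Hq : forall eps, 0 <= eps < eps0 -> L * (K * (M * eps0) + eps) * K <= / 2).
{ intros eps He. eapply Rle_trans; [|exact He2]. unfold Q.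
  replace (L * (K * M + 1) * K * eps0) with (L * (K * (M * eps0) + eps0) * K) by ring.
  apply Rmult_le_compat_r; [lra|]. apply Rmult_le_compat_l; lra. }
assert (Hrho : forall eps h, 0 <= eps < eps0 -> in_ball (M * eps) h ->
   forall t, Rabs (G1 h (pi t)) <= K * (M * eps0) /\ Rabs (G2 h (pi t)) <= K * (M * eps0)).
{ intros eps h He Hh t. destruct (solver_bound _ _ _ _ _ HG h _ Hh t) as [H1 H2].
  assert (K * (M * eps) <= K * (M * eps0)) by (apply Rmult_le_compat_l; [lra|]; apply Rmult_le_compat_l; lra).
  split; lra. }
assert (HXlo : forall t, lo <= X (pi t) - K * (M * eps0)) by (intros t; specialize (HX t); lra).
exists eps0, M; repeat split; trivial; try lra.
- intros eps th He.
  set (Phi := fun h t => remainder b1 b2 B C Om eps th (pi t) (X (pi t)) (Y (pi t)) (G1 h (pi t)) (G2 h (pi t))).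
  assert (Hcon : forall h g eta, in_ball (M * eps) h -> in_ball (M * eps) g ->
     (forall t, Rabs (h t - g t) <= eta) -> forall t, Rabs (Phi h t - Phi g t) <= / 2 * eta).
  { intros h g eta Hh Hg Hd t. unfold Phi.
    assert (Heta : 0 <= eta) by (specialize (Hd 0); pose proof (Rabs_pos (h 0 - g 0)); lra).
    destruct (solver_lipschitz _ _ _ _ _ HG h g _ eta Hh Hg Hd t) as [D1 D2].
    destruct (Hrho eps h He Hh t) as [B1 B2]. destruct (Hrho eps g He Hg t) as [B3 B4].
    eapply Rle_trans; [apply (Hlip eps th (pi t) (X (pi t)) (Y (pi t)) _ _ _ _ (K * (M * eps0)) (K * eta)); trivial; lra|].
    specialize (Hq eps He).
    replace (L * (K * (M * eps0) + eps) * (K * eta)) with (L * (K * (M * eps0) + eps) * K * eta) by ring.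
    apply Rmult_le_compat_r; trivial. }
  destruct (contraction_fixed_point Phi (M * eps)) as [h [Hh Hfix]].
  + nra.
  + intros h Hh; split; intros t.
    * assert (c1 : forall t, continuous (G1 h) t) by (intros s; eapply derive_continuous; eapply (solver_derive1 _ _ _ _ _ HG); eauto).
      assert (c2 : forall t, continuous (G2 h) t) by (intros s; eapply derive_continuous; eapply (solver_derive2 _ _ _ _ _ HG); eauto).
      destruct (Hrho eps h He Hh t) as [B1 _]. apply Rabs_le_between in B1.
      specialize (HX t).
      unfold Phi, remainder, force.
      assert (cX : continuous (fun t => X (pi t)) t) by continuous_tac.
      assert (cG : continuous (fun t => X (pi t) + G1 h (pi t)) t) by continuous_tac.
      apply continuous_add; [apply continuous_sub; [apply continuous_sub|]|].
      -- apply continuous_comp_m; trivial; lra.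
      -- apply continuous_comp_m; trivial; lra.
      -- apply continuous_mul; [|continuous_tac]. apply (continuous_comp_dm b1 b2 (fun t => X (pi t))); trivial; lra.
      -- continuous_tac. apply pow_nonzero; lra.
    * assert (H0 : in_ball (M * eps) (fun _ => 0)).
      { split; [intros; apply continuous_const | intros; rewrite Rabs_R0; nra]. }
      assert (HD : forall t, Rabs (h t - 0) <= M * eps) by (intros s; rewrite Rminus_0_r; apply Hh).
      assert (HC := Hcon h (fun _ => 0) (M * eps) Hh H0 HD t).
      assert (HZ : Rabs (Phi (fun _ => 0) t) <= L * eps).
      { unfold Phi.
        destruct (solver_bound _ _ _ _ _ HG (fun _ => 0) 0) with (t := t) as [Z1 Z2].
        { split; [intros; apply continuous_const | intros; rewrite Rabs_R0; lra]. }
        assert (forall x, Rabs x <= K * 0 -> x = 0).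
        { intros x Hx. rewrite Rmult_0_r in Hx. destruct (Req_dec x 0); trivial.
          pose proof (Rabs_pos_lt x); lra. }
        rewrite (H _ Z1), (H _ Z2). apply Hzero; trivial; try lra. specialize (HX t); lra. }
      assert (Rabs (Phi h t) <= Rabs (Phi h t - Phi (fun _ => 0) t) + Rabs (Phi (fun _ => 0) t)).
      { replace (Phi h t) with ((Phi h t - Phi (fun _ => 0) t) + Phi (fun _ => 0) t) at 1 by ring. apply Rabs_triang. }
      unfold M in *; lra.
  + exact Hcon.
  + exists h; split; trivial.
- intros eps th h eps' th' h' He He' [Hh Hf] [Hh' Hf'].
  replace (fun t => Rabs (h t - h' t)) with (fun t => Rabs ((fun t => h t - h' t) t)) by reflexivity.
  replace (M * (Rabs (eps - eps') + Rabs (th - th'))) with (2 * (L * (Rabs (eps - eps') + Rabs (th - th')))) by (unfold M; ring).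
  assert (Hh0 : in_ball (M * eps0) h).
  { split; [apply Hh|]. intros t; eapply Rle_trans; [apply Hh|]. apply Rmult_le_compat_l; lra. }
  assert (Hh0' : in_ball (M * eps0) h').
  { split; [apply Hh'|]. intros t; eapply Rle_trans; [apply Hh'|]. apply Rmult_le_compat_l; lra. }
  apply (self_improving_bound (fun t => h t - h' t) (M * eps + M * eps')).
  + intros t; apply Rabs_diff_bound; [apply Hh | apply Hh'].
  + intros eta Hd t. cbv beta in *. rewrite (Hf t), (Hf' t).
    assert (Heta : 0 <= eta) by (specialize (Hd 0); pose proof (Rabs_pos (h 0 - h' 0)); lra).
    destruct (solver_lipschitz _ _ _ _ _ HG h h' _ eta Hh0 Hh0' Hd t) as [D1 D2].
    destruct (Hrho eps h He Hh t) as [B1 B2]. destruct (Hrho eps' h' He' Hh' t) as [B3 B4].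
    (* The displacement is varied at fixed parameters, and the parameters at fixed displacement. *)
    match goal with |- Rabs (?a - ?c) <= _ =>
      replace (a - c) with ((a - remainder b1 b2 B C Om eps th (pi t) (X (pi t)) (Y (pi t)) (G1 h' (pi t)) (G2 h' (pi t)))
        + (remainder b1 b2 B C Om eps th (pi t) (X (pi t)) (Y (pi t)) (G1 h' (pi t)) (G2 h' (pi t)) - c)) by ring end.
    apply Rabs_sum_bound.
    * eapply Rle_trans; [apply (Hlip eps th (pi t) (X (pi t)) (Y (pi t)) _ _ _ _ (K * (M * eps0)) (K * eta)); trivial; lra|].
      specialize (Hq eps He).
      replace (L * (K * (M * eps0) + eps) * (K * eta)) with (L * (K * (M * eps0) + eps) * K * eta) by ring.
      apply Rmult_le_compat_r; trivial.
    * apply (Hpar eps th eps' th' _ _ _ _ _ (K * (M * eps0))); trivial; lra.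
(* Comparison with zero displacement: the displacement is at most [K M eps] and the Lipschitz
   constant is [L (K M + 1) eps], so the product is quadratic in [eps]. *)
- exists (L * (K * M + 1) * (K * M)). intros eps th h He [Hh Hf] t.
  rewrite <- (remainder_0 b1 b2), (Hf t).
  destruct (solver_bound _ _ _ _ _ HG h _ Hh t) as [B1 B2].
  assert (K * (M * eps) <= K * (M * eps0)) by (apply Rmult_le_compat_l; [lra|]; apply Rmult_le_compat_l; lra).
  assert (0 <= K * (M * eps)) by (apply Rmult_le_pos; nra).
  eapply Rle_trans; [apply (Hlip eps th (pi t) (X (pi t)) (Y (pi t)) _ _ _ _ (K * (M * eps)) (K * (M * eps))); trivial; try (rewrite Rabs_R0; lra); try lra|].
  + specialize (HXlo t); lra.
  + rewrite Rminus_0_r; trivial.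
  + rewrite Rminus_0_r; trivial.
  + right; ring.
Qed.

(** * Bounded solutions of the linearized equations *)

Lemma in_ball_sub h g r eta :
  in_ball r h -> in_ball r g -> (forall t, Rabs (h t - g t) <= eta) -> in_ball eta (fun t => h t - g t).
Proof. intros [Hh _] [Hg _] Hd; split; trivial; intros t; continuous_tac. Qed.

Lemma linear_solver_of_sub c pi K G1 G2 :
  (forall h r, in_ball r h -> forall t, is_derive (G1 h) t (G2 h t)) ->
  (forall h r, in_ball r h -> forall t, is_derive (G2 h) t (c t * G1 h t + h t)) ->
  (forall h r, in_ball r h -> forall t, Rabs (G1 h (pi t)) <= K * r /\ Rabs (G2 h (pi t)) <= K * r) ->
  (forall h g r, in_ball r h -> in_ball r g -> forall t,
     G1 h t - G1 g t = G1 (fun s => h s - g s) t /\ G2 h t - G2 g t = G2 (fun s => h s - g s) t) ->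
  linear_solver c pi K G1 G2.
Proof.
intros H1 H2 H3 H4; constructor; trivial.
intros h g r eta Hh Hg Hd t. destruct (H4 h g r Hh Hg (pi t)) as [E1 E2].
rewrite E1, E2. apply H3. now apply in_ball_sub with r.
Qed.

(* The bounded solution of [y' = mu y + h], that is
   [- int_t^oo exp (mu (t - s)) h s ds]. *)
Definition growing_solver (mu : R) (h : R -> R) (t : R) : R :=
  exp (mu * t) * tail (fun s => exp (- mu * s) * h s) t.

(** By time reversal, the bounded solution of [y' = - mu y + h], that is
    [int_-oo^t exp (- mu (t - s)) h s ds]. *)
Definition decaying_solver (mu : R) (h : R -> R) (t : R) : R :=
  - growing_solver mu (fun s => h (- s)) (- t).

Lemma in_ball_reverse r h : in_ball r h -> in_ball r (fun s => h (- s)).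
Proof. intros [H1 H2]; split; intros t; trivial. continuous_tac. Qed.

Lemma exp_dominated_weighted mu h r t :
  0 < mu -> in_ball r h -> exp_dominated (fun s => exp (- mu * s) * h s) t (exp (- mu * t) * r) mu.
Proof.
intros Hmu [Hc Hb]; split; [trivial|split].
- intros s; continuous_tac.
- intros s Hs. rewrite Rabs_mult, (Rabs_pos_eq (exp _)) by apply Rlt_le, exp_pos.
  replace (exp (- mu * t) * r * exp (- mu * (s - t))) with (exp (- mu * s) * r).
  + apply Rmult_le_compat_l; trivial. apply Rlt_le, exp_pos.
  + replace (- mu * s) with (- mu * t + - mu * (s - t)) by ring. rewrite exp_plus; ring.
Qed.

Lemma growing_solver_derive mu h r t :
  in_ball r h -> is_derive (growing_solver mu h) t (mu * growing_solver mu h t + h t).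
Proof.
intros [Hc _].
assert (HT : is_derive (tail (fun s => exp (- mu * s) * h s)) t (exp (- mu * t) * h t)).
{ apply (tail_derive (fun s => exp (- mu * s) * h s)); intros s; continuous_tac. }
evar_last.
- apply (is_derive_ext (fun t => tail (fun s => exp (- mu * s) * h s) t * exp (mu * t))).
  + intros s; apply Rmult_comm.
  + apply (derive_weighted_exp (tail (fun s => exp (- mu * s) * h s))), HT.
- unfold growing_solver.
  rewrite Rmult_plus_distr_r, (Rmult_comm (exp _) (h t)), Rmult_assoc, <- exp_plus.
  replace (- mu * t + mu * t) with 0 by ring. rewrite exp_0; ring.
Qed.

Lemma growing_solver_bound mu h r t :
  0 < mu -> in_ball r h -> Rabs (growing_solver mu h t) <= / mu * r.
Proof.
intros Hmu Hh; unfold growing_solver.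
rewrite Rabs_mult, (Rabs_pos_eq (exp _)) by apply Rlt_le, exp_pos.
assert (HT := tail_bound _ _ _ _ (exp_dominated_weighted mu h r t Hmu Hh)).
apply (Rmult_le_compat_l (exp (mu * t))) in HT; [|apply Rlt_le, exp_pos].
eapply Rle_trans; [exact HT|]. unfold Rdiv. rewrite <- !Rmult_assoc, <- exp_plus.
replace (mu * t + - mu * t) with 0 by ring. rewrite exp_0; lra.
Qed.

Lemma tail_ext F G t : (forall s, F s = G s) -> tail F t = tail G t.
Proof.
intros H. unfold tail, improper.
assert (E : forall t, RInt F 0 t = RInt G 0 t) by (intros; apply RInt_ext; intros; apply H).
rewrite E, (Lim_ext _ _ _ E); reflexivity.
Qed.

Lemma growing_solver_sub mu h g r t :
  0 < mu -> in_ball r h -> in_ball r g ->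
  growing_solver mu h t - growing_solver mu g t = growing_solver mu (fun s => h s - g s) t.
Proof.
intros Hmu Hh Hg; unfold growing_solver.
rewrite <- Rmult_minus_distr_l.
rewrite (tail_sub _ _ _ _ _ _ _ _ t (exp_dominated_weighted mu h r t Hmu Hh) (exp_dominated_weighted mu g r t Hmu Hg)).
f_equal; apply tail_ext; intros; ring.
Qed.

Lemma is_derive_reverse (f : R -> R) t l :
  is_derive f (- t) l -> is_derive (fun s => f (- s)) t (- l).
Proof.
intros H. evar_last.
- apply (is_derive_comp f (fun s => - s)); [exact H|]. auto_derive; trivial.
- unfold scal; simpl; unfold mult; simpl; ring.
Qed.

Lemma decaying_solver_derive mu h r t :
  in_ball r h -> is_derive (decaying_solver mu h) t (- mu * decaying_solver mu h t + h t).
Proof.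
intros Hh; unfold decaying_solver. apply in_ball_reverse in Hh.
assert (HD := growing_solver_derive mu _ r (- t) Hh).
apply is_derive_reverse, is_derive_opp in HD.
rewrite (Ropp_involutive t) in HD. evar_last; [exact HD|].
change (- - (mu * growing_solver mu (fun s => h (- s)) (- t) + h t)
  = - mu * - growing_solver mu (fun s => h (- s)) (- t) + h t). ring.
Qed.

Lemma decaying_solver_bound mu h r t :
  0 < mu -> in_ball r h -> Rabs (decaying_solver mu h t) <= / mu * r.
Proof.
intros Hmu Hh; unfold decaying_solver; rewrite Rabs_Ropp.
apply growing_solver_bound; trivial. now apply in_ball_reverse.
Qed.

Lemma decaying_solver_sub mu h g r t :
  0 < mu -> in_ball r h -> in_ball r g ->
  decaying_solver mu h t - decaying_solver mu g t = decaying_solver mu (fun s => h s - g s) t.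
Proof.
intros Hmu Hh Hg; unfold decaying_solver.
rewrite <- (growing_solver_sub mu (fun s => h (- s)) (fun s => g (- s)) r); trivial; try now apply in_ball_reverse.
ring.
Qed.

(** Factorization of [u'' - lam ^ 2 u = h]: [u' + lam u] and [u' - lam u] solve the growing and the
    decaying first-order equation. *)
Definition saddle_solver1 (lam : R) (h : R -> R) (t : R) : R :=
  (growing_solver lam h t - decaying_solver lam h t) / (2 * lam).
Definition saddle_solver2 (lam : R) (h : R -> R) (t : R) : R :=
  (growing_solver lam h t + decaying_solver lam h t) / 2.

Lemma saddle_linear_solver lam :
  0 < lam ->
  linear_solver (fun _ => lam ^ 2) (fun t => t) (/ lam * / lam + / lam)
    (saddle_solver1 lam) (saddle_solver2 lam).
Proof.
intros Hlam. assert (Hi := Rinv_0_lt_compat _ Hlam).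
apply linear_solver_of_sub.
- intros h r Hh t. unfold saddle_solver1, saddle_solver2.
  assert (D1 := growing_solver_derive lam h r t Hh). assert (D2 := decaying_solver_derive lam h r t Hh).
  apply (is_derive_ext (fun t => / (2 * lam) * (growing_solver lam h t - decaying_solver lam h t))).
  { intros s; unfold Rdiv; apply Rmult_comm. }
  evar_last.
  + apply is_derive_scal. apply (is_derive_minus (growing_solver lam h) (decaying_solver lam h)); [exact D1 | exact D2].
  + unfold minus, plus, opp; simpl; field; lra.
- intros h r Hh t. unfold saddle_solver1, saddle_solver2.
  assert (D1 := growing_solver_derive lam h r t Hh). assert (D2 := decaying_solver_derive lam h r t Hh).
  apply (is_derive_ext (fun t => / 2 * (growing_solver lam h t + decaying_solver lam h t))).
  { intros s; unfold Rdiv; apply Rmult_comm. }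
  evar_last.
  + apply is_derive_scal. apply (is_derive_plus (growing_solver lam h) (decaying_solver lam h)); [exact D1 | exact D2].
  + unfold plus; simpl; field; lra.
- intros h r Hh t. unfold saddle_solver1, saddle_solver2.
  assert (B1 := growing_solver_bound lam h r t Hlam Hh). assert (B2 := decaying_solver_bound lam h r t Hlam Hh).
  assert (Hr : 0 <= r) by (destruct Hh as [_ Hh]; specialize (Hh 0); pose proof (Rabs_pos (h 0)); lra).
  assert (0 <= / lam * r) by nra. assert (0 <= / lam * / lam * r) by (apply Rmult_le_pos; nra).
  split.
  + apply Rle_trans with ((/ lam * r + / lam * r) * / (2 * lam)).
    * apply Rabs_prod_bound; [now apply Rabs_diff_bound|].
      rewrite Rabs_pos_eq; [apply Rle_refl|]. apply Rlt_le, Rinv_0_lt_compat; lra.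
    * rewrite Rinv_mult. lra.
  + apply Rle_trans with ((/ lam * r + / lam * r) * / 2).
    * apply Rabs_prod_bound; [now apply Rabs_sum_bound|]. rewrite Rabs_pos_eq; lra.
    * lra.
- intros h g r Hh Hg t. unfold saddle_solver1, saddle_solver2.
  rewrite <- (growing_solver_sub lam h g r t Hlam Hh Hg), <- (decaying_solver_sub lam h g r t Hlam Hh Hg).
  split; field; lra.
Qed.

(** One formula for both components of the loop solver, which differ by exchanging [p] with [q] and
    by the sign of [b]. *)
Lemma is_derive_frame (al b p q : R -> R) t al' b' p' q' :
  is_derive al t al' -> is_derive b t b' -> is_derive p t p' -> is_derive q t q' ->
  0 < p t ^ 2 + q t ^ 2 ->
  is_derive (fun s => al s * p s + b s * q s / (p s ^ 2 + q s ^ 2)) t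
    (al' * p t + al t * p'
     + ((b' * q t + b t * q') / (p t ^ 2 + q t ^ 2)
        - b t * q t * (2 * p t * p' + 2 * q t * q') / (p t ^ 2 + q t ^ 2) ^ 2)).
Proof.
intros D1 D2 D3 D4 Hn.
evar_last.
- auto_derive; [repeat split; try (eexists; eassumption); simpl in *; lra | reflexivity].
- replace (Derive (fun x => al x) t) with al' by (symmetry; now apply is_derive_unique).
  replace (Derive (fun x => b x) t) with b' by (symmetry; now apply is_derive_unique).
  replace (Derive (fun x => p x) t) with p' by (symmetry; now apply is_derive_unique).
  replace (Derive (fun x => q x) t) with q' by (symmetry; now apply is_derive_unique).
  field. simpl in *; lra.
Qed.

(** * The linearization along the loop, on the half-line *)

Section Loop_solver.
Variables (phi psi c : R -> R).

(* Coordinates of [(u, v)] along [(phi, psi)] and along the orthogonal vector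
   [(- psi, phi) / (phi^2 + psi^2)], which make a basis of Wronskian 1. *)
Definition normal_coord (h : R -> R) : R -> R := tail (fun s => phi s * h s).
(** The normal coordinate is the Wronskian of [(phi, psi)] and [(u, v)], with derivative [phi h]. It
    must vanish at infinity along with [(phi, psi)] when [(u, v)] is bounded, hence the [tail]. The
    condition [u' = v] then forces this derivative of the tangential coordinate. *)
Definition tangent_rate (h : R -> R) (s : R) : R :=
  (1 + c s) * normal_coord h s * (phi s ^ 2 - psi s ^ 2) / (phi s ^ 2 + psi s ^ 2) ^ 2
  + psi s * h s / (phi s ^ 2 + psi s ^ 2).
(** Integrated from 0 and not from infinity: the rate may grow like [/ w], which the factors [phi]
    and [psi] compensate, and starting at 0 is what realizes the crossing condition. *)
Definition tangent_coord (h : R -> R) (t : R) : R := RInt (tangent_rate h) 0 t.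
Definition loop_solver1 (h : R -> R) (t : R) : R :=
  tangent_coord h t * phi t - normal_coord h t * psi t / (phi t ^ 2 + psi t ^ 2).
Definition loop_solver2 (h : R -> R) (t : R) : R :=
  tangent_coord h t * psi t + normal_coord h t * phi t / (phi t ^ 2 + psi t ^ 2).

(** The weight [w] is comparable, at nonnegative times, with the norm of [(phi, psi)]. It decays
    exponentially up to the factor [K], which absorbs an initial interval where the loop is still
    far from the saddle. *)
Variables (w : R -> R) (k K : R).
Hypothesis Hk : 0 < k.
Hypothesis HK : 0 < K.
Hypothesis Hphi : forall t, is_derive phi t (psi t).
Hypothesis Hpsi : forall t, is_derive psi t (c t * phi t).
Hypothesis Hc : forall t, continuous c t.
Hypothesis Hn : forall t, 0 < phi t ^ 2 + psi t ^ 2.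
Hypothesis Hcb : forall t, 0 <= t -> Rabs (c t) <= K.
Hypothesis Hw : forall t, 0 <= t -> 0 < w t.
Hypothesis Hphiw : forall t, 0 <= t -> Rabs (phi t) <= K * w t.
Hypothesis Hpsiw : forall t, 0 <= t -> Rabs (psi t) <= K * w t.
Hypothesis Hnw : forall t, 0 <= t -> w t ^ 2 <= K * (phi t ^ 2 + psi t ^ 2).
Hypothesis Hwdecay : forall t s, 0 <= t <= s -> w s <= K * exp (- k * (s - t)) * w t.

Lemma phi_continuous t : continuous phi t.
Proof. eapply derive_continuous; apply Hphi. Qed.
Lemma psi_continuous t : continuous psi t.
Proof. eapply derive_continuous; apply Hpsi. Qed.

Lemma phi_exp_dominated h r t :
  in_ball r h -> 0 <= t -> exp_dominated (fun s => phi s * h s) t (K * K * w t * r) k.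
Proof.
intros [Hh Hb] Ht; split; [trivial|split].
- intros s. pose proof phi_continuous. continuous_tac.
- intros s Hs. replace (K * K * w t * r * exp (- k * (s - t))) with ((K * (K * exp (- k * (s - t)) * w t)) * r) by ring.
  apply Rabs_prod_bound; trivial.
  eapply Rle_trans; [apply Hphiw; lra|]. apply Rmult_le_compat_l; [lra|]. apply Hwdecay; lra.
Qed.

Lemma normal_coord_derive h r t : in_ball r h -> is_derive (normal_coord h) t (phi t * h t).
Proof.
intros [Hh _]. apply (tail_derive (fun s => phi s * h s)).
intros s. pose proof phi_continuous. continuous_tac.
Qed.

Lemma tangent_rate_continuous h r t : in_ball r h -> continuous (tangent_rate h) t.
Proof.
intros Hh. pose proof phi_continuous. pose proof psi_continuous.
assert (forall t, continuous (normal_coord h) t).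
{ intros s; eapply derive_continuous; eapply normal_coord_derive, Hh. }
destruct Hh as [Hh _]. unfold tangent_rate. specialize (Hn t).
continuous_tac; try apply pow_nonzero; lra.
Qed.

Lemma tangent_coord_derive h r t : in_ball r h -> is_derive (tangent_coord h) t (tangent_rate h t).
Proof. intros Hh; apply derive_RInt; intros; eapply tangent_rate_continuous, Hh. Qed.

Lemma normal_coord_bound h r t :
  in_ball r h -> 0 <= t -> Rabs (normal_coord h t) <= K * K * w t * r / k.
Proof. intros Hh Ht; apply tail_bound; now apply phi_exp_dominated. Qed.

Lemma ball_radius_ge0 h r : in_ball r h -> 0 <= r.
Proof. intros [_ H]; specialize (H 0); pose proof (Rabs_pos (h 0)); lra. Qed.

(** The numerator of the rate is at most [((1 + K) (K K / k) + K) r w], and dividing by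
    [phi ^ 2 + psi ^ 2 >= w ^ 2 / K] costs the factor [K / w ^ 2]. *)
Definition tangent_const : R := K * ((1 + K) * (K * K / k) + K).

Lemma tangent_const_pos : 0 < tangent_const.
Proof.
unfold tangent_const. assert (0 < K * K / k) by (apply Rdiv_lt_0_compat; nra). nra.
Qed.

Lemma div_norm_bound x y s A : 0 <= s -> Rabs x <= A * w s -> y = phi s ^ 2 + psi s ^ 2 ->
  Rabs (x / y) <= A * K / w s.
Proof.
intros Hs Hx ->. specialize (Hn s). specialize (Hw s Hs). specialize (Hnw s Hs).
assert (HA : 0 <= A) by (pose proof (Rabs_pos x); nra).
unfold Rdiv; rewrite Rabs_mult, (Rabs_pos_eq (/ _)) by (apply Rlt_le, Rinv_0_lt_compat; lra).
apply Rmult_le_reg_r with (phi s ^ 2 + psi s ^ 2); trivial.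
rewrite Rmult_assoc, Rinv_l by lra. rewrite Rmult_1_r.
eapply Rle_trans; [exact Hx|].
apply Rmult_le_reg_r with (w s); trivial.
replace (A * K * / w s * (phi s ^ 2 + psi s ^ 2) * w s) with (A * (K * (phi s ^ 2 + psi s ^ 2))) by (field; lra).
rewrite Rmult_assoc. apply Rmult_le_compat_l; trivial. lra.
Qed.

Lemma tangent_rate_bound h r s :
  in_ball r h -> 0 <= s -> Rabs (tangent_rate h s) <= tangent_const * r / w s.
Proof.
intros Hh Hs. assert (Hr := ball_radius_ge0 _ _ Hh).
assert (Hb := normal_coord_bound h r s Hh Hs).
assert (Hns := Hn s). assert (Hws := Hw s Hs).
set (n := phi s ^ 2 + psi s ^ 2) in *.
unfold tangent_rate; fold n.
replace ((1 + c s) * normal_coord h s * (phi s ^ 2 - psi s ^ 2) / n ^ 2 + psi s * h s / n)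
  with (((1 + c s) * normal_coord h s * ((phi s ^ 2 - psi s ^ 2) / n) + psi s * h s) / n) by (field; lra).
assert (Hq : Rabs ((phi s ^ 2 - psi s ^ 2) / n) <= 1).
{ unfold Rdiv; rewrite Rabs_mult, (Rabs_pos_eq (/ n)) by (apply Rlt_le, Rinv_0_lt_compat; lra).
  apply Rmult_le_reg_r with n; trivial. rewrite Rmult_assoc, Rinv_l by lra.
  rewrite Rmult_1_r, Rmult_1_l. unfold n. apply Rabs_le. pose proof (pow2_ge_0 (phi s)); pose proof (pow2_ge_0 (psi s)); lra. }
replace (tangent_const * r / w s) with ((((1 + K) * (K * K / k) + K) * r) * K / w s) by (unfold tangent_const; field; lra).
apply div_norm_bound; trivial.
replace ((((1 + K) * (K * K / k) + K) * r) * w s) with ((1 + K) * (K * K * w s * r / k) * 1 + (K * w s) * r) by (field; lra).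
apply Rabs_sum_bound; apply Rabs_prod_bound; trivial; try apply Rabs_prod_bound; trivial.
- apply Rabs_sum_bound; [rewrite Rabs_R1; lra | now apply Hcb].
- now apply Hpsiw.
- apply Hh.
Qed.

(** For [s <= t] one has [/ w s <= K exp (- k (t - s)) / w t]: the bound on the rate grows
    exponentially, so its integral is of the order of its value at the endpoint. *)
Lemma tangent_coord_bound h r t :
  in_ball r h -> 0 <= t -> Rabs (tangent_coord h t) <= tangent_const * K * r / k / w t.
Proof.
intros Hh Ht. assert (Hr := ball_radius_ge0 _ _ Hh). assert (HK1 := tangent_const_pos). assert (Hwt := Hw t Ht).
set (A := tangent_const * K * r / w t).
assert (HA : 0 <= A).
{ apply Rmult_le_pos; [|left; now apply Rinv_0_lt_compat]. apply Rmult_le_pos; nra. }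
assert (HI : is_RInt (fun s => A * exp (- k * (t - s))) 0 t
   (minus ((fun s => A / k * exp (- k * (t - s))) t) ((fun s => A / k * exp (- k * (t - s))) 0))).
{ apply (is_RInt_derive (fun s => A / k * exp (- k * (t - s))) (fun s => A * exp (- k * (t - s)))).
  - intros x _; auto_derive; trivial. unfold Rminus; field; lra.
  - intros x _; continuous_tac. }
eapply Rle_trans.
- apply (norm_RInt_le (tangent_rate h) (fun s => A * exp (- k * (t - s))) 0 t); trivial.
  + intros x Hx. eapply Rle_trans; [apply (tangent_rate_bound h r x); trivial; lra|].
    assert (Hwx := Hw x (proj1 Hx)). assert (HD := Hwdecay x t Hx). unfold A.
    apply Rmult_le_reg_r with (w x * w t); [now apply Rmult_lt_0_compat|].
    replace (tangent_const * r / w x * (w x * w t)) with (tangent_const * r * w t) by (field; lra).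
    replace (tangent_const * K * r / w t * exp (- k * (t - x)) * (w x * w t)) with (tangent_const * r * (K * exp (- k * (t - x)) * w x)) by (field; lra).
    apply Rmult_le_compat_l; trivial. nra.
  + apply (RInt_correct (V := R_CompleteNormedModule)), continuous_ex_RInt.
    intros s; eapply tangent_rate_continuous, Hh.
  + exact HI.
- unfold minus, plus, opp; simpl. replace (t - t) with 0 by ring. rewrite Rmult_0_r, exp_0.
  replace (tangent_const * K * r / k / w t) with (A / k) by (unfold A; field; lra).
  assert (0 <= A / k) by (apply Rmult_le_pos; [trivial|now apply Rlt_le, Rinv_0_lt_compat]).
  pose proof (exp_pos (- k * (t - 0))). nra.
Qed.

Lemma loop_solver_derive1 h r t : in_ball r h -> is_derive (loop_solver1 h) t (loop_solver2 h t).
Proof.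
intros Hh. unfold loop_solver1.
assert (D1 := tangent_coord_derive h r t Hh). assert (D2 := normal_coord_derive h r t Hh).
assert (D3 := Hphi t). assert (D4 := Hpsi t). assert (Hnt := Hn t).
assert (D2' := is_derive_opp _ _ _ D2).
evar_last.
- apply (is_derive_ext (fun s => tangent_coord h s * phi s + (- normal_coord h s) * psi s / (phi s ^ 2 + psi s ^ 2))).
  { intros s. specialize (Hn s). real_equation. field; simpl in *; lra. }
  exact (is_derive_frame _ _ _ _ _ _ _ _ _ D1 D2' D3 D4 Hnt).
- unfold loop_solver2, tangent_rate. change (opp (phi t * h t)) with (- (phi t * h t)). change (opp (normal_coord h t)) with (- normal_coord h t). real_equation. field. simpl in *; lra.
Qed.

Lemma loop_solver_derive2 h r t :
  in_ball r h -> is_derive (loop_solver2 h) t (c t * loop_solver1 h t + h t).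
Proof.
intros Hh. unfold loop_solver2.
assert (D1 := tangent_coord_derive h r t Hh). assert (D2 := normal_coord_derive h r t Hh).
assert (D3 := Hphi t). assert (D4 := Hpsi t). assert (Hnt := Hn t).
assert (Hnt' : 0 < psi t ^ 2 + phi t ^ 2) by lra.
evar_last.
- apply (is_derive_ext (fun s => tangent_coord h s * psi s + normal_coord h s * phi s / (psi s ^ 2 + phi s ^ 2))).
  { intros s. specialize (Hn s). real_equation. field; simpl in *; lra. }
  exact (is_derive_frame _ _ _ _ _ _ _ _ _ D1 D2 D4 D3 Hnt').
- unfold loop_solver1, tangent_rate. real_equation. field. simpl in *; lra.
Qed.

Lemma tangent_rate_sub h g r s :
  in_ball r h -> in_ball r g -> tangent_rate h s - tangent_rate g s = tangent_rate (fun t => h t - g t) s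
  /\ normal_coord h s - normal_coord g s = normal_coord (fun t => h t - g t) s.
Proof.
intros Hh Hg.
assert (E : normal_coord h s - normal_coord g s = normal_coord (fun t => h t - g t) s).
{ unfold normal_coord.
  rewrite (tail_sub _ _ _ _ _ _ _ _ s (phi_exp_dominated h r 0 Hh (Rle_refl 0)) (phi_exp_dominated g r 0 Hg (Rle_refl 0))).
  apply tail_ext; intros; ring. }
split; trivial.
unfold tangent_rate; rewrite <- E. specialize (Hn s). field. simpl in *; lra.
Qed.

Definition loop_solver_const : R := tangent_const * K * K / k + K * K * K * K / k.

Lemma loop_linear_solver : linear_solver c Rabs loop_solver_const loop_solver1 loop_solver2.
Proof.
apply linear_solver_of_sub.
- intros; eapply loop_solver_derive1; eassumption.
- intros; eapply loop_solver_derive2; eassumption.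
- intros h r Hh t. assert (Ht := Rabs_pos t). set (s := Rabs t) in *.
  assert (Hr := ball_radius_ge0 _ _ Hh). assert (Hws := Hw s Ht).
  assert (B1 := tangent_coord_bound h r s Hh Ht). assert (B2 := normal_coord_bound h r s Hh Ht).
  assert (B3 := Hphiw s Ht). assert (B4 := Hpsiw s Ht).
  assert (HB : forall z, Rabs z <= K * w s -> Rabs (tangent_coord h s * z) <= tangent_const * K * K / k * r).
  { intros z Hz. replace (tangent_const * K * K / k * r) with (tangent_const * K * r / k / w s * (K * w s)) by (field; lra).
    now apply Rabs_prod_bound. }
  assert (HB' : forall z, Rabs z <= K * w s -> Rabs (normal_coord h s * z / (phi s ^ 2 + psi s ^ 2)) <= K * K * K * K / k * r).
  { intros z Hz. replace (K * K * K * K / k * r) with ((K * K * w s * r / k * K) * K / w s) by (field; lra).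
    apply div_norm_bound; trivial. rewrite Rmult_assoc. now apply Rabs_prod_bound. }
  unfold loop_solver_const; rewrite Rmult_plus_distr_r. split.
  + apply Rabs_diff_bound; [now apply HB | now apply HB'].
  + apply Rabs_sum_bound; [now apply HB | now apply HB'].
- intros h g r Hh Hg t.
  destruct (tangent_rate_sub h g r t Hh Hg) as [_ E].
  assert (E' : tangent_coord h t - tangent_coord g t = tangent_coord (fun s => h s - g s) t).
  { unfold tangent_coord.
    symmetry; etransitivity;
      [|apply (RInt_minus (V := R_CompleteNormedModule) (tangent_rate h) (tangent_rate g) 0 t);
        apply continuous_ex_RInt; intros; eapply tangent_rate_continuous; eassumption].
    apply RInt_ext; intros x _; symmetry. now apply (tangent_rate_sub h g r x). }
  unfold loop_solver1, loop_solver2. rewrite <- E, <- E'. specialize (Hn t).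
  split; field; simpl in *; lra.
Qed.

(** With [phi 0 = 0] the frame is aligned with the axes at time 0. The tangential coordinate
    vanishes there and the normal one is minus the integral of [phi h]: this is where the Melnikov
    integral originates. *)
Lemma loop_solver_at_0 h : phi 0 = 0 ->
  psi 0 * loop_solver1 h 0 = improper (fun s => phi s * h s) /\ loop_solver2 h 0 = 0.
Proof.
intros H0. specialize (Hn 0).
unfold loop_solver1, loop_solver2, tangent_coord, normal_coord, tail.
rewrite !RInt_point, H0. rewrite H0 in Hn. change zero with 0.
split; real_equation; field; simpl in *; nra.
Qed.

End Loop_solver.

(** * Riccati equation and Floquet multipliers *)

Lemma decaying_solver_continuous mu h r t : in_ball r h -> continuous (decaying_solver mu h) t.
Proof. intros Hh; eapply derive_continuous, decaying_solver_derive, Hh. Qed.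

Lemma is_derive_translate (f : R -> R) T t l :
  is_derive f (t + T) l -> is_derive (fun s => f (s + T)) t l.
Proof.
intros H. evar_last.
- apply (is_derive_comp f (fun s => s + T)); [exact H|]. auto_derive; trivial.
- unfold scal; simpl; unfold mult; simpl; ring.
Qed.

Lemma is_derive_square_diff (f g : R -> R) t f' g' :
  is_derive f t f' -> is_derive g t g' ->
  is_derive (fun s => (f s - g s) ^ 2) t (2 * (f t - g t) * (f' - g')).
Proof.
intros D1 D2. evar_last.
- auto_derive; [repeat split; eexists; eassumption | reflexivity].
- replace (Derive (fun x => f x) t) with f' by (symmetry; now apply is_derive_unique).
  replace (Derive (fun x => g x) t) with g' by (symmetry; now apply is_derive_unique).
  real_equation; ring.
Qed.

(** Writing [r = lam + rho] gives [rho' = - 2 lam rho + h] with a small [h], so [rho] is a bounded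
    solution obtained by contraction. The squared distance between [r] and its translate by [T]
    contracts at rate at least [lam] while staying bounded on the whole line, so it is zero. *)
Lemma periodic_riccati lam : 0 < lam ->
  exists delta, 0 < delta /\ forall (c e : R -> R) T,
    (forall t, continuous c t) -> (forall t, continuous e t) ->
    (forall t, c (t + T) = c t) -> (forall t, e (t + T) = e t) ->
    (forall t, Rabs (c t - lam ^ 2) <= delta) -> (forall t, Rabs (e t) <= delta) ->
    exists r, (forall t, is_derive r t (c t + e t * r t - r t ^ 2)) /\
      (forall t, r (t + T) = r t) /\ forall t, lam / 2 <= r t.
Proof.
intros Hlam.
assert (HD : 0 < 8 * (1 + 2 * lam)) by lra.
(* The first bound serves the contraction; the second keeps [c - lam ^ 2 + e (lam + rho)] below
   [lam ^ 2 / 8], half of the radius [r0]. *)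
set (delta := Rmin (lam / 2) (lam ^ 2 / (8 * (1 + 2 * lam)))).
assert (Hdelta : 0 < delta).
{ apply Rmin_glb_lt; [lra|]. apply Rdiv_lt_0_compat; nra. }
assert (Hd1 : delta <= lam / 2) by apply Rmin_l.
assert (Hd2 : delta * (1 + 2 * lam) <= lam ^ 2 / 8).
{ replace (lam ^ 2 / 8) with (lam ^ 2 / (8 * (1 + 2 * lam)) * (1 + 2 * lam)) by (field; lra).
  apply Rmult_le_compat_r; [lra | apply Rmin_r]. }
exists delta; split; trivial.
intros c e T cc ce Tc Te Hc He.
set (rho := decaying_solver (2 * lam)).
set (Phi := fun h t => (c t - lam ^ 2) + e t * (lam + rho h t) - rho h t ^ 2).
(* Through the factor [/ (2 lam)] of the solver, this radius gives [Rabs rho <= lam / 8]. *)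
set (r0 := lam ^ 2 / 4).
assert (Hrho : forall h, in_ball r0 h -> forall t, Rabs (rho h t) <= lam / 8).
{ intros h Hh t. eapply Rle_trans; [apply (decaying_solver_bound _ _ r0); trivial; lra|].
  right; unfold r0; field; lra. }
assert (Hr0 : 0 <= r0) by (unfold r0; nra).
destruct (contraction_fixed_point Phi r0) as [h [Hh Hfix]]; trivial.
- intros h Hh; split; intros t.
  + unfold Phi. assert (forall t, continuous (rho h) t) by (intros; now apply decaying_solver_continuous with r0).
    continuous_tac.
  + specialize (Hrho h Hh t). unfold Phi.
    assert (HR2 : Rabs (rho h t ^ 2) <= lam / 8 * (lam / 8)).
    { simpl; rewrite Rmult_1_r; now apply Rabs_prod_bound. }
    eapply Rle_trans; [apply Rabs_diff_bound; [apply Rabs_sum_bound; [apply Hc | apply Rabs_prod_bound; [apply He|]]|exact HR2]|].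
    * apply Rabs_sum_bound; [rewrite Rabs_pos_eq; [apply Rle_refl | lra] | exact Hrho].
    * unfold r0; nra.
- intros h g eta Hh Hg Hd t.
  assert (Heta : 0 <= eta) by (specialize (Hd 0); pose proof (Rabs_pos (h 0 - g 0)); lra).
  assert (HS : Rabs (rho h t - rho g t) <= / (2 * lam) * eta).
  { unfold rho. rewrite (decaying_solver_sub (2 * lam) h g r0); trivial; [|lra].
    apply decaying_solver_bound; [lra|]. now apply in_ball_sub with r0. }
  unfold Phi.
  match goal with |- Rabs ?X <= _ => replace X with ((e t - (rho h t + rho g t)) * (rho h t - rho g t)) by ring end.
  eapply Rle_trans; [apply Rabs_prod_bound; [apply Rabs_diff_bound; [apply He | apply Rabs_sum_bound; apply Hrho; trivial] | exact HS]|].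
  rewrite <- Rmult_assoc. apply Rmult_le_compat_r; trivial.
  apply Rmult_le_reg_r with (2 * lam); [lra|]. rewrite Rmult_assoc, Rinv_l by lra. lra.
- assert (HR := Hrho h Hh).
  assert (HRb : forall t, 7 / 8 * lam <= lam + rho h t <= 9 / 8 * lam).
  { intros t; specialize (HR t); apply Rabs_le_between in HR; lra. }
  assert (HRd : forall t, is_derive (fun t => lam + rho h t) t
    (c t + e t * (lam + rho h t) - (lam + rho h t) ^ 2)).
  { intros t. evar_last.
    - apply (is_derive_plus (fun _ => lam) (rho h)); [apply (is_derive_const (V := R_NormedModule))|].
      apply (decaying_solver_derive (2 * lam) h r0 t Hh).
    - change (0 + (- (2 * lam) * rho h t + h t) = c t + e t * (lam + rho h t) - (lam + rho h t) ^ 2).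
      rewrite Hfix at 1; unfold Phi; ring. }
  exists (fun t => lam + rho h t); split; [trivial|split].
  + intros t. apply Rminus_diag_uniq.
    set (r := fun t => lam + rho h t) in *.
    assert (HW : (r (t + T) - r t) ^ 2 = 0).
    { apply (bounded_contracting_zero (fun t => (r (t + T) - r t) ^ 2)
        (fun t => 2 * (r (t + T) - r t) * ((c t + e t * r (t + T) - r (t + T) ^ 2) - (c t + e t * r t - r t ^ 2))) lam (lam ^ 2)); trivial.
      - intros s. apply (is_derive_square_diff (fun s => r (s + T)) r).
        + apply (is_derive_translate r). rewrite <- (Tc s), <- (Te s). apply HRd.
        + apply HRd.
      - intros s. assert (B1 := HRb s). assert (B2 := HRb (s + T)). fold (r s) in B1. fold (r (s + T)) in B2.
        assert (B3 := He s). apply Rabs_le_between in B3.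
        assert (0 <= (r (s + T) - r s) ^ 2) by apply pow2_ge_0.
        replace (2 * (r (s + T) - r s) * (c s + e s * r (s + T) - r (s + T) ^ 2 - (c s + e s * r s - r s ^ 2)))
          with ((2 * (e s - r (s + T) - r s)) * (r (s + T) - r s) ^ 2) by ring.
        apply Rmult_le_compat_r; trivial. lra.
      - intros s. split; [apply pow2_ge_0|].
        assert (B1 := HRb s). assert (B2 := HRb (s + T)). fold (r s) in B1. fold (r (s + T)) in B2. nra. }
    destruct (Req_dec (r (t + T) - r t) 0) as [|Hne]; trivial.
    exfalso; revert HW; now apply pow_nonzero.
  + intros t; specialize (HRb t); lra.
Qed.

Lemma exp_primitive_derive (r : R -> R) t :
  (forall t, continuous r t) ->
  is_derive (fun t => exp (RInt r 0 t)) t (r t * exp (RInt r 0 t)).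
Proof.
intros Hr. evar_last.
- apply (is_derive_comp exp (fun t => RInt r 0 t)).
  + apply is_derive_exp.
  + now apply derive_RInt.
- unfold scal; simpl; unfold mult; simpl; ring.
Qed.

(** Riccati substitution [r = u' / u]: the exponential of the primitive of [r] solves
    [u'' = c u + e u']. *)
Lemma riccati_derive (r c e : R -> R) t :
  (forall t, is_derive r t (c t + e t * r t - r t ^ 2)) ->
  is_derive (fun t => r t * exp (RInt r 0 t)) t
    (c t * exp (RInt r 0 t) + e t * (r t * exp (RInt r 0 t))).
Proof.
intros Hr.
assert (Hc : forall t, continuous r t) by (intros s; eapply derive_continuous, Hr).
evar_last.
- apply (is_derive_mult (K := R_AbsRing) r (fun t => exp (RInt r 0 t)) t _ _ (Hr t) (exp_primitive_derive r t Hc)).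
  intros; apply Rmult_comm.
- unfold plus, mult; simpl. real_equation; ring.
Qed.

(* [c2 - rm c1] and [c2 - rp c1] are the left eigenvectors of the monodromy
   matrix, for the multipliers [mp] and [mm]. *)
Lemma floquet_multiplier_cases (rp rm mp mm u1 u2 v1 v2 : R) (mu c1 c2 : C) :
  rm < rp ->
  u1 = (rp * mm - rm * mp) / (rp - rm) -> u2 = (mp - mm) / (rp - rm) ->
  v1 = rp * rm * (mm - mp) / (rp - rm) -> v2 = (rp * mp - rm * mm) / (rp - rm) ->
  (c1, c2) <> (RtoC 0, RtoC 0) ->
  (RtoC u1 * c1 + RtoC u2 * c2 = mu * c1)%C ->
  (RtoC v1 * c1 + RtoC v2 * c2 = mu * c2)%C ->
  mu = RtoC mp \/ mu = RtoC mm.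
Proof.
intros Hr Hu1 Hu2 Hv1 Hv2 Hc E1 E2.
assert (A1 : v1 - rm * u1 = - rm * mp) by (subst; field; lra).
assert (A2 : v2 - rm * u2 = mp) by (subst; field; lra).
assert (A3 : v1 - rp * u1 = - rp * mm) by (subst; field; lra).
assert (A4 : v2 - rp * u2 = mm) by (subst; field; lra).
assert (F1 : ((mu - RtoC mp) * (c2 - RtoC rm * c1) = 0)%C).
{ transitivity ((mu * c2 - RtoC rm * (mu * c1)) - RtoC mp * (c2 - RtoC rm * c1))%C; [ring|].
  rewrite <- E1, <- E2.
  transitivity ((RtoC (v1 - rm * u1) + RtoC (rm * mp)) * c1 + (RtoC (v2 - rm * u2) - RtoC mp) * c2)%C.
  - rewrite !RtoC_minus, !RtoC_mult; ring.
  - rewrite A1, A2, <- RtoC_plus. replace (- rm * mp + rm * mp) with 0 by ring. ring. }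
assert (F2 : ((mu - RtoC mm) * (c2 - RtoC rp * c1) = 0)%C).
{ transitivity ((mu * c2 - RtoC rp * (mu * c1)) - RtoC mm * (c2 - RtoC rp * c1))%C; [ring|].
  rewrite <- E1, <- E2.
  transitivity ((RtoC (v1 - rp * u1) + RtoC (rp * mm)) * c1 + (RtoC (v2 - rp * u2) - RtoC mm) * c2)%C.
  - rewrite !RtoC_minus, !RtoC_mult; ring.
  - rewrite A3, A4, <- RtoC_plus. replace (- rp * mm + rp * mm) with 0 by ring. ring. }
assert (Hint : forall a b : C, (a * b = 0)%C -> a <> 0%C -> b = 0%C).
{ intros a b Hab Ha. destruct (Ceq_dec b 0) as [|Hb]; trivial.
  exfalso; now apply (Cmult_neq_0 a b). }
destruct (Ceq_dec (mu - RtoC mp) 0) as [Hz|Hz].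
{ left. transitivity (mu - RtoC mp + RtoC mp)%C; [ring | rewrite Hz; ring]. }
destruct (Ceq_dec (mu - RtoC mm) 0) as [Hz'|Hz'].
{ right. transitivity (mu - RtoC mm + RtoC mm)%C; [ring | rewrite Hz'; ring]. }
exfalso; apply Hc.
assert (G1 := Hint _ _ F1 Hz). assert (G2 := Hint _ _ F2 Hz').
assert (G3 : (RtoC (rp - rm) * c1 = 0)%C).
{ rewrite RtoC_minus. transitivity ((c2 - RtoC rm * c1) - (c2 - RtoC rp * c1))%C; [ring | rewrite G1, G2; ring]. }
assert (G4 : c1 = 0%C).
{ apply (Hint (RtoC (rp - rm))); trivial. intros H; apply RtoC_inj in H; lra. }
f_equal; trivial. rewrite G4 in G1. transitivity (c2 - RtoC rm * 0)%C; [ring | exact G1].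
Qed.

Lemma hyperbolic_of_near_saddle lam : 0 < lam ->
  exists delta, 0 < delta /\ forall F T x y (c e : R -> R), 0 < T ->
    (forall t, Derive (fun s => F t s (y t)) (x t) = c t) ->
    (forall t, Derive (fun s => F t (x t) s) (y t) = e t) ->
    (forall t, continuous c t) -> (forall t, continuous e t) ->
    (forall t, c (t + T) = c t) -> (forall t, e (t + T) = e t) ->
    (forall t, Rabs (c t - lam ^ 2) <= delta) -> (forall t, Rabs (e t) <= delta) ->
    hyperbolic F T x y.
Proof.
intros Hlam. destruct (periodic_riccati lam Hlam) as [delta [Hdelta HR]].
exists delta; split; trivial.
intros F T x y c e HT Dc De cc ce Tc Te Hc He.
destruct (HR c e T) as (rp & Drp & Trp & Brp); trivial.
(* The negative solution is [- rn (- t)]: time reversal changes the sign of [r] and of [e], but not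
   that of [c]. *)
destruct (HR (fun t => c (- t)) (fun t => - e (- t)) T) as (rn & Drn & Trn & Brn).
{ intros t; continuous_tac. }
{ intros t; continuous_tac. }
{ intros t. rewrite <- (Tc (- (t + T))). f_equal; ring. }
{ intros t. rewrite <- (Te (- (t + T))). do 2 f_equal; ring. }
{ intros t; apply Hc. }
{ intros t; rewrite Rabs_Ropp; apply He. }
set (rm := fun t => - rn (- t)).
assert (Drm : forall t, is_derive rm t (c t + e t * rm t - rm t ^ 2)).
{ intros t. assert (HD := Drn (- t)). cbv beta in HD. rewrite Ropp_involutive in HD.
  apply is_derive_reverse, is_derive_opp in HD. evar_last; [exact HD|].
  unfold rm. change (- - (c t + - e t * rn (- t) - rn (- t) ^ 2) = c t + e t * - rn (- t) - (- rn (- t)) ^ 2). ring. }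
assert (Trm : forall t, rm (t + T) = rm t).
{ intros t; unfold rm. rewrite <- (Trn (- (t + T))). do 2 f_equal; ring. }
assert (Brm : forall t, rm t <= - (lam / 2)) by (intros t; unfold rm; specialize (Brn (- t)); lra).
clearbody rm; clear rn Drn Trn Brn.
assert (Crp : forall t, continuous rp t) by (intros s; eapply derive_continuous, Drp).
assert (Crm : forall t, continuous rm t) by (intros s; eapply derive_continuous, Drm).
set (up := fun t => exp (RInt rp 0 t)). set (um := fun t => exp (RInt rm 0 t)).
assert (Hup0 : up 0 = 1) by (unfold up; rewrite RInt_point; apply exp_0).
assert (Hum0 : um 0 = 1) by (unfold um; rewrite RInt_point; apply exp_0).
set (P := rp 0) in *. set (N := rm 0) in *.
assert (HP : lam / 2 <= P) by apply Brp. assert (HN : N <= - (lam / 2)) by apply Brm.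
assert (Hcomb : forall al be : R, variational_solution F x y
   (fun t => al * up t + be * um t) (fun t => al * (rp t * up t) + be * (rm t * um t))).
{ intros al be t. rewrite Dc, De. split.
  - apply (is_derive_plus (fun t => al * up t) (fun t => be * um t)); apply is_derive_scal;
    now apply exp_primitive_derive.
  - evar_last.
    + apply (is_derive_plus (fun t => al * (rp t * up t)) (fun t => be * (rm t * um t)));
      apply is_derive_scal; apply riccati_derive with (c := c) (e := e); trivial.
    + unfold plus; simpl; fold (up t) (um t). real_equation; ring. }
(* Combinations of the two exponential solutions, which at 0 have value 1 and slopes [P] and [N],
   with identity initial data. *)
exists (fun t => (- N / (P - N)) * up t + (P / (P - N)) * um t),
  (fun t => (- N / (P - N)) * (rp t * up t) + (P / (P - N)) * (rm t * um t)),
  (fun t => (/ (P - N)) * up t + (- / (P - N)) * um t),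
  (fun t => (/ (P - N)) * (rp t * up t) + (- / (P - N)) * (rm t * um t)).
fold P N.
split; [apply Hcomb|]. split; [cbv beta; rewrite Hup0, Hum0; field; lra|].
split; [cbv beta; rewrite Hup0, Hum0; fold P N; field; lra|].
split; [apply Hcomb|]. split; [cbv beta; rewrite Hup0, Hum0; field; lra|].
split; [cbv beta; rewrite Hup0, Hum0; fold P N; field; lra|].
(* By periodicity the slopes at [T] are again [P] and [N] times the values, so [up T] and [um T] are
   the multipliers. *)
assert (HrpT : rp T = P) by (unfold P; rewrite <- (Trp 0); f_equal; ring).
assert (HrmT : rm T = N) by (unfold N; rewrite <- (Trm 0); f_equal; ring).
intros mu c1 c2 Hne E1 E2.
assert (Hup : 1 < up T).
{ unfold up; rewrite <- exp_0; apply exp_increasing.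
  apply Rlt_le_trans with (T * (lam / 2)); [nra|].
  replace (T * (lam / 2)) with (RInt (fun _ => lam / 2) 0 T)
    by (rewrite RInt_const; unfold scal; simpl; unfold mult; simpl; ring).
  apply RInt_le; try lra; try (apply continuous_ex_RInt; trivial; intros; apply continuous_const).
  intros z _; apply Brp. }
assert (Hum : um T < 1).
{ unfold um; rewrite <- exp_0; apply exp_increasing.
  apply Rle_lt_trans with (- (T * (lam / 2))); [|nra].
  replace (- (T * (lam / 2))) with (RInt (fun _ => - (lam / 2)) 0 T)
    by (rewrite RInt_const; unfold scal; simpl; unfold mult; simpl; ring).
  apply RInt_le; try lra; try (apply continuous_ex_RInt; trivial; intros; apply continuous_const).
  intros z _; apply Brm. }
assert (Hump : 0 < um T) by apply exp_pos.
cbv beta in E1, E2. rewrite HrpT, HrmT in E2.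
assert (Hmu : mu = RtoC (up T) \/ mu = RtoC (um T)).
{ eapply (floquet_multiplier_cases P N (up T) (um T)) with (6 := Hne) (7 := E1) (8 := E2);
    try (field; lra); lra. }
destruct Hmu as [-> | ->]; rewrite Cmod_R, Rabs_pos_eq; lra.
Qed.

(** * Solutions near the saddle *)

(** An eigenvector has [v2 = l1 v1] with [v1] nonzero, and the second row gives slope [l1 ^ 2] for
    [m]; hence [lam = - l1]. *)
Lemma saddle_positive_slope b1 b2 a xsa :
  unperturbed_saddle b1 b2 a xsa ->
  0 < xsa /\ m b1 b2 xsa + a = 0 /\ exists lam, 0 < lam /\ dm b1 b2 xsa = lam ^ 2.
Proof.
intros (Hx & _ & Hm & l1 & l2 & Hl & (v1 & v2 & Hne & E1 & E2) & _).
repeat split; trivial.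
rewrite Derive_const in E1.
rewrite (Derive_ext (fun y => y) (fun y => id y)) in E1 by reflexivity.
unfold id in E1; rewrite Derive_id in E1.
assert (HD : Derive (fun x => m b1 b2 x + a) xsa = dm b1 b2 xsa).
{ apply is_derive_unique. evar_last.
  - apply (is_derive_plus (m b1 b2) (fun _ => a)); [now apply is_derive_m | apply (is_derive_const (V := R_NormedModule))].
  - unfold plus, zero; simpl; ring. }
rewrite HD, Derive_const in E2.
assert (Hv2 : v2 = l1 * v1) by lra. subst v2.
assert (Hv1 : v1 <> 0).
{ intros H0; apply Hne; rewrite H0; f_equal; ring. }
exists (- l1); split; [lra|].
apply Rmult_eq_reg_r with v1; trivial. lra.
Qed.

Lemma small_multiple A b : 0 < b -> exists e, 0 < e /\ forall x, 0 <= x < e -> A * x <= b.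
Proof.
intros Hb. pose proof (Rabs_pos A).
exists (b / (Rabs A + 1)); split; [apply Rdiv_lt_0_compat; lra|].
intros x [H0 Hx].
apply Rle_trans with (Rabs A * x); [apply Rmult_le_compat_r; trivial; apply RRle_abs|].
apply (Rmult_lt_compat_l (Rabs A + 1)) in Hx; [|lra].
replace ((Rabs A + 1) * (b / (Rabs A + 1))) with b in Hx by (field; lra). lra.
Qed.

Lemma m_expanding b1 b2 xsa lam :
  0 < xsa -> 0 < lam -> dm b1 b2 xsa = lam ^ 2 ->
  exists rho, 0 < rho <= xsa / 2 /\ forall x y, Rabs (x - xsa) <= rho -> Rabs (y - xsa) <= rho ->
    3 / 4 * lam ^ 2 * (x - y) ^ 2 <= (m b1 b2 x - m b1 b2 y) * (x - y).
Proof.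
intros Hx Hlam Hd.
destruct (lipschitz_bounds b1 b2 (xsa / 2) ltac:(lra)) as (L & HL & _ & Hl).
assert (Hl2 : 0 < lam ^ 2) by nra.
(* Within [rho] of the saddle [dm] varies by at most [lam ^ 2 / 4], which leaves the factor
   [3 / 4]. *)
set (rho := Rmin (xsa / 2) (lam ^ 2 / (4 * L))).
assert (Hrho : 0 < rho).
{ apply Rmin_glb_lt; [lra|]. apply Rdiv_lt_0_compat; lra. }
assert (H1 : rho <= xsa / 2) by apply Rmin_l.
assert (H2 : L * rho <= lam ^ 2 / 4).
{ replace (lam ^ 2 / 4) with (L * (lam ^ 2 / (4 * L))) by (field; lra).
  apply Rmult_le_compat_l; [lra | apply Rmin_r]. }
exists rho; split; [lra|]. intros x y Hx1 Hy1.
apply Rabs_le_between in Hx1. apply Rabs_le_between in Hy1.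
assert (Hr : forall c, Rmin y x <= c <= Rmax y x -> - rho <= c - xsa <= rho).
{ intros c [C1 C2]. split.
  - assert (xsa - rho <= Rmin y x) by (apply Rmin_glb; lra). lra.
  - assert (Rmax y x <= xsa + rho) by (apply Rmax_lub; lra). lra. }
destruct (MVT_gen (m b1 b2) y x (dm b1 b2)) as [c [Hc E]].
- intros z Hz. apply is_derive_m. assert (H := Hr z ltac:(lra)). lra.
- intros z Hz. apply continuous_cont_pt; eapply derive_continuous; apply is_derive_m.
  assert (H := Hr z Hz). lra.
- rewrite E. apply Hr in Hc.
  assert (Hdc : 3 / 4 * lam ^ 2 <= dm b1 b2 c).
  { destruct (Hl c xsa ltac:(lra) ltac:(lra)) as (_ & HH & _). rewrite Hd in HH.
    assert (Rabs (c - xsa) <= rho) by (apply Rabs_le; lra).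
    assert (L * Rabs (c - xsa) <= L * rho) by (apply Rmult_le_compat_l; lra).
    apply Rabs_le_between in HH. lra. }
  replace (dm b1 b2 c * (x - y) * (x - y)) with (dm b1 b2 c * (x - y) ^ 2) by ring.
  apply Rmult_le_compat_r; trivial. apply pow2_ge_0.
Qed.

Definition forced (b1 b2 a B C Om eps th t x y : R) : R :=
  m b1 b2 x + a + eps * force B C Om th t x y.

Lemma perturbed_forced b1 b2 a B C Om eps t x y :
  perturbed b1 b2 a B C Om eps t x y = forced b1 b2 a B C Om eps 0 t x y.
Proof. unfold perturbed, forced, force; now rewrite Rplus_0_r. Qed.

(** Pointwise in [t] and without positivity, so that it applies to half-orbits and passes through
    reversal, translation and gluing. *)
Definition solves_at (F : R -> R -> R -> R) (z w : R -> R) (t : R) : Prop :=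
  is_derive z t (w t) /\ is_derive w t (F t (z t) (w t)).

Lemma fixed_point_solves b1 b2 a B C Om X Y pi K G1 G2 r eps th h t :
  linear_solver (fun t => dm b1 b2 (X t)) pi K G1 G2 ->
  forcing_fixed_point b1 b2 B C Om X Y pi G1 G2 r eps th h ->
  is_derive X t (Y t) -> is_derive Y t (m b1 b2 (X t) + a) -> pi t = t ->
  solves_at (forced b1 b2 a B C Om eps th) (fun t => X t + G1 h t) (fun t => Y t + G2 h t) t.
Proof.
intros HG [Hh Hf] DX DY Hpi. split.
- apply (is_derive_plus X (G1 h)); trivial. now apply (solver_derive1 _ _ _ _ _ HG h r).
- evar_last.
  + apply (is_derive_plus Y (G2 h)); [exact DY|]. now apply (solver_derive2 _ _ _ _ _ HG h r).
  + rewrite (Hf t), Hpi. unfold remainder, forced, plus; simpl. real_equation; ring.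
Qed.

(** The periodic forcing is common to both solutions and cancels. For gaps [d] and [e] of position
    and velocity, the friction contributes at order [eps (Rabs e + Rabs d)]; this is absorbed by the
    term [2 e ^ 2] of the second derivative and by part of the expansion [3 / 2 lam ^ 2 d ^ 2]. *)
Lemma squared_gap_convex b1 b2 a B C Om xsa lam :
  0 < xsa -> 0 < lam -> dm b1 b2 xsa = lam ^ 2 ->
  exists rho eps1, 0 < rho <= xsa / 2 /\ 0 < eps1 /\
    forall eps th z1 w1 z2 w2 t, 0 <= eps < eps1 ->
      solves_at (forced b1 b2 a B C Om eps th) z1 w1 t ->
      solves_at (forced b1 b2 a B C Om eps th) z2 w2 t ->
      Rabs (z1 t - xsa) <= rho -> Rabs (z2 t - xsa) <= rho -> Rabs (w2 t) <= 1 ->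
      exists l, is_derive (fun t => 2 * (z1 t - z2 t) * (w1 t - w2 t)) t l /\
        lam ^ 2 * (z1 t - z2 t) ^ 2 <= l.
Proof.
intros Hx Hlam Hd.
destruct (m_expanding b1 b2 xsa lam Hx Hlam Hd) as (rho & Hrho & Hexp).
destruct (lipschitz_bounds b1 b2 (xsa / 2) ltac:(lra)) as (L & HL & Hb & Hl).
assert (Hl2 : 0 < lam ^ 2) by nra.
(* With [eta = Rabs C * L * eps] the loss is at most [eta (e ^ 2 + 3 d ^ 2)]: [eta <= 1] covers the
   first term, and [eta <= lam ^ 2 / 6] leaves [lam ^ 2 d ^ 2]. *)
destruct (small_multiple (Rabs C * L) (Rmin 1 (lam ^ 2 / 6))) as (eps1 & He1 & Hsmall).
{ apply Rmin_glb_lt; lra. }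
exists rho, eps1; split; [trivial|split; trivial].
intros eps th z1 w1 z2 w2 t He [D1 D2] [D3 D4] Hz1 Hz2 Hw2.
eexists; split.
{ apply (is_derive_mult (K := R_AbsRing) (fun t => 2 * (z1 t - z2 t)) (fun t => w1 t - w2 t)).
  - apply is_derive_scal, (is_derive_minus z1 z2); eassumption.
  - apply (is_derive_minus w1 w2); eassumption.
  - intros; apply Rmult_comm. }
assert (HE := Hexp _ _ Hz1 Hz2). specialize (Hsmall eps He).
assert (Hs1 : Rabs C * L * eps <= 1) by (eapply Rle_trans; [exact Hsmall | apply Rmin_l]).
assert (Hs2 : Rabs C * L * eps <= lam ^ 2 / 6) by (eapply Rle_trans; [exact Hsmall | apply Rmin_r]).
apply Rabs_le_between in Hz1. apply Rabs_le_between in Hz2.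
set (x := z1 t) in *. set (x' := z2 t) in *. set (y := w1 t) in *. set (y' := w2 t) in *.
set (d := x - x') in *. set (e := y - y').
set (g := C / x ^ 3 * y - C / x' ^ 3 * y').
assert (Hg : Rabs (eps * g) <= Rabs C * L * eps * (Rabs e + Rabs d)).
{ unfold g.
  replace (eps * (C / x ^ 3 * y - C / x' ^ 3 * y')) with (C * (/ x ^ 3 * e + (/ x ^ 3 - / x' ^ 3) * y') * eps) by (unfold e, Rdiv; ring).
  replace (Rabs C * L * eps * (Rabs e + Rabs d)) with (Rabs C * (L * Rabs e + L * Rabs d * 1) * eps) by ring.
  apply Rabs_prod_bound; [|rewrite Rabs_pos_eq; lra].
  apply Rabs_prod_bound; [lra|].
  apply Rabs_sum_bound; apply Rabs_prod_bound; trivial; try lra.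
  - apply Hb; lra.
  - apply Hl; lra. }
match goal with |- _ <= ?X => replace X with (2 * e ^ 2 + 2 * ((m b1 b2 x - m b1 b2 x') * d - d * (eps * g)))
  by (unfold forced, force, minus, plus, opp, mult, scal, e, g, d; simpl; unfold mult; simpl; ring) end.
set (eta := Rabs C * L * eps) in *.
assert (Heta : 0 <= eta) by (unfold eta; apply Rmult_le_pos; [apply Rmult_le_pos; [apply Rabs_pos | lra] | lra]).
assert (Hdg : d * (eps * g) <= eta * (e ^ 2 / 2 + 3 / 2 * d ^ 2)).
{ eapply Rle_trans; [apply RRle_abs|]. rewrite Rabs_mult.
  eapply Rle_trans; [apply Rmult_le_compat_l; [apply Rabs_pos | exact Hg]|].
  replace (Rabs d * (eta * (Rabs e + Rabs d))) with (eta * (Rabs d * (Rabs e + Rabs d))) by ring.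
  apply Rmult_le_compat_l; trivial.
  rewrite <- (pow2_abs e), <- (pow2_abs d).
  pose proof (pow2_ge_0 (Rabs e - Rabs d)). nra. }
assert (0 <= e ^ 2) by apply pow2_ge_0. assert (0 <= d ^ 2) by apply pow2_ge_0.
assert (eta * (e ^ 2 / 2) <= 1 * (e ^ 2 / 2)) by (apply Rmult_le_compat_r; lra).
assert (eta * (3 / 2 * d ^ 2) <= lam ^ 2 / 6 * (3 / 2 * d ^ 2)) by (apply Rmult_le_compat_r; lra).
lra.
Qed.

Section Asymptotics.
Variables (b1 b2 a B C Om xsa lam rho eps1 : R).
Hypothesis Hrho : 0 < rho <= xsa / 2.
Hypothesis Hlam : 0 < lam.
Hypothesis Hgap : forall eps th z1 w1 z2 w2 t, 0 <= eps < eps1 ->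
      solves_at (forced b1 b2 a B C Om eps th) z1 w1 t ->
      solves_at (forced b1 b2 a B C Om eps th) z2 w2 t ->
      Rabs (z1 t - xsa) <= rho -> Rabs (z2 t - xsa) <= rho -> Rabs (w2 t) <= 1 ->
      exists l, is_derive (fun t => 2 * (z1 t - z2 t) * (w1 t - w2 t)) t l /\
        lam ^ 2 * (z1 t - z2 t) ^ 2 <= l.

Lemma gap_derivative eps th z1 w1 z2 w2 tau : 0 <= eps < eps1 ->
  (forall t, tau <= t -> solves_at (forced b1 b2 a B C Om eps th) z1 w1 t /\
     solves_at (forced b1 b2 a B C Om eps th) z2 w2 t /\
     Rabs (z1 t - xsa) <= rho /\ Rabs (z2 t - xsa) <= rho /\ Rabs (w2 t) <= 1) ->
  exists V2, forall t, tau <= t ->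
    is_derive (fun t => (z1 t - z2 t) ^ 2) t (2 * (z1 t - z2 t) * (w1 t - w2 t)) /\
    is_derive (fun t => 2 * (z1 t - z2 t) * (w1 t - w2 t)) t (V2 t) /\
    lam ^ 2 * (z1 t - z2 t) ^ 2 <= V2 t /\ (z1 t - z2 t) ^ 2 <= (2 * rho) ^ 2.
Proof.
intros He H.
destruct (choice (fun t l => tau <= t -> is_derive (fun t => 2 * (z1 t - z2 t) * (w1 t - w2 t)) t l /\
        lam ^ 2 * (z1 t - z2 t) ^ 2 <= l)) as [V2 HV].
{ intros t. destruct (Rle_or_lt tau t) as [Ht|Ht].
  - destruct (H t Ht) as (S1 & S2 & B1 & B2 & B3).
    destruct (Hgap eps th z1 w1 z2 w2 t) as [l Hl]; trivial. now exists l.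
  - exists 0; intros; lra. }
exists V2; intros t Ht. destruct (H t Ht) as (S1 & S2 & B1 & B2 & B3). destruct (HV t Ht).
split; [|split; [trivial|split; trivial]].
- apply (is_derive_square_diff z1 z2); [apply S1 | apply S2].
- apply Rabs_le_between in B1. apply Rabs_le_between in B2. nra.
Qed.

Lemma gap_tends_to_0 eps th z1 w1 z2 w2 tau : 0 <= eps < eps1 ->
  (forall t, tau <= t -> solves_at (forced b1 b2 a B C Om eps th) z1 w1 t /\
     solves_at (forced b1 b2 a B C Om eps th) z2 w2 t /\
     Rabs (z1 t - xsa) <= rho /\ Rabs (z2 t - xsa) <= rho /\ Rabs (w2 t) <= 1) ->
  (forall t, tau <= t -> Rabs (w1 t) <= 1) ->
  is_lim (fun t => z1 t - z2 t) p_infty 0 /\ is_lim (fun t => w1 t - w2 t) p_infty 0.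
Proof.
intros He H Hw1.
destruct (gap_derivative eps th z1 w1 z2 w2 tau He H) as [V2 HV].
assert (Hdec : forall t, tau <= t ->
   (z1 t - z2 t) ^ 2 <= (z1 tau - z2 tau) ^ 2 * exp (- lam * (t - tau))).
{ apply (decay_of_derive_le (fun t => (z1 t - z2 t) ^ 2) (fun t => 2 * (z1 t - z2 t) * (w1 t - w2 t))).
  - intros t Ht; now apply HV.
  - apply (bounded_convex_derive_le (fun t => (z1 t - z2 t) ^ 2) (fun t => 2 * (z1 t - z2 t) * (w1 t - w2 t)) V2 lam tau ((2 * rho) ^ 2)); trivial;
    try (intros t Ht; now apply HV).
    intros t Ht. rewrite Rabs_pos_eq by apply pow2_ge_0. now apply HV. }
assert (L1 : is_lim (fun t => z1 t - z2 t) p_infty 0).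
{ apply is_lim_spec; intros [e Hpe]; simpl.
  destruct (exp_decay_lt lam ((z1 tau - z2 tau) ^ 2) (e ^ 2) Hlam (pow2_ge_0 _) ltac:(nra)) as [s0 [Hs0 Hs]].
  exists (tau + s0); intros t Ht. rewrite Rminus_0_r.
  specialize (Hdec t ltac:(lra)). specialize (Hs (t - tau) ltac:(lra)).
  apply Rnot_le_lt; intros Hle. rewrite <- (pow2_abs (z1 t - z2 t)) in Hdec.
  assert (e ^ 2 <= Rabs (z1 t - z2 t) ^ 2) by (apply pow_incr; lra). lra. }
split; trivial.
(* The velocities follow by the Landau argument, the difference of accelerations being bounded near
   the saddle. *)
destruct (lipschitz_bounds b1 b2 (xsa / 2) ltac:(lra)) as (L & HL & Hb & Hl).
apply (derive_tends_to_0 (fun t => z1 t - z2 t) (fun t => w1 t - w2 t)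
  (fun t => forced b1 b2 a B C Om eps th t (z1 t) (w1 t) - forced b1 b2 a B C Om eps th t (z2 t) (w2 t)) tau
  (L * (rho + rho) + eps * (Rabs C * (L * 1) + Rabs C * (L * 1)))); trivial.
- intros t Ht; destruct (H t Ht) as (S1 & S2 & _). apply (is_derive_minus z1 z2); [apply S1 | apply S2].
- intros t Ht; destruct (H t Ht) as (S1 & S2 & _). apply (is_derive_minus w1 w2); [apply S1 | apply S2].
- intros t Ht; destruct (H t Ht) as (S1 & S2 & B1 & B2 & B3). specialize (Hw1 t Ht).
  unfold forced, force.
  match goal with |- Rabs ?X <= _ => replace X with ((m b1 b2 (z1 t) - m b1 b2 (z2 t))
    - eps * (C * (/ z1 t ^ 3 * w1 t) - C * (/ z2 t ^ 3 * w2 t))) by (unfold Rdiv; ring) end.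
  assert (B1' := B1). assert (B2' := B2).
  apply Rabs_le_between in B1'. apply Rabs_le_between in B2'.
  apply Rabs_diff_bound.
  + eapply Rle_trans; [apply Hl; lra|]. apply Rmult_le_compat_l; [lra|].
    replace (z1 t - z2 t) with ((z1 t - xsa) - (z2 t - xsa)) by ring. now apply Rabs_diff_bound.
  + apply Rabs_prod_bound; [rewrite Rabs_pos_eq; lra|].
    apply Rabs_diff_bound; (apply Rabs_prod_bound; [lra|]); apply Rabs_prod_bound; trivial; apply Hb; lra.
Qed.

(** The decay estimate is started at [t - s] for every [s >= 0], where the squared gap is at most
    [(2 rho) ^ 2]; the velocities then agree as derivatives of equal functions. *)
Lemma gap_zero eps th z1 w1 z2 w2 : 0 <= eps < eps1 ->
  (forall t, solves_at (forced b1 b2 a B C Om eps th) z1 w1 t /\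
     solves_at (forced b1 b2 a B C Om eps th) z2 w2 t /\
     Rabs (z1 t - xsa) <= rho /\ Rabs (z2 t - xsa) <= rho /\ Rabs (w2 t) <= 1) ->
  forall t, z1 t = z2 t /\ w1 t = w2 t.
Proof.
intros He H.
assert (Hz : forall t, (z1 t - z2 t) ^ 2 = 0).
{ intros t. apply Rle_antisym; [|apply pow2_ge_0].
  apply (bounded_by_all_decay_le0 _ ((2 * rho) ^ 2) lam Hlam). intros s Hs.
  destruct (gap_derivative eps th z1 w1 z2 w2 (t - s) He ltac:(auto)) as [V2 HV].
  eapply Rle_trans.
  - apply (decay_of_derive_le (fun t => (z1 t - z2 t) ^ 2) (fun t => 2 * (z1 t - z2 t) * (w1 t - w2 t)) lam (t - s)).
    + intros u Hu; now apply HV.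
    + apply (bounded_convex_derive_le (fun t => (z1 t - z2 t) ^ 2) (fun t => 2 * (z1 t - z2 t) * (w1 t - w2 t)) V2 lam (t - s) ((2 * rho) ^ 2)); trivial;
      try (intros u Hu; now apply HV).
      intros u Hu. rewrite Rabs_pos_eq by apply pow2_ge_0. now apply HV.
    + lra.
  - replace (t - (t - s)) with s by ring. apply Rmult_le_compat_r; [apply Rlt_le, exp_pos|].
    apply HV; lra. }
assert (Hz' : forall t, z1 t = z2 t).
{ intros t. apply Rminus_diag_uniq. destruct (Req_dec (z1 t - z2 t) 0) as [|Hne]; trivial.
  exfalso; generalize (Hz t); now apply pow_nonzero. }
intros t; split; trivial.
destruct (H t) as ([S1 _] & [S2 _] & _).
rewrite <- (is_derive_unique _ _ _ S1), <- (is_derive_unique _ _ _ S2).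
now apply Derive_ext.
Qed.

End Asymptotics.

Lemma saddle_continuation_restrict F T xsa eps0 eps1 p q :
  eps1 <= eps0 -> saddle_continuation F T xsa eps0 p q -> saddle_continuation F T xsa eps1 p q.
Proof.
intros Hle (H0 & H1 & H2). split; [trivial|split].
- intros eps He; apply H1; lra.
- intros eps He eta Heta. destruct (H2 eps ltac:(lra) eta Heta) as (d & Hd & H).
  exists d; split; trivial. intros eps' He'; apply H; lra.
Qed.

Lemma force_periodic B C Om th t x y :
  0 < Om -> force B C Om th (t + 2 * PI / Om) x y = force B C Om th t x y.
Proof.
intros HOm; unfold force.
replace (Om * (t + 2 * PI / Om) + th) with ((Om * t + th) + 2 * PI) by (field; lra).
rewrite cos_plus, cos_2PI, sin_2PI. ring.
Qed.

Lemma Derive_perturbed_x b1 b2 a B C Om eps t x y : 0 < x ->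
  Derive (fun s => perturbed b1 b2 a B C Om eps t s y) x = dm b1 b2 x + eps * (3 * C / x ^ 4 * y).
Proof.
intros Hx; apply is_derive_unique; unfold perturbed. evar_last.
- apply (is_derive_plus (fun s => m b1 b2 s + a) (fun s => eps * (B * cos (Om * t) - C / s ^ 3 * y))).
  + apply (is_derive_plus (m b1 b2) (fun _ => a)); [now apply is_derive_m | apply (is_derive_const (V := R_NormedModule))].
  + auto_derive; [apply Rgt_not_eq, (pow_lt x 3 Hx) | reflexivity].
- unfold plus, zero; simpl. field; lra.
Qed.

Lemma Derive_perturbed_y b1 b2 a B C Om eps t x y : 0 < x ->
  Derive (fun s => perturbed b1 b2 a B C Om eps t x s) y = - eps * (C / x ^ 3).
Proof.
intros Hx; apply is_derive_unique; unfold perturbed.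
auto_derive; trivial. simpl; field; lra.
Qed.

Lemma saddle_branch b1 b2 a B C Om xsa lam :
  0 < xsa -> m b1 b2 xsa + a = 0 -> 0 < lam -> dm b1 b2 xsa = lam ^ 2 -> 0 < Om ->
  exists eps0 M p q, 0 < eps0 /\ 0 < M /\
    saddle_continuation (perturbed b1 b2 a B C Om) (2 * PI / Om) xsa eps0 p q /\
    forall eps, 0 <= eps < eps0 -> forall t, Rabs (p eps t - xsa) <= M * eps /\ Rabs (q eps t) <= M * eps.
Proof.
intros Hx Hm Hlam Hd HOm.
set (T := 2 * PI / Om).
assert (HT : 0 < T) by (apply Rdiv_lt_0_compat; [pose proof PI_RGT_0; lra | trivial]).
set (K := / lam * / lam + / lam).
assert (HK : 0 < K) by (unfold K; pose proof (Rinv_0_lt_compat _ Hlam); nra).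
assert (HG : linear_solver (fun t => dm b1 b2 xsa) (fun t => t) K (saddle_solver1 lam) (saddle_solver2 lam)).
{ rewrite Hd. now apply saddle_linear_solver. }
destruct (forcing_fixed_points b1 b2 B C Om (xsa / 2) 0 (fun _ => xsa) (fun _ => 0) (fun t => t) K
  (saddle_solver1 lam) (saddle_solver2 lam)) as (e0 & M & He0 & HM & HKM & Hex & Hcmp & _);
  try (intros; apply continuous_const); try (intros; apply continuous_id);
  try (intros; lra); trivial.
{ intros; rewrite Rabs_R0; lra. }
destruct (squared_gap_convex b1 b2 a B C Om xsa lam Hx Hlam Hd) as (rho & e1 & Hrho & He1 & Hgap).
destruct (hyperbolic_of_near_saddle lam Hlam) as (delta & Hdelta & Hhyp).
destruct (lipschitz_bounds b1 b2 (xsa / 2) ltac:(lra)) as (L & HL & Hb & Hl).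
(* [A eps] bounds the distance from [lam ^ 2] of the coefficient of [u] in the variational equation:
   one term for the change of [dm], one for the [x]-derivative of the friction, with velocity at
   most [xsa / 2]. *)
set (A := L * (K * M) + 3 * Rabs C * / (xsa / 2) ^ 4 * (xsa / 2)).
destruct (small_multiple A delta Hdelta) as (e2 & He2 & Hs2).
destruct (small_multiple (Rabs C * L) delta Hdelta) as (e3 & He3 & Hs3).
destruct (small_multiple (K * M) (Rmin 1 rho)) as (e4 & He4 & Hs4).
{ apply Rmin_glb_lt; lra. }
set (eps0 := Rmin (Rmin (Rmin e0 e1) (Rmin e2 e3)) e4).
assert (Heps0 : 0 < eps0) by (unfold eps0; repeat apply Rmin_glb_lt; lra).
assert (Hle : eps0 <= e0 /\ eps0 <= e1 /\ eps0 <= e2 /\ eps0 <= e3 /\ eps0 <= e4).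
{ unfold eps0.
  assert (Q1 := Rmin_l (Rmin (Rmin e0 e1) (Rmin e2 e3)) e4). assert (Q2 := Rmin_r (Rmin (Rmin e0 e1) (Rmin e2 e3)) e4).
  assert (Q3 := Rmin_l (Rmin e0 e1) (Rmin e2 e3)). assert (Q4 := Rmin_r (Rmin e0 e1) (Rmin e2 e3)).
  assert (Q5 := Rmin_l e0 e1). assert (Q6 := Rmin_r e0 e1). assert (Q7 := Rmin_l e2 e3). assert (Q8 := Rmin_r e2 e3).
  repeat split; lra. }
clearbody eps0.
destruct (choice (fun eps h => 0 <= eps < eps0 ->
   forcing_fixed_point b1 b2 B C Om (fun _ => xsa) (fun _ => 0) (fun t => t)
     (saddle_solver1 lam) (saddle_solver2 lam) (M * eps) eps 0 h)) as [h Hh].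
{ intros eps. destruct (Rle_or_lt 0 eps); [destruct (Rlt_or_le eps eps0)|].
  - destruct (Hex eps 0) as [h Hh]; [lra | now exists h].
  - exists (fun _ => 0); intros; lra.
  - exists (fun _ => 0); intros; lra. }
set (p := fun eps t => xsa + saddle_solver1 lam (h eps) t).
set (q := fun eps t => 0 + saddle_solver2 lam (h eps) t).
assert (Hpq : forall eps, 0 <= eps < eps0 -> forall t,
   Rabs (p eps t - xsa) <= K * M * eps /\ Rabs (q eps t) <= K * M * eps).
{ intros eps He t. destruct (Hh eps He) as [Hball _].
  unfold p, q. rewrite Rplus_0_l. replace (xsa + saddle_solver1 lam (h eps) t - xsa) with (saddle_solver1 lam (h eps) t) by ring.
  rewrite Rmult_assoc. apply (solver_bound _ _ _ _ _ HG (h eps) _ Hball t). }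
assert (Hnear : forall eps, 0 <= eps < eps0 -> forall t,
   Rabs (p eps t - xsa) <= rho /\ Rabs (q eps t) <= 1 /\ Rabs (q eps t) <= xsa / 2).
{ intros eps He t. destruct (Hpq eps He t). specialize (Hs4 eps ltac:(lra)).
  assert (Q1 := Rmin_l 1 rho). assert (Q2 := Rmin_r 1 rho).
  assert (K * (M * eps) <= K * (M * e0)) by (repeat apply Rmult_le_compat_l; lra).
  repeat split; lra. }
assert (Hpos : forall eps, 0 <= eps < eps0 -> forall t, xsa / 2 <= p eps t).
{ intros eps He t. destruct (Hnear eps He t) as [HN _]. apply Rabs_le_between in HN. lra. }
assert (Hsolves : forall eps, 0 <= eps < eps0 -> forall t,
   solves_at (forced b1 b2 a B C Om eps 0) (p eps) (q eps) t).
{ intros eps He t.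
  apply (fixed_point_solves b1 b2 a B C Om (fun _ => xsa) (fun _ => 0) (fun t => t) K (saddle_solver1 lam) (saddle_solver2 lam) (M * eps)); trivial.
  - now apply Hh.
  - apply (is_derive_const (V := R_NormedModule)).
  - rewrite Hm. apply (is_derive_const (V := R_NormedModule)). }
assert (Hper : forall eps, 0 <= eps < eps0 -> forall t, p eps (t + T) = p eps t /\ q eps (t + T) = q eps t).
{ intros eps He.
  apply (gap_zero b1 b2 a B C Om xsa lam rho e1 Hlam Hgap eps 0 (fun t => p eps (t + T)) (fun t => q eps (t + T)) (p eps) (q eps)); [lra|].
  intros t. destruct (Hnear eps He t) as (N1 & N2 & _). destruct (Hnear eps He (t + T)) as (N3 & N4 & _).
  split; [|auto]. destruct (Hsolves eps He (t + T)) as [S1 S2]. split.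
  - now apply (is_derive_translate (p eps)).
  - apply (is_derive_translate (q eps)).
    unfold forced in *. unfold T in *. rewrite <- (force_periodic B C Om 0 t) by trivial. exact S2. }
exists eps0, (K * M), p, q. split; [trivial|]. split; [nra|]. split; [|exact Hpq].
split; [|split].
(* At [eps = 0] the bound [K M eps] leaves only the equilibrium. *)
- intros t. destruct (Hpq 0 ltac:(lra) t) as [Z1 Z2]. rewrite Rmult_0_r in *.
  assert (HZ : forall x, Rabs x <= 0 -> x = 0).
  { intros x Hx0. destruct (Req_dec x 0); trivial. pose proof (Rabs_pos_lt x); lra. }
  apply HZ in Z1. apply HZ in Z2. split; lra.
- intros eps He. split; [|split].
  + intros t. specialize (Hpos eps He t). destruct (Hsolves eps He t) as [S1 S2].
    split; [lra|]. split; trivial. now rewrite perturbed_forced.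
  + now apply Hper.
  + assert (cp : forall t, continuous (p eps) t) by (intros t; destruct (Hsolves eps He t) as [S1 _]; exact (derive_continuous _ _ _ S1)).
    assert (cq : forall t, continuous (q eps) t) by (intros t; destruct (Hsolves eps He t) as [_ S2]; exact (derive_continuous _ _ _ S2)).
    assert (Hp0 : forall t, 0 < p eps t) by (intros t; specialize (Hpos eps He t); lra).
    apply (Hhyp _ T _ _ (fun t => dm b1 b2 (p eps t) + eps * (3 * C / p eps t ^ 4 * q eps t)) (fun t => - eps * (C / p eps t ^ 3))); trivial.
    * intros t; now apply Derive_perturbed_x.
    * intros t; now apply Derive_perturbed_y.
    * intros t; specialize (Hp0 t). apply continuous_add; [now apply continuous_comp_dm|].
      continuous_tac. apply pow_nonzero; lra.
    * intros t; specialize (Hp0 t). continuous_tac. apply pow_nonzero; lra.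
    * intros t; destruct (Hper eps He t) as [-> ->]; reflexivity.
    * intros t; destruct (Hper eps He t) as [-> _]; reflexivity.
    * intros t. specialize (Hpos eps He t). destruct (Hpq eps He t) as [N1 _]. destruct (Hnear eps He t) as (_ & _ & N3).
      specialize (Hs2 eps ltac:(lra)).
      eapply Rle_trans; [|exact Hs2]. rewrite <- Hd.
      match goal with |- Rabs ?X <= _ => replace X with ((dm b1 b2 (p eps t) - dm b1 b2 xsa) + 3 * C / p eps t ^ 4 * q eps t * eps) by ring end.
      unfold A; rewrite Rmult_plus_distr_r. apply Rabs_sum_bound.
      -- eapply Rle_trans; [apply Hl; lra|]. rewrite Rmult_assoc. apply Rmult_le_compat_l; lra.
      -- apply Rabs_prod_bound; [|rewrite Rabs_pos_eq; lra]. apply Rabs_prod_bound; trivial.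
         eapply Rle_trans; [apply (abs_scaled_inv_le _ (xsa / 2)); lra|].
         rewrite Rabs_mult, (Rabs_pos_eq 3); lra.
    * intros t. specialize (Hpos eps He t). specialize (Hs3 eps ltac:(lra)).
      eapply Rle_trans; [|exact Hs3].
      replace (- eps * (C / p eps t ^ 3)) with (C * / p eps t ^ 3 * - eps) by (unfold Rdiv; ring).
      apply Rabs_prod_bound; [|rewrite Rabs_Ropp, Rabs_pos_eq; lra].
      apply Rabs_prod_bound; [lra|]. now apply Hb.
(* The forcings are Lipschitz in [eps] with constant [M], and the solver turns this into a bound
   [K M] uniform in time. *)
- intros eps He eta Heta. exists (eta / (K * M + 1)).
  assert (HKM1 : 0 < K * M) by nra.
  split; [apply Rdiv_lt_0_compat; lra|].
  intros eps' He' Hdist t.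
  assert (HB : forall e, 0 <= e < eps0 -> in_ball (M * eps0) (h e)).
  { intros e He''. destruct (Hh e He'') as [[Hc Hbb] _]. split; trivial.
    intros s; eapply Rle_trans; [apply Hbb|]. apply Rmult_le_compat_l; lra. }
  assert (Hdh : forall t, Rabs (h eps' t - h eps t) <= M * Rabs (eps' - eps)).
  { intros s. replace (Rabs (eps' - eps)) with (Rabs (eps' - eps) + Rabs (0 - 0)) by (rewrite Rminus_0_r, Rabs_R0; ring).
    apply (Hcmp eps' 0 (h eps') eps 0 (h eps)); try lra; now apply Hh. }
  destruct (solver_lipschitz _ _ _ _ _ HG (h eps') (h eps) _ _ (HB _ He') (HB _ He) Hdh t) as [D1 D2].
  assert (Hlt : K * (M * Rabs (eps' - eps)) < eta).
  { apply (Rmult_lt_compat_l (K * M + 1)) in Hdist; [|lra].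
    replace ((K * M + 1) * (eta / (K * M + 1))) with eta in Hdist by (field; lra).
    pose proof (Rabs_pos (eps' - eps)). lra. }
  unfold p, q. split.
  + replace (xsa + saddle_solver1 lam (h eps') t - (xsa + saddle_solver1 lam (h eps) t)) with (saddle_solver1 lam (h eps') t - saddle_solver1 lam (h eps) t) by ring. lra.
  + replace (0 + saddle_solver2 lam (h eps') t - (0 + saddle_solver2 lam (h eps) t)) with (saddle_solver2 lam (h eps') t - saddle_solver2 lam (h eps) t) by ring. lra.
Qed.

(** * The homoclinic loop *)

Lemma is_lim_infty_bound (f : R -> R) l eps :
  is_lim f p_infty (Finite l) -> 0 < eps -> exists T, 0 <= T /\ forall t, T <= t -> Rabs (f t - l) < eps.
Proof.
intros H He. apply is_lim_spec in H. destruct (H (mkposreal eps He)) as [T HT]; simpl in HT.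
exists (Rmax 0 (T + 1)); split; [apply Rmax_l|].
intros t Ht; apply HT. pose proof (Rmax_r 0 (T + 1)); lra.
Qed.

Lemma is_lim_m_infty_reverse (f : R -> R) l :
  is_lim f m_infty (Finite l) <-> is_lim (fun t => f (- t)) p_infty (Finite l).
Proof.
split; intros H; apply is_lim_spec in H; apply is_lim_spec; intros eps;
destruct (H eps) as [T HT]; exists (- T); intros t Ht.
- apply HT; lra.
- rewrite <- (Ropp_involutive t). apply HT; lra.
Qed.

Lemma is_lim_square_0 (f : R -> R) x :
  is_lim f x (Finite 0) -> is_lim (fun t => f t ^ 2) x (Finite 0).
Proof.
intros H. replace (Finite 0) with (Finite (0 * 0)) by (f_equal; ring).
apply (is_lim_ext (fun t => f t * f t)); [intros; real_equation; ring|].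
apply (is_lim_mult f f x (Finite 0) (Finite 0)); trivial; exact I.
Qed.

Lemma bounded_of_limits (f : R -> R) l1 l2 :
  (forall t, continuous f t) -> is_lim f p_infty (Finite l1) -> is_lim f m_infty (Finite l2) ->
  exists M, 0 <= M /\ forall t, Rabs (f t) <= M.
Proof.
intros Hc H1 H2. apply is_lim_m_infty_reverse in H2.
destruct (is_lim_infty_bound _ _ 1 H1 Rlt_0_1) as (T1 & HT1 & B1).
destruct (is_lim_infty_bound _ _ 1 H2 Rlt_0_1) as (T2 & HT2 & B2).
destruct (continuity_ab_maj (fun t => Rabs (f t)) (- T2) T1) as [x [Hx _]]; [lra| |].
{ intros t _. apply continuous_cont_pt. apply (continuous_comp f Rabs); [apply Hc | apply continuous_Rabs]. }
exists (Rabs (f x) + (Rabs l1 + 1) + (Rabs l2 + 1)).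
assert (P0 := Rabs_pos (f x)). assert (P1 := Rabs_pos l1). assert (P2 := Rabs_pos l2).
split; [lra|]. intros t.
destruct (Rle_or_lt T1 t) as [Ht|Ht]; [|destruct (Rle_or_lt (- T2) t) as [Ht'|Ht']].
- assert (B := B1 t Ht). replace (f t) with ((f t - l1) + l1) by ring.
  eapply Rle_trans; [apply Rabs_triang|]. lra.
- assert (B := Hx t (conj Ht' (Rlt_le _ _ Ht))). cbv beta in B. lra.
- assert (B := B2 (- t) ltac:(lra)). rewrite Ropp_involutive in B. replace (f t) with ((f t - l2) + l2) by ring.
  eapply Rle_trans; [apply Rabs_triang|]. lra.
Qed.

Section Loop.
Variables (b1 b2 a xsa : R) (x1 x2 : R -> R) (lam : R).
Hypothesis Hloop : homoclinic_loop b1 b2 a xsa x1 x2.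
Hypothesis Hx20 : x2 0 = 0.
Hypothesis Hxsa : 0 < xsa.
Hypothesis Heq : m b1 b2 xsa + a = 0.
Hypothesis Hlam : 0 < lam.
Hypothesis Hd : dm b1 b2 xsa = lam ^ 2.

Lemma loop_pos t : 0 < x1 t.
Proof. apply Hloop. Qed.
Lemma loop_derive1 t : is_derive x1 t (x2 t).
Proof. apply Hloop. Qed.
Lemma loop_derive2 t : is_derive x2 t (m b1 b2 (x1 t) + a).
Proof. apply Hloop. Qed.
Lemma loop_continuous1 t : continuous x1 t.
Proof. exact (derive_continuous _ _ _ (loop_derive1 t)). Qed.
Lemma loop_continuous2 t : continuous x2 t.
Proof. exact (derive_continuous _ _ _ (loop_derive2 t)). Qed.

Lemma loop_bounds : exists lo Ymax, 0 < lo /\ 0 <= Ymax /\ 2 * lo <= xsa /\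
  (forall t, 2 * lo <= x1 t) /\ (forall t, Rabs (x2 t) <= Ymax) /\ (forall t, Rabs (x1 t - xsa) <= Ymax).
Proof.
destruct Hloop as (_ & _ & L1 & L2 & L3 & L4 & _).
destruct (bounded_of_limits x2 _ _ loop_continuous2 L2 L4) as (Y1 & HY1 & B1).
destruct (bounded_of_limits x1 _ _ loop_continuous1 L1 L3) as (Y2 & HY2 & B2).
assert (Hne : Finite xsa <> Finite 0) by (intros E; injection E; lra).
(* The loop stays away from the singularity at 0 because [/ x1] is continuous with finite limits,
   hence bounded. *)
destruct (bounded_of_limits (fun t => / x1 t) (/ xsa) (/ xsa)) as (Y3 & HY3 & B3).
{ intros t. apply continuous_Rinv_comp; [apply loop_continuous1|]. pose proof (loop_pos t); lra. }
{ exact (is_lim_inv x1 p_infty xsa L1 Hne). }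
{ exact (is_lim_inv x1 m_infty xsa L3 Hne). }
assert (Hi : 0 < / (Y3 + 1)) by (apply Rinv_0_lt_compat; lra).
exists (Rmin (xsa / 2) (/ (Y3 + 1) / 2)), (Y1 + Y2 + xsa).
assert (Q1 := Rmin_l (xsa / 2) (/ (Y3 + 1) / 2)). assert (Q2 := Rmin_r (xsa / 2) (/ (Y3 + 1) / 2)).
split; [apply Rmin_glb_lt; lra|]. split; [lra|]. split; [lra|].
split; [|split]; intros t.
- apply Rle_trans with (/ (Y3 + 1)); [lra|]. pose proof (loop_pos t).
  specialize (B3 t). rewrite Rabs_pos_eq in B3 by (apply Rlt_le, Rinv_0_lt_compat; trivial).
  rewrite <- (Rinv_inv (x1 t)). apply Rinv_le_contravar; [now apply Rinv_0_lt_compat | lra].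
- specialize (B1 t); lra.
- specialize (B2 t). apply Rle_trans with (Y2 + xsa); [|lra].
  apply Rabs_diff_bound; [trivial | rewrite Rabs_pos_eq; lra].
Qed.

(** [(x1 (- t), - x2 (- t))] solves the same autonomous system with the same data at 0; the squared
    distance to the loop grows at rate at most [1 + L], so it stays zero. *)
Lemma loop_even t : x1 (- t) = x1 t /\ x2 (- t) = - x2 t.
Proof.
assert (H : forall t, 0 <= t -> x1 t - x1 (- t) = 0 /\ x2 t + x2 (- t) = 0).
{ destruct loop_bounds as (lo & _ & Hlo & _ & _ & Bx & _).
  destruct (lipschitz_bounds b1 b2 lo Hlo) as (L & HL & _ & Hl).
  intros s Hs.
  set (V := fun t => (x1 t - x1 (- t)) ^ 2 + (x2 t - - x2 (- t)) ^ 2).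
  assert (D1 : forall t, is_derive (fun t => x1 (- t)) t (- x2 (- t))).
  { intros u; apply (is_derive_reverse x1), loop_derive1. }
  assert (D2 : forall t, is_derive (fun t => - x2 (- t)) t (m b1 b2 (x1 (- t)) + a)).
  { intros u. evar_last.
    - apply (is_derive_opp (fun t => x2 (- t))), (is_derive_reverse x2), loop_derive2.
    - apply Ropp_involutive. }
  assert (HV : V s <= V 0 * exp (- - (1 + L) * (s - 0))).
  { apply (decay_of_derive_le V (fun t => 2 * (x1 t - x1 (- t)) * (x2 t - - x2 (- t))
      + 2 * (x2 t - - x2 (- t)) * ((m b1 b2 (x1 t) + a) - (m b1 b2 (x1 (- t)) + a)))); trivial.
    - intros u _. apply (is_derive_plus (fun t => (x1 t - x1 (- t)) ^ 2) (fun t => (x2 t - - x2 (- t)) ^ 2)).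
      + apply (is_derive_square_diff x1 (fun t => x1 (- t))); [apply loop_derive1 | apply D1].
      + apply (is_derive_square_diff x2 (fun t => - x2 (- t))); [apply loop_derive2 | apply D2].
    - intros u _. unfold V.
      set (d := x1 u - x1 (- u)). set (e := x2 u - - x2 (- u)).
      replace (m b1 b2 (x1 u) + a - (m b1 b2 (x1 (- u)) + a)) with (m b1 b2 (x1 u) - m b1 b2 (x1 (- u))) by ring.
      set (g := m b1 b2 (x1 u) - m b1 b2 (x1 (- u))).
      assert (Hg : Rabs g <= L * Rabs d).
      { apply Hl; [specialize (Bx u) | specialize (Bx (- u))]; lra. }
      assert (Hg2 : g ^ 2 <= L ^ 2 * d ^ 2).
      { rewrite <- (pow2_abs g), <- (pow2_abs d). rewrite <- Rpow_mult_distr.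
        apply pow_incr; split; [apply Rabs_pos | trivial]. }
      assert (2 * d * e <= d ^ 2 + e ^ 2) by (pose proof (pow2_ge_0 (d - e)); lra).
      assert (2 * e * g <= L * (d ^ 2 + e ^ 2)).
      { apply Rmult_le_reg_l with L; trivial.
        pose proof (pow2_ge_0 (L * e - g)). nra. }
      lra. }
  assert (V 0 = 0).
  { unfold V. rewrite Ropp_0, Hx20; ring. }
  rewrite H, Rmult_0_l in HV. unfold V in HV.
  assert (P1 := pow2_ge_0 (x1 s - x1 (- s))). assert (P2 := pow2_ge_0 (x2 s - - x2 (- s))).
  assert (Hsq : forall x, x ^ 2 = 0 -> x = 0).
  { intros x Hx. destruct (Req_dec x 0) as [|Hne]; trivial. exfalso; revert Hx; now apply pow_nonzero. }
  split; [apply Hsq; lra|]. rewrite <- (Hsq (x2 s - - x2 (- s))); [ring | lra]. }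
destruct (Rle_or_lt 0 t) as [Ht|Ht].
- destruct (H t Ht); split; lra.
- destruct (H (- t) ltac:(lra)) as [H1 H2]. rewrite Ropp_involutive in *. split; lra.
Qed.

(** [(x2, loop_accel)] is the velocity of the loop in the phase plane, hence a solution of the
    linearization along it: these are the [phi] and [psi] of the solver. *)
Definition loop_accel (t : R) : R := m b1 b2 (x1 t) + a.
Definition loop_coef (t : R) : R := dm b1 b2 (x1 t).

Lemma loop_accel_derive t : is_derive loop_accel t (loop_coef t * x2 t).
Proof.
unfold loop_accel, loop_coef. evar_last.
- apply (is_derive_plus (fun t => m b1 b2 (x1 t)) (fun _ => a)); [|apply (is_derive_const (V := R_NormedModule))].
  apply (is_derive_comp (m b1 b2) x1); [apply is_derive_m, loop_pos | apply loop_derive1].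
- unfold plus, zero, scal; simpl; unfold mult; simpl; ring.
Qed.

Lemma norm_derive t :
  is_derive (fun t => x2 t ^ 2 + loop_accel t ^ 2) t (2 * (1 + loop_coef t) * x2 t * loop_accel t).
Proof.
assert (D1 : is_derive x2 t (loop_accel t)) by apply loop_derive2.
assert (D2 := loop_accel_derive t).
evar_last.
- auto_derive; [repeat split; eexists; eassumption | reflexivity].
- replace (Derive (fun x => x2 x) t) with (loop_accel t) by (symmetry; now apply is_derive_unique).
  replace (Derive (fun x => loop_accel x) t) with (loop_coef t * x2 t) by (symmetry; now apply is_derive_unique).
  real_equation; ring.
Qed.

(** The sign lets the left and the right loop be treated together. *)
Lemma loop_sign : exists sg, (sg = 1 \/ sg = -1) /\ forall t, 0 < sg * (x1 t - xsa).
Proof.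
destruct Hloop as (_ & _ & _ & _ & _ & _ & [H|H]); [exists (-1) | exists 1]; split; auto;
intros t; specialize (H t); lra.
Qed.

(* The distance to the saddle is convex near the saddle, which pins its
   logarithmic derivative between two negative constants. *)
Lemma loop_approach : exists tau k L d, 0 <= tau /\ 0 < k /\ 0 < L /\
  (forall t, 0 < d t) /\ (forall t, d t = Rabs (x1 t - xsa)) /\
  (forall t, Rabs (loop_coef t) <= L) /\ (forall t, Rabs (loop_accel t) <= L * d t) /\
  (forall t, tau <= t -> k * d t <= Rabs (x2 t) <= (1 + L) * d t) /\
  (forall t s, tau <= t <= s -> d s <= d t * exp (- k * (s - t))).
Proof.
destruct loop_bounds as (lo & Ymax & Hlo & _ & Hlox & Bx & _).
destruct (lipschitz_bounds b1 b2 lo Hlo) as (L & HL & Hb & Hl).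
destruct (m_expanding b1 b2 xsa lam Hxsa Hlam Hd) as (rho & Hrho & Hexp).
destruct Hloop as (_ & _ & L1 & L2 & _).
destruct (is_lim_infty_bound _ _ rho L1 (proj1 Hrho)) as (tau & Htau & Bt).
destruct loop_sign as (sg & Hsg & Hpos).
assert (Hsg2 : sg * sg = 1) by (destruct Hsg as [-> | ->]; ring).
set (d := fun t => sg * (x1 t - xsa)).
assert (Hdabs : forall t, d t = Rabs (x1 t - xsa)).
{ intros t; unfold d; specialize (Hpos t).
  destruct Hsg as [-> | ->]; [rewrite Rabs_pos_eq | rewrite Rabs_left]; lra. }
assert (Dd : forall t, is_derive d t (sg * x2 t)).
{ intros t; unfold d. apply is_derive_scal. evar_last.
  - apply (is_derive_minus x1 (fun _ => xsa)); [apply loop_derive1 | apply (is_derive_const (V := R_NormedModule))].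
  - unfold minus, plus, opp, zero; simpl; ring. }
assert (Dd2 : forall t, is_derive (fun t => sg * x2 t) t (sg * loop_accel t)).
{ intros t; apply is_derive_scal, loop_derive2. }
assert (Hacc : forall t, Rabs (loop_accel t) <= L * d t).
{ intros t. rewrite Hdabs. unfold loop_accel.
  replace (m b1 b2 (x1 t) + a) with (m b1 b2 (x1 t) - m b1 b2 xsa) by lra.
  apply Hl; [specialize (Bx t)|]; lra. }
assert (Hlow : forall t, tau <= t -> (lam / 2) ^ 2 * d t <= sg * loop_accel t).
{ intros t Ht. assert (Hdt : 0 < d t) by apply Hpos.
  apply Rmult_le_reg_r with (d t); trivial.
  assert (HE := Hexp (x1 t) xsa (Rlt_le _ _ (Bt t Ht)) ltac:(rewrite Rminus_diag, Rabs_R0; lra)).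
  replace (sg * loop_accel t * d t) with ((sg * sg) * ((m b1 b2 (x1 t) - - a) * (x1 t - xsa))) by (unfold loop_accel, d; ring).
  replace ((lam / 2) ^ 2 * d t * d t) with ((sg * sg) * (lam ^ 2 / 4 * (x1 t - xsa) ^ 2)) by (unfold d; field).
  rewrite Hsg2, !Rmult_1_l. replace (- a) with (m b1 b2 xsa) by lra.
  assert (0 <= lam ^ 2 * (x1 t - xsa) ^ 2) by (apply Rmult_le_pos; apply pow2_ge_0). lra. }
assert (Hdecay : forall t, tau <= t -> sg * x2 t <= - (lam / 2) * d t).
{ apply (bounded_convex_derive_le d (fun t => sg * x2 t) (fun t => sg * loop_accel t) (lam / 2) tau rho); auto; try lra.
  intros t Ht. rewrite Rabs_pos_eq by apply Rlt_le, Hpos. rewrite Hdabs. now apply Rlt_le, Bt. }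
assert (Hx2abs : forall t, tau <= t -> Rabs (x2 t) = - (sg * x2 t)).
{ intros t Ht. specialize (Hdecay t Ht). assert (Hdt : 0 < d t) by apply Hpos.
  assert (sg * x2 t <= 0) by nra.
  destruct Hsg as [-> | ->]; [rewrite Rabs_left1 | rewrite Rabs_pos_eq]; lra. }
exists tau, (lam / 2), L, d.
split; [trivial|]. split; [lra|]. split; [trivial|]. split; [apply Hpos|]. split; [trivial|].
split; [intros t; apply Hb; specialize (Bx t); lra|]. split; [trivial|].
split.
- intros t Ht. split; [rewrite Hx2abs by trivial; specialize (Hdecay t Ht); lra|].
  assert (Hdt : 0 < d t) by apply Hpos.
  (* [x2 ^ 2 - L d ^ 2] is nondecreasing and tends to 0, hence is nonpositive; [L <= (1 + L) ^ 2]
     then avoids a square root. *)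
  assert (Hsq : x2 t ^ 2 - L * d t ^ 2 <= 0).
  { set (Q := fun t => x2 t ^ 2 - L * d t ^ 2).
    assert (HQlim : is_lim Q p_infty 0).
    { unfold Q. replace (Finite 0) with (Finite (0 - L * 0)) by (f_equal; ring).
      assert (Ld : is_lim d p_infty 0).
      { unfold d. replace (Finite 0) with (Finite (sg * (xsa - xsa))) by (f_equal; ring).
        apply (is_lim_scal_l (fun t => x1 t - xsa) sg p_infty (Finite (xsa - xsa))).
        apply is_lim_minus'; [trivial | apply is_lim_const]. }
      apply is_lim_minus'; [now apply is_lim_square_0|].
      apply (is_lim_scal_l (fun t => d t ^ 2) L p_infty (Finite 0)); now apply is_lim_square_0. }
    assert (HQm : forall s, t <= s -> Q t <= Q s).
    { intros s Hs. apply (derive_ge0_le Q (fun t => 2 * (sg * x2 t) * (sg * loop_accel t - L * d t))); trivial.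
      - intros u Hu. unfold Q.
        assert (D1 : is_derive x2 u (loop_accel u)) by apply loop_derive2.
        assert (D2 := Dd u).
        evar_last.
        + auto_derive; [repeat split; eexists; eassumption | reflexivity].
        + replace (Derive (fun x => x2 x) u) with (loop_accel u) by (symmetry; now apply is_derive_unique).
          replace (Derive (fun x => d x) u) with (sg * x2 u) by (symmetry; now apply is_derive_unique).
          real_equation. transitivity (2 * ((sg * sg) * (x2 u * loop_accel u) - sg * x2 u * (L * d u))); [rewrite Hsg2|]; ring.
      - intros u Hu. assert (Hu2 := Hdecay u ltac:(lra)). assert (Hdu : 0 < d u) by apply Hpos.
        assert (Hau := Hacc u). apply Rabs_le_between in Hau.
        assert (sg * x2 u <= 0) by nra.
        assert (sg * loop_accel u <= L * d u) by (destruct Hsg as [-> | ->]; lra).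
        nra. }
    apply Rnot_lt_le; intros Hlt. change (0 < Q t) in Hlt.
    destruct (is_lim_infty_bound _ _ (Q t) HQlim Hlt) as (T' & _ & HT').
    assert (A1 := HT' (Rmax T' t) (Rmax_l _ _)). assert (A2 := HQm (Rmax T' t) (Rmax_r _ _)).
    rewrite Rminus_0_r in A1. apply Rabs_lt_between in A1. lra. }
  apply Rnot_lt_le; intros Hlt.
  assert (((1 + L) * d t) ^ 2 < Rabs (x2 t) ^ 2).
  { assert (0 < (1 + L) * d t) by nra. nra. }
  rewrite pow2_abs in H. assert (0 < d t ^ 2) by nra. nra.
- intros t s Hts. apply (decay_of_derive_le d (fun t => sg * x2 t)); try lra.
  + intros u _; apply Dd.
  + intros u Hu; apply Hdecay; lra.
Qed.

Lemma loop_solver_exists : exists K k A, 0 < K /\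
  linear_solver loop_coef Rabs K (loop_solver1 x2 loop_accel loop_coef) (loop_solver2 x2 loop_accel loop_coef) /\
  (forall h r, in_ball r h -> exp_dominated (fun s => x2 s * h s) 0 (A * r) k) /\
  (forall t, 0 < x2 t ^ 2 + loop_accel t ^ 2).
Proof.
destruct loop_bounds as (lo & Ymax & Hlo & HY & _ & _ & BY & BX).
destruct loop_approach as (tau & k & L & d & Htau & Hk & HL & Hdpos & Hdabs & Hcoef & Hacc & Hx2 & Hdecay).
set (n := fun t => x2 t ^ 2 + loop_accel t ^ 2).
(* The distance to the saddle, frozen before [tau], where it need not be monotone. *)
set (w := fun t => d (Rmax tau t)).
assert (Hdtau := Hdpos tau).
assert (HY2 : 0 <= Ymax / d tau) by (apply Rmult_le_pos; [trivial | left; now apply Rinv_0_lt_compat]).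
assert (HY3 : 0 <= L * (Ymax / d tau)) by nra.
assert (He1 := exp_pos (k * tau)). assert (He2 := exp_pos ((1 + L) * tau)).
assert (Hk2 : 0 < k ^ 2) by nra.
assert (Hek : 0 < exp ((1 + L) * tau) / k ^ 2) by (apply Rdiv_lt_0_compat; lra).
(* The first four terms bound [x2] and [loop_accel] by [w] after and before [tau], the fifth pays
   for the delay [tau] in the decay, and the last gives the lower bound of the norm. *)
set (K := 1 + L + Ymax / d tau + L * (Ymax / d tau) + exp (k * tau) + exp ((1 + L) * tau) / k ^ 2).
assert (HK : 0 < K) by (unfold K; lra).
assert (Hn0 : forall t, 0 <= n t) by (intros t; unfold n; pose proof (pow2_ge_0 (x2 t)); pose proof (pow2_ge_0 (loop_accel t)); lra).
assert (Hnk : forall t, tau <= t -> k ^ 2 * d t ^ 2 <= n t).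
{ intros t Ht. destruct (Hx2 t Ht) as [H1 _]. specialize (Hdpos t). unfold n.
  rewrite <- (pow2_abs (x2 t)). pose proof (pow2_ge_0 (loop_accel t)).
  assert ((k * d t) ^ 2 <= Rabs (x2 t) ^ 2) by (apply pow_incr; split; [nra | trivial]).
  rewrite Rpow_mult_distr in *. lra. }
assert (Hw0 : forall t, 0 < w t) by (intros; apply Hdpos).
assert (Hphiw : forall t, 0 <= t -> Rabs (x2 t) <= K * w t).
{ intros t Ht; unfold w. destruct (Rle_or_lt tau t) as [H|H].
  - rewrite Rmax_right by trivial. destruct (Hx2 t H) as [_ H1]. eapply Rle_trans; [exact H1|].
    apply Rmult_le_compat_r; [apply Rlt_le, Hdpos | unfold K; lra].
  - rewrite Rmax_left by lra. eapply Rle_trans; [apply BY|].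
    apply Rle_trans with (Ymax / d tau * d tau); [right; field; lra|].
    apply Rmult_le_compat_r; [lra | unfold K; lra]. }
assert (Hpsiw : forall t, 0 <= t -> Rabs (loop_accel t) <= K * w t).
{ intros t Ht; unfold w. eapply Rle_trans; [apply Hacc|]. destruct (Rle_or_lt tau t) as [H|H].
  - rewrite Rmax_right by trivial.
    apply Rmult_le_compat_r; [apply Rlt_le, Hdpos | unfold K; lra].
  - rewrite Rmax_left by lra.
    apply Rle_trans with (L * (Ymax / d tau) * d tau).
    + replace (L * (Ymax / d tau) * d tau) with (L * Ymax) by (field; lra).
      apply Rmult_le_compat_l; [lra|]. rewrite Hdabs; apply BX.
    + apply Rmult_le_compat_r; [lra | unfold K; lra]. }
assert (Hnw : forall t, 0 <= t -> w t ^ 2 <= K * n t).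
{ intros t Ht; unfold w.
  (* Before [tau] the squared norm is compared with its value at [tau]: it grows at rate at most
     [1 + L]. *)
  assert (Hcmp : k ^ 2 * d (Rmax tau t) ^ 2 <= n t * exp ((1 + L) * tau)).
  { destruct (Rle_or_lt tau t) as [H|H].
    - rewrite Rmax_right by trivial. eapply Rle_trans; [now apply Hnk|].
      assert (1 <= exp ((1 + L) * tau)) by (rewrite <- exp_0 at 1; apply exp_le_mono, Rmult_le_pos; lra).
      specialize (Hn0 t); nra.
    - rewrite Rmax_left by lra. eapply Rle_trans; [apply Hnk; lra|].
      eapply Rle_trans; [apply (decay_of_derive_le n (fun t => 2 * (1 + loop_coef t) * x2 t * loop_accel t) (- (1 + L)) t)|].
      + intros u _; apply norm_derive.
      + intros u _. specialize (Hcoef u). unfold n.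
        assert (Hp : Rabs (2 * (x2 u * loop_accel u)) <= x2 u ^ 2 + loop_accel u ^ 2).
        { pose proof (pow2_ge_0 (x2 u - loop_accel u)). pose proof (pow2_ge_0 (x2 u + loop_accel u)). apply Rabs_le; lra. }
        assert (Hc : Rabs (1 + loop_coef u) <= 1 + L) by (apply Rabs_sum_bound; [rewrite Rabs_R1; lra | trivial]).
        assert (HH := Rabs_prod_bound _ _ _ _ Hc Hp).
        apply Rle_trans with (Rabs ((1 + loop_coef u) * (2 * (x2 u * loop_accel u)))); [|lra].
        eapply Rle_trans; [|apply RRle_abs]. right; ring.
      + lra.
      + apply Rmult_le_compat_l; [apply Hn0|]. apply exp_le_mono. nra. }
  apply Rmult_le_reg_l with (k ^ 2); trivial.
  eapply Rle_trans; [exact Hcmp|].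
  replace (n t * exp ((1 + L) * tau)) with (k ^ 2 * (exp ((1 + L) * tau) / k ^ 2 * n t)) by (field; lra).
  apply Rmult_le_compat_l; [lra|]. apply Rmult_le_compat_r; [apply Hn0 | unfold K; lra]. }
assert (Hwdecay : forall t s, 0 <= t <= s -> w s <= K * exp (- k * (s - t)) * w t).
{ intros t s Hts; unfold w.
  eapply Rle_trans; [apply (Hdecay (Rmax tau t) (Rmax tau s))|].
  - split; [apply Rmax_l|]. apply Rle_max_compat_l; lra.
  - rewrite Rmult_comm. apply Rmult_le_compat_r; [apply Rlt_le, Hdpos|].
    apply Rle_trans with (exp (k * tau) * exp (- k * (s - t))).
    + rewrite <- exp_plus. apply exp_le_mono.
      assert (Rmax tau t <= tau + t) by (apply Rmax_lub; lra).
      assert (s <= Rmax tau s) by apply Rmax_r. nra.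
    + apply Rmult_le_compat_r; [apply Rlt_le, exp_pos | unfold K; lra]. }
assert (Hcoef' : forall t, 0 <= t -> Rabs (loop_coef t) <= K).
{ intros t _; eapply Rle_trans; [apply Hcoef | unfold K; lra]. }
assert (Hnpos' : forall t, 0 <= t -> 0 < n t).
{ intros t Ht. specialize (Hnw t Ht). specialize (Hw0 t).
  apply Rmult_lt_reg_l with K; trivial. nra. }
assert (Hnpos : forall t, 0 < n t).
{ intros t. destruct (Rle_or_lt 0 t) as [Ht|Ht]; [now apply Hnpos'|].
  destruct (loop_even t) as [E1 E2]. specialize (Hnpos' (- t) ltac:(lra)).
  unfold n, loop_accel in *. rewrite E1, E2 in Hnpos'. lra. }
assert (Hcc : forall t, continuous loop_coef t).
{ intros t. apply (continuous_comp_dm b1 b2 x1); [apply loop_continuous1 | apply loop_pos]. }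
exists (loop_solver_const k K), k, (K * K * w 0). split; [|split; [|split]].
- unfold loop_solver_const. pose proof (tangent_const_pos k K Hk HK).
  assert (0 < K * K * K * K / k) by (apply Rdiv_lt_0_compat; trivial; repeat (apply Rmult_lt_0_compat; trivial)).
  assert (0 < tangent_const k K * K * K / k) by (apply Rdiv_lt_0_compat; trivial; repeat (apply Rmult_lt_0_compat; trivial)). lra.
- apply (loop_linear_solver x2 loop_accel loop_coef w k K); auto.
  + intros t; apply loop_derive2.
  + intros t; apply loop_accel_derive.
- intros h r Hh. apply (phi_exp_dominated x2 loop_accel w k K); auto; try lra.
  intros t; apply loop_derive2.
- exact Hnpos.
Qed.

End Loop.

(** * The Melnikov function *)

Lemma improper_ext F G : (forall s, 0 <= s -> F s = G s) -> improper F = improper G.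
Proof.
intros H; unfold improper; f_equal. apply Lim_ext_loc. exists 0; intros t Ht.
apply RInt_ext; intros x Hx. rewrite Rmin_left in Hx by lra. symmetry; apply H; lra.
Qed.

Lemma improper_bound F A k : exp_dominated F 0 A k -> Rabs (improper F) <= A / k.
Proof.
intros H. apply tail_bound in H. unfold tail in H. rewrite RInt_point in H.
change zero with 0 in H. rewrite Rminus_0_l, Rabs_Ropp in H. exact H.
Qed.

Lemma lipschitz_continuity (f : R -> R) L :
  (forall x y, Rabs (f x - f y) <= L * Rabs (x - y)) -> continuity f.
Proof.
intros H x. apply continuous_cont_pt, filterlim_locally. intros [e He].
assert (HL : 0 < Rabs L + 1) by (pose proof (Rabs_pos L); lra).
assert (Hd : 0 < e / (Rabs L + 1)) by (apply Rdiv_lt_0_compat; lra).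
exists (mkposreal _ Hd); intros y Hy. change (Rabs (y - x) < e / (Rabs L + 1)) in Hy.
change (Rabs (f y - f x) < e).
apply (Rmult_lt_compat_l (Rabs L + 1)) in Hy; trivial.
replace ((Rabs L + 1) * (e / (Rabs L + 1))) with e in Hy by (field; lra).
eapply Rle_lt_trans; [apply H|].
pose proof (Rabs_pos (y - x)). pose proof (RRle_abs L). nra.
Qed.

Section Melnikov.
Variables (b1 b2 a xsa : R) (x1 x2 : R -> R) (lam B Om : R).
Hypothesis Hloop : homoclinic_loop b1 b2 a xsa x1 x2.
Hypothesis Hx20 : x2 0 = 0.
Hypothesis Hxsa : 0 < xsa.
Hypothesis Heq : m b1 b2 xsa + a = 0.
Hypothesis Hlam : 0 < lam.
Hypothesis Hd : dm b1 b2 xsa = lam ^ 2.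

Local Notation accel0 := (m b1 b2 (x1 0) + a).

(** [Rabs s] matches the even forcings of the half-line contraction and makes the force bounded and
    continuous on the whole line; the improper integral reads only [s >= 0]. *)
Definition melnikov_integrand (C th s : R) : R :=
  x2 s * force B C Om th (Rabs s) (x1 (Rabs s)) (x2 (Rabs s)).

Lemma loop_force_in_ball C : exists r, forall th,
  in_ball r (fun s => force B C Om th (Rabs s) (x1 (Rabs s)) (x2 (Rabs s))).
Proof.
destruct (loop_bounds _ _ _ _ _ _ Hloop Hxsa) as (lo & Ymax & Hlo & HY & _ & Bx & By & _).
exists (Rabs B * 1 + Rabs C * / (2 * lo) ^ 3 * Ymax). intros th; split.
- assert (C1 := loop_continuous1 _ _ _ _ _ _ Hloop). assert (C2 := loop_continuous2 _ _ _ _ _ _ Hloop).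
  assert (CR : forall t, continuous Rabs t) by (intros; apply continuous_Rabs).
  intros t. unfold force. specialize (Bx (Rabs t)).
  apply continuous_sub; [continuous_tac|]. apply continuous_mul; [|continuous_tac].
  apply (continuous_div (fun _ => C) (fun s => x1 (Rabs s) ^ 3)).
  + apply continuous_const.
  + continuous_tac.
  + apply pow_nonzero; lra.
- intros t. unfold force. apply Rabs_diff_bound.
  + apply Rabs_prod_bound; [lra | apply Rabs_le, COS_bound].
  + apply Rabs_prod_bound; [|apply By]. apply abs_scaled_inv_le; split; [lra | apply Bx].
Qed.

(* [w th 0 = 0] selects, on the stable manifold of the continued saddle, the
   orbit that crosses the axis [x' = 0] at time [0]; it starts at
   [(z th 0, 0)]. *)
Lemma stable_family C : exists e0 M, 0 < e0 /\ 0 < M /\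
  forall eps, 0 <= eps < e0 -> exists z w : R -> R -> R,
    (forall th t, 0 <= t -> solves_at (forced b1 b2 a B C Om eps th) (z th) (w th) t) /\
    (forall th t, 0 <= t -> Rabs (z th t - x1 t) <= M * eps /\ Rabs (w th t - x2 t) <= M * eps) /\
    (forall th t, 0 <= t -> 0 < z th t) /\
    (forall th, w th 0 = 0) /\
    (forall th th', Rabs (z th 0 - z th' 0) <= M * Rabs (th - th')) /\
    (forall th, Rabs (accel0 * (z th 0 - x1 0) - eps * improper (melnikov_integrand C th)) <= M * eps ^ 2).
Proof.
destruct (loop_bounds _ _ _ _ _ _ Hloop Hxsa) as (lo & Ymax & Hlo & HY & Hlox & Bx & By & _).
destruct (loop_solver_exists _ _ _ _ _ _ lam Hloop Hx20 Hxsa Heq Hlam Hd) as (K & k & A & HK & HG & Hdom & Hn).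
assert (C1 := loop_continuous1 _ _ _ _ _ _ Hloop). assert (C2 := loop_continuous2 _ _ _ _ _ _ Hloop).
set (G1 := loop_solver1 x2 (loop_accel b1 b2 a x1) (loop_coef b1 b2 x1)) in *.
set (G2 := loop_solver2 x2 (loop_accel b1 b2 a x1) (loop_coef b1 b2 x1)) in *.
destruct (forcing_fixed_points b1 b2 B C Om lo Ymax x1 x2 Rabs K G1 G2 Hlo HY HK C1 C2) as
  (e0 & M & He0 & HM & HKM & Hex & Hcmp & M' & HM'); trivial.
{ intros; apply continuous_Rabs. }
assert (HAk : 0 <= Rabs (A * M' / k)) by apply Rabs_pos.
assert (HKM0 : 0 < K * M) by nra.
exists e0, (K * M + Rabs (A * M' / k)). split; [lra|]. split; [lra|].
intros eps He.
destruct (choice (fun th h => forcing_fixed_point b1 b2 B C Om x1 x2 Rabs G1 G2 (M * eps) eps th h)) as [h Hh].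
{ intros th; now apply Hex. }
assert (HB : forall th t, 0 <= t -> Rabs (G1 (h th) t) <= K * (M * eps) /\ Rabs (G2 (h th) t) <= K * (M * eps)).
{ intros th t Ht. assert (H := solver_bound _ _ _ _ _ HG (h th) _ (proj1 (Hh th)) t).
  now rewrite (Rabs_pos_eq t Ht) in H. }
assert (HAe : 0 <= Rabs (A * M' / k) * eps) by (apply Rmult_le_pos; lra).
assert (Hpsi0 : loop_accel b1 b2 a x1 0 = accel0) by reflexivity.
assert (H00 := fun h => loop_solver_at_0 x2 (loop_accel b1 b2 a x1) (loop_coef b1 b2 x1) Hn h Hx20).
fold G1 G2 in H00.
exists (fun th t => x1 t + G1 (h th) t), (fun th t => x2 t + G2 (h th) t).
split; [|split; [|split; [|split; [|split]]]].
- intros th t Ht. apply (fixed_point_solves b1 b2 a B C Om x1 x2 Rabs K G1 G2 (M * eps) _ _ _ _ HG (Hh th)).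
  + apply (loop_derive1 _ _ _ _ _ _ Hloop).
  + apply (loop_derive2 _ _ _ _ _ _ Hloop).
  + now apply Rabs_pos_eq.
- intros th t Ht. destruct (HB th t Ht).
  replace (x1 t + G1 (h th) t - x1 t) with (G1 (h th) t) by ring.
  replace (x2 t + G2 (h th) t - x2 t) with (G2 (h th) t) by ring.
  split; nra.
- intros th t Ht. destruct (HB th t Ht) as [HB1 _]. apply Rabs_le_between in HB1.
  specialize (Bx t). assert (K * (M * eps) <= K * (M * e0)) by (repeat apply Rmult_le_compat_l; lra). lra.
- intros th. destruct (H00 (h th)) as [_ E]. rewrite E, Hx20; ring.
- intros th th'. replace (x1 0 + G1 (h th) 0 - (x1 0 + G1 (h th') 0)) with (G1 (h th) 0 - G1 (h th') 0) by ring.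
  assert (Hdh : forall t, Rabs (h th t - h th' t) <= M * Rabs (th - th')).
  { intros t. replace (Rabs (th - th')) with (Rabs (eps - eps) + Rabs (th - th')) by (rewrite Rminus_diag, Rabs_R0; ring).
    apply (Hcmp eps th (h th) eps th' (h th')); trivial. }
  assert (HL := solver_lipschitz _ _ _ _ _ HG (h th) (h th') _ _ (proj1 (Hh th)) (proj1 (Hh th')) Hdh 0).
  rewrite Rabs_R0 in HL. destruct HL as [HL _].
  eapply Rle_trans; [exact HL|]. rewrite <- Rmult_assoc. apply Rmult_le_compat_r; [apply Rabs_pos | lra].
- intros th. destruct (H00 (h th)) as [E _]. rewrite Hpsi0 in E.
  replace (x1 0 + G1 (h th) 0 - x1 0) with (G1 (h th) 0) by ring. rewrite E.
  destruct (loop_force_in_ball C) as [r Hr]. specialize (Hr th).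
  set (g := fun s => force B C Om th (Rabs s) (x1 (Rabs s)) (x2 (Rabs s))) in *.
  (* The forcing [h th] equals [eps g] up to [M' eps ^ 2], and integration against [x2] preserves
     this order. *)
  assert (Hlin := improper_linear _ _ _ _ _ _ _ _ (- eps) (Hdom _ _ (proj1 (Hh th))) (Hdom _ _ Hr)).
  change (improper (melnikov_integrand C th)) with (improper (fun s => x2 s * g s)).
  replace (improper (fun s => x2 s * h th s) - eps * improper (fun s => x2 s * g s))
    with (improper (fun t => x2 t * h th t + - eps * (x2 t * g t))) by (rewrite Hlin; ring).
  rewrite (improper_ext _ (fun t => x2 t * (h th t - eps * g t))) by (intros; ring).
  assert (Hball : in_ball (M' * eps ^ 2) (fun t => h th t - eps * g t)).
  { split.
    - destruct (proj1 (Hh th)) as [Hc _]. destruct Hr as [Hcg _]. intros t; continuous_tac.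
    - intros t. apply (HM' eps th (h th) He (Hh th) t). }
  eapply Rle_trans; [exact (improper_bound _ _ _ (Hdom _ _ Hball))|].
  replace (A * (M' * eps ^ 2) / k) with (A * M' / k * eps ^ 2) by (unfold Rdiv; ring).
  apply Rmult_le_compat_r; [apply pow2_ge_0|].
  pose proof (RRle_abs (A * M' / k)). lra.
Qed.

(** In the difference of the two forces the part [cos th cos (Om s)] cancels, leaving [- 2 B sin th
    sin (Om s) - 2 C x2 / x1 ^ 3]. The integrand of [xi2] is even, so its half-line integral is half
    of the full one. *)
Lemma melnikov_difference C th :
  improper (melnikov_integrand C th) - improper (melnikov_integrand (- C) (- th))
    = B * sin th * xi1 Om x2 + C * xi2 x1 x2.
Proof.
destruct (loop_bounds _ _ _ _ _ _ Hloop Hxsa) as (lo & Ymax & Hlo & HY & _ & Bx & By & _).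
destruct (loop_solver_exists _ _ _ _ _ _ lam Hloop Hx20 Hxsa Heq Hlam Hd) as (_ & k & A & _ & _ & Hdom & _).
assert (C1 := loop_continuous1 _ _ _ _ _ _ Hloop). assert (C2 := loop_continuous2 _ _ _ _ _ _ Hloop).
assert (HS : forall c, in_ball (Rabs c * 1) (fun s => c * sin (Om * s))).
{ intros c; split; intros s.
  - apply continuous_mul; [apply continuous_const|].
    apply (continuous_comp (fun s => Om * s) sin); [continuous_tac | apply continuous_sin].
  - apply Rabs_prod_bound; [lra | apply Rabs_le, SIN_bound]. }
assert (HQ : in_ball (1 * / (2 * lo) ^ 3 * Ymax) (fun s => 1 / x1 s ^ 3 * x2 s)).
{ split; intros s.
  - specialize (Bx s). continuous_tac. apply pow_nonzero; lra.
  - apply Rabs_prod_bound; [|apply By]. rewrite <- (Rabs_R1) at 2. apply abs_scaled_inv_le; split; [lra | apply Bx]. }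
assert (X1 : xi1 Om x2 = -2 * improper (fun s => x2 s * (1 * sin (Om * s)))).
{ unfold xi1. f_equal. apply is_RInt_gen_unique.
  rewrite (improper_ext _ (fun t => sin (Om * t) * x2 t)) by (intros; ring).
  apply (improper_RInt_gen _ 0 (A * (Rabs 1 * 1)) k).
  destruct (Hdom _ _ (HS 1)) as (K1 & K2 & K3). split; [trivial|split].
  - intros t. apply (continuous_ext (fun s => x2 s * (1 * sin (Om * s)))); [intros; real_equation; ring | apply K2].
  - intros s Hs. replace (sin (Om * s) * x2 s) with (x2 s * (1 * sin (Om * s))) by ring. now apply K3. }
assert (X2 : xi2 x1 x2 = - (2 * improper (fun s => x2 s * (1 / x1 s ^ 3 * x2 s)))).
{ unfold xi2. f_equal. apply is_RInt_gen_unique.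
  rewrite (improper_ext _ (fun t => x2 t ^ 2 / x1 t ^ 3)) by (intros; unfold Rdiv; ring).
  apply (even_RInt_gen _ 0 (A * (1 * / (2 * lo) ^ 3 * Ymax)) k).
  - destruct (Hdom _ _ HQ) as (K1 & K2 & K3). split; [trivial|split].
    + intros t. apply (continuous_ext (fun s => x2 s * (1 / x1 s ^ 3 * x2 s))); [intros; real_equation; unfold Rdiv; ring | apply K2].
    + intros s Hs. replace (x2 s ^ 2 / x1 s ^ 3) with (x2 s * (1 / x1 s ^ 3 * x2 s)) by (unfold Rdiv; ring). now apply K3.
  - intros t. destruct (loop_even _ _ _ _ _ _ Hloop Hx20 Hxsa t) as [-> ->]. unfold Rdiv; ring. }
destruct (loop_force_in_ball C) as [r1 Hr1]. destruct (loop_force_in_ball (- C)) as [r2 Hr2].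
specialize (Hr1 th). specialize (Hr2 (- th)).
assert (L1 := improper_linear _ _ _ _ _ _ _ _ (-1) (Hdom _ _ Hr1) (Hdom _ _ Hr2)).
assert (L2 := improper_linear _ _ _ _ _ _ _ _ (-2 * C) (Hdom _ _ (HS (-2 * B * sin th))) (Hdom _ _ HQ)).
(* [improper_linear] fixes the first coefficient at 1, so the factor [- 2 B sin th] is reached as
   [1 + (- 2 B sin th - 1)]. *)
assert (L3 := improper_linear _ _ _ _ _ _ _ _ (-2 * B * sin th - 1) (Hdom _ _ (HS 1)) (Hdom _ _ (HS 1))).
cbv beta in L1, L2, L3.
rewrite (improper_ext _ (fun s => x2 s * (-2 * B * sin th * sin (Om * s)))) in L3 by (intros; ring).
rewrite L3 in L2.
transitivity (improper (fun t => x2 t * (-2 * B * sin th * sin (Om * t)) + -2 * C * (x2 t * (1 / x1 t ^ 3 * x2 t)))).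
- unfold melnikov_integrand.
  transitivity (improper (fun t => x2 t * force B C Om th (Rabs t) (x1 (Rabs t)) (x2 (Rabs t))
    + -1 * (x2 t * force B (- C) Om (- th) (Rabs t) (x1 (Rabs t)) (x2 (Rabs t))))).
  + rewrite L1; ring.
  + apply improper_ext; intros s Hs. rewrite (Rabs_pos_eq s) by trivial. unfold force.
    rewrite !cos_plus, cos_neg, sin_neg. unfold Rdiv; ring.
- rewrite L2, X1, X2. ring.
Qed.

End Melnikov.

(** * Gluing *)

Definition glue (f g : R -> R) (t : R) : R := if Rle_dec 0 t then f t else g t.

Lemma glue_nonneg f g t : 0 <= t -> glue f g t = f t.
Proof. intros H; unfold glue; destruct (Rle_dec 0 t); tauto. Qed.

Lemma glue_neg f g t : t < 0 -> glue f g t = g t.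
Proof. intros H; unfold glue; destruct (Rle_dec 0 t); trivial; lra. Qed.

(** Both pieces have two-sided derivatives at 0, with equal values and slopes, so on either side of
    0 the difference quotient is that of one piece and the limits agree. *)
Lemma is_derive_glue (f g f' g' : R -> R) :
  (forall t, 0 <= t -> is_derive f t (f' t)) -> (forall t, t <= 0 -> is_derive g t (g' t)) ->
  f 0 = g 0 -> f' 0 = g' 0 -> forall t, is_derive (glue f g) t (glue f' g' t).
Proof.
intros Hf Hg E E' t.
destruct (total_order_T t 0) as [[Ht| ->]|Ht].
- rewrite glue_neg by trivial. apply (is_derive_ext_loc g); [|apply Hg; lra].
  exists (mkposreal (- t) ltac:(lra)); intros y Hy. change (Rabs (y - t) < - t) in Hy.
  apply Rabs_lt_between in Hy. rewrite glue_neg; [reflexivity | lra].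
- rewrite glue_nonneg by lra. apply is_derive_Reals; intros e He.
  assert (D1 := Hf 0 (Rle_refl 0)). assert (D2 := Hg 0 (Rle_refl 0)). rewrite <- E' in D2.
  apply is_derive_Reals in D1. apply is_derive_Reals in D2.
  destruct (D1 e He) as [d1 H1]. destruct (D2 e He) as [d2 H2].
  exists (mkposreal _ (Rmin_stable_in_posreal d1 d2)); simpl; intros h Hh Hd.
  rewrite Rplus_0_l in *. rewrite (glue_nonneg f g 0) by lra.
  destruct (Rle_or_lt 0 h) as [Hp|Hp].
  + rewrite glue_nonneg by trivial. specialize (H1 h Hh). rewrite Rplus_0_l in H1. apply H1.
    eapply Rlt_le_trans; [exact Hd | apply Rmin_l].
  + rewrite glue_neg by trivial. specialize (H2 h Hh). rewrite Rplus_0_l in H2. rewrite E. apply H2.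
    eapply Rlt_le_trans; [exact Hd | apply Rmin_r].
- rewrite glue_nonneg by lra. apply (is_derive_ext_loc f); [|apply Hf; lra].
  exists (mkposreal t Ht); intros y Hy. change (Rabs (y - t) < t) in Hy.
  apply Rabs_lt_between in Hy. rewrite glue_nonneg; [reflexivity | lra].
Qed.

Lemma solves_at_reverse b1 b2 a B C Om eps th z w t :
  solves_at (forced b1 b2 a B C Om eps th) z w (- t) ->
  solves_at (forced b1 b2 a B (- C) Om eps (- th)) (fun t => z (- t)) (fun t => - w (- t)) t.
Proof.
intros [D1 D2]. split.
- now apply (is_derive_reverse z).
- evar_last.
  + apply (is_derive_opp (fun t => w (- t))), (is_derive_reverse w), D2.
  + change (- - forced b1 b2 a B C Om eps th (- t) (z (- t)) (w (- t)) = forced b1 b2 a B (- C) Om eps (- th) t (z (- t)) (- w (- t))).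
    unfold forced, force. replace (Om * t + - th) with (- (Om * - t + th)) by ring. rewrite cos_neg.
    unfold Rdiv; ring.
Qed.

Lemma solves_at_shift b1 b2 a B C Om eps th z w t :
  Om <> 0 -> solves_at (forced b1 b2 a B C Om eps th) z w (t - th / Om) ->
  solves_at (forced b1 b2 a B C Om eps 0) (fun t => z (t - th / Om)) (fun t => w (t - th / Om)) t.
Proof.
intros HOm [D1 D2]. split.
- now apply (is_derive_translate z).
- evar_last; [apply (is_derive_translate w), D2|].
  unfold forced, force. replace (Om * t + 0) with (Om * (t - th / Om) + th) by (field; trivial). reflexivity.
Qed.

Lemma sign_of_leading_term x mu eps K :
  0 < eps -> Rabs (x - eps * mu) <= K * eps ^ 2 -> K * eps < Rabs mu -> 0 < x * mu.
Proof.
intros He Hx HK. apply Rabs_le_between in Hx.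
assert (K * eps ^ 2 < eps * Rabs mu) by nra.
destruct (Rle_or_lt 0 mu) as [Hm|Hm].
- rewrite Rabs_pos_eq in * by trivial. assert (0 < x) by lra.
  destruct Hm as [Hm | <-]; [nra | lra].
- rewrite Rabs_left in * by trivial. nra.
Qed.

Section Gluing.
Variables (b1 b2 a xsa : R) (x1 x2 : R -> R) (lam B C Om : R).
Hypothesis Hloop : homoclinic_loop b1 b2 a xsa x1 x2.
Hypothesis Hx20 : x2 0 = 0.
Hypothesis Hxsa : 0 < xsa.
Hypothesis Heq : m b1 b2 xsa + a = 0.
Hypothesis Hlam : 0 < lam.
Hypothesis Hd : dm b1 b2 xsa = lam ^ 2.
Hypothesis HC : 0 < C.
Hypothesis HOm : 0 < Om.
Hypothesis Hxi1 : xi1 Om x2 <> 0.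
Hypothesis Hratio : B / C > Rabs (xi2 x1 x2 / xi1 Om x2).

Lemma melnikov_opposite_signs :
  (B * xi1 Om x2 + C * xi2 x1 x2) * (- B * xi1 Om x2 + C * xi2 x1 x2) < 0.
Proof.
set (p := xi1 Om x2) in *. set (q := xi2 x1 x2) in *.
assert (Hp : 0 < Rabs p) by now apply Rabs_pos_lt.
assert (H : C * Rabs q < B * Rabs p).
{ unfold Rdiv in Hratio. rewrite Rabs_mult, Rabs_inv in Hratio.
  apply (Rmult_gt_compat_r (C * Rabs p)) in Hratio; [|apply Rmult_lt_0_compat; lra].
  replace (B * / C * (C * Rabs p)) with (B * Rabs p) in Hratio by (field; lra).
  replace (Rabs q * / Rabs p * (C * Rabs p)) with (C * Rabs q) in Hratio by (field; lra).
  exact Hratio. }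
assert (H0 : 0 <= C * Rabs q) by (apply Rmult_le_pos; [lra | apply Rabs_pos]).
replace ((B * p + C * q) * (- B * p + C * q)) with (C ^ 2 * q ^ 2 - B ^ 2 * p ^ 2) by ring.
rewrite <- (pow2_abs p), <- (pow2_abs q). nra.
Qed.

Lemma glued_solution_exists : exists e0 M, 0 < e0 /\ 0 < M /\
  forall eps, 0 < eps < e0 -> exists th z w,
    (forall t, solves_at (forced b1 b2 a B C Om eps th) z w t) /\ (forall t, 0 < z t) /\
    (forall t, Rabs (z t - x1 t) <= M * eps /\ Rabs (w t - x2 t) <= M * eps).
Proof.
destruct (stable_family b1 b2 a xsa x1 x2 lam B Om Hloop Hx20 Hxsa Heq Hlam Hd C) as (e1 & M1 & He1 & HM1 & HF1).
destruct (stable_family b1 b2 a xsa x1 x2 lam B Om Hloop Hx20 Hxsa Heq Hlam Hd (- C)) as (e2 & M2 & He2 & HM2 & HF2).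
assert (Hacc : m b1 b2 (x1 0) + a <> 0).
{ destruct (loop_solver_exists _ _ _ _ _ _ lam Hloop Hx20 Hxsa Heq Hlam Hd) as (_ & _ & _ & _ & _ & _ & Hn).
  specialize (Hn 0). rewrite Hx20 in Hn. unfold loop_accel in Hn. intros E; rewrite E in Hn. lra. }
assert (Hsign := melnikov_opposite_signs).
set (mup := B * xi1 Om x2 + C * xi2 x1 x2) in *. set (mum := - B * xi1 Om x2 + C * xi2 x1 x2) in *.
assert (Hmup : 0 < Rabs mup) by (apply Rabs_pos_lt; intros E; rewrite E in Hsign; lra).
assert (Hmum : 0 < Rabs mum) by (apply Rabs_pos_lt; intros E; rewrite E in Hsign; lra).
set (M := M1 + M2).
(* The error [M eps ^ 2] is at most half of [eps Rabs mup] and of [eps Rabs mum], so the leading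
   term decides the sign at both phases. *)
destruct (small_multiple M (Rmin (Rabs mup) (Rabs mum) / 2)) as (e3 & He3 & Hs3).
{ pose proof (Rmin_glb_lt (Rabs mup) (Rabs mum) 0 Hmup Hmum); lra. }
assert (Q1 := Rmin_l (Rmin e1 e2) e3). assert (Q2 := Rmin_r (Rmin e1 e2) e3).
assert (Q3 := Rmin_l e1 e2). assert (Q4 := Rmin_r e1 e2).
exists (Rmin (Rmin e1 e2) e3), M. split; [repeat apply Rmin_glb_lt; trivial|]. split; [unfold M; lra|].
intros eps He.
destruct (HF1 eps ltac:(lra)) as (z1 & w1 & S1 & A1 & P1 & W1 & L1 & D1).
destruct (HF2 eps ltac:(lra)) as (z2 & w2 & S2 & A2 & P2 & W2 & L2 & D2).
set (acc := m b1 b2 (x1 0) + a) in *.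
(* The factor [acc], nonzero but of a sign that depends on the loop, makes the leading coefficient
   exactly the Melnikov function. *)
set (D := fun th => acc * (z1 th 0 - z2 (- th) 0)).
assert (HDc : continuity D).
{ apply (lipschitz_continuity D (Rabs acc * M)). intros th th'. unfold D.
  replace (acc * (z1 th 0 - z2 (- th) 0) - acc * (z1 th' 0 - z2 (- th') 0))
    with (acc * ((z1 th 0 - z1 th' 0) - (z2 (- th) 0 - z2 (- th') 0))) by ring.
  rewrite Rmult_assoc. apply Rabs_prod_bound; [lra|].
  unfold M; rewrite Rmult_plus_distr_r. apply Rabs_diff_bound; [apply L1|].
  eapply Rle_trans; [apply L2|]. replace (- th - - th') with (- (th - th')) by ring. rewrite Rabs_Ropp; lra. }
assert (HDe : forall th, Rabs (D th - eps * (B * sin th * xi1 Om x2 + C * xi2 x1 x2)) <= M * eps ^ 2).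
{ intros th. unfold D.
  rewrite <- (melnikov_difference b1 b2 a xsa x1 x2 lam B Om Hloop Hx20 Hxsa Heq Hlam Hd C th).
  match goal with |- Rabs ?X <= _ => replace X with
    ((acc * (z1 th 0 - x1 0) - eps * improper (melnikov_integrand x1 x2 B Om C th))
     - (acc * (z2 (- th) 0 - x1 0) - eps * improper (melnikov_integrand x1 x2 B Om (- C) (- th)))) by ring end.
  unfold M; rewrite Rmult_plus_distr_r. now apply Rabs_diff_bound. }
assert (Hs3' : M * eps <= Rmin (Rabs mup) (Rabs mum) / 2) by (apply Hs3; lra).
assert (Q5 := Rmin_l (Rabs mup) (Rabs mum)). assert (Q6 := Rmin_r (Rabs mup) (Rabs mum)).
assert (Hp : 0 < D (PI / 2) * mup).
{ apply (sign_of_leading_term _ _ eps M); [lra| |lra].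
  specialize (HDe (PI / 2)). rewrite sin_PI2, Rmult_1_r in HDe. exact HDe. }
assert (Hm : 0 < D (- (PI / 2)) * mum).
{ apply (sign_of_leading_term _ _ eps M); [lra| |lra].
  specialize (HDe (- (PI / 2))). rewrite sin_neg, sin_PI2 in HDe.
  replace (B * - (1)) with (- B) in HDe by ring. exact HDe. }
destruct (IVT_cor D (- (PI / 2)) (PI / 2) HDc) as [th [_ Hth]].
{ pose proof PI_RGT_0; lra. }
{ apply Rnot_lt_le; intros Hpos. nra. }
assert (Hmeet : z1 th 0 = z2 (- th) 0).
{ unfold D in Hth. apply Rmult_integral in Hth. destruct Hth; [contradiction | lra]. }
assert (S2' : forall t, t <= 0 -> solves_at (forced b1 b2 a B C Om eps th) (fun t => z2 (- th) (- t)) (fun t => - w2 (- th) (- t)) t).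
{ intros t Ht. assert (H := S2 (- th) (- t) ltac:(lra)). apply solves_at_reverse in H.
  now rewrite !Ropp_involutive in H. }
exists th, (glue (z1 th) (fun t => z2 (- th) (- t))), (glue (w1 th) (fun t => - w2 (- th) (- t))).
split; [|split].
(* Both velocities vanish at 0, so equal positions give equal states and, through the equation,
   equal accelerations. *)
- assert (E0 : w1 th 0 = - w2 (- th) (- 0)) by (rewrite Ropp_0, W1, W2; ring).
  intros t; split.
  + apply (is_derive_glue (z1 th) (fun t => z2 (- th) (- t)) (w1 th) (fun t => - w2 (- th) (- t))); trivial.
    * intros s Hs; now apply S1.
    * intros s Hs; now apply S2'.
    * now rewrite Ropp_0.
  + evar_last.
    * apply (is_derive_glue (w1 th) (fun t => - w2 (- th) (- t))
        (fun t => forced b1 b2 a B C Om eps th t (z1 th t) (w1 th t))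
        (fun t => forced b1 b2 a B C Om eps th t (z2 (- th) (- t)) (- w2 (- th) (- t)))); trivial.
      -- intros s Hs; now apply S1.
      -- intros s Hs; now apply S2'.
      -- rewrite <- E0, Hmeet. now rewrite Ropp_0.
    * unfold glue; destruct (Rle_dec 0 t); reflexivity.
- intros t. destruct (Rle_or_lt 0 t) as [Ht|Ht].
  + rewrite glue_nonneg by trivial. now apply P1.
  + rewrite glue_neg by trivial. apply P2; lra.
- intros t.
  assert (M1 * eps <= M * eps /\ M2 * eps <= M * eps) by (unfold M; split; nra).
  destruct (Rle_or_lt 0 t) as [Ht|Ht].
  + rewrite !glue_nonneg by trivial. destruct (A1 th t Ht). lra.
  + rewrite !glue_neg by trivial. destruct (A2 (- th) (- t) ltac:(lra)) as [B1 B2].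
    destruct (loop_even _ _ _ _ _ _ Hloop Hx20 Hxsa t) as [E1 E2]. rewrite E1 in B1. rewrite E2 in B2.
    rewrite <- Rabs_Ropp in B2. replace (- (w2 (- th) (- t) - - x2 t)) with (- w2 (- th) (- t) - x2 t) in B2 by ring. lra.
Qed.

End Gluing.

(** * Asymptotics and convergence of the glued orbits *)

Theorem theorem4 :
  forall (b1 b2 xl xr a B C Omega xsa : R) (x1 x2 : R -> R),
    0 < b2 ->
    0 < b1 < b1_star b2 ->
    local_min_point (m b1 b2) xl ->
    local_max_point (m b1 b2) xr ->
    - m b1 b2 xr < a < - m b1 b2 xl ->
    0 < B -> 0 < C -> 0 < Omega ->
    unperturbed_saddle b1 b2 a xsa ->
    homoclinic_loop b1 b2 a xsa x1 x2 ->
    x2 0 = 0 ->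
    xi1 Omega x2 <> 0 ->
    B / C > Rabs (xi2 x1 x2 / xi1 Omega x2) ->
    persists (perturbed b1 b2 a B C Omega) (2 * PI / Omega) xsa x1 x2.
Proof.
intros b1 b2 xl xr a B C Om xsa x1 x2 _ _ _ _ _ _ HC HOm Hsaddle Hloop Hx20 Hxi1 Hratio.
destruct (saddle_positive_slope _ _ _ _ Hsaddle) as (Hxsa & Heq & lam & Hlam & Hd).
destruct (saddle_branch b1 b2 a B C Om xsa lam Hxsa Heq Hlam Hd HOm) as (e1 & Mp & p & q & He1 & HMp & Hcont & Hpq).
destruct (glued_solution_exists b1 b2 a xsa x1 x2 lam B C Om Hloop Hx20 Hxsa Heq Hlam Hd HC Hxi1 Hratio)
  as (e2 & Mz & He2 & HMz & Hglue).
(* Convexity is taken for both signs of the friction: the limits at minus infinity are those at plus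
   infinity of the reversed solutions, whose friction is [- C]. *)
destruct (squared_gap_convex b1 b2 a B C Om xsa lam Hxsa Hlam Hd) as (rho1 & g1 & Hrho1 & Hg1 & Hgap1).
destruct (squared_gap_convex b1 b2 a B (- C) Om xsa lam Hxsa Hlam Hd) as (rho2 & g2 & Hrho2 & Hg2 & Hgap2).
set (rho := Rmin 1 (Rmin rho1 rho2)).
assert (Hrho : 0 < rho) by (repeat apply Rmin_glb_lt; lra).
assert (R0 : rho <= 1) by apply Rmin_l.
assert (R1 : rho <= rho1) by (eapply Rle_trans; [apply Rmin_r | apply Rmin_l]).
assert (R2 : rho <= rho2) by (eapply Rle_trans; [apply Rmin_r | apply Rmin_r]).
assert (Hd0 : 0 < Rabs (x1 0 - xsa)).
{ apply Rabs_pos_lt. destruct Hloop as (_ & _ & _ & _ & _ & _ & [H|H]); specialize (H 0); lra. }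
(* The first bound keeps the solutions in the region of convexity; the second separates the
   homoclinic solution from the periodic one at time [t0]. *)
set (b := Rmin (rho / 2) (Rabs (x1 0 - xsa) / 2)).
assert (Hb : 0 < b) by (apply Rmin_glb_lt; lra).
assert (B1 : b <= rho / 2) by apply Rmin_l. assert (B2 : b <= Rabs (x1 0 - xsa) / 2) by apply Rmin_r.
destruct (small_multiple (Mp + Mz) (b / 2)) as (e3 & He3 & Hs3); [lra|].
set (eps0 := Rmin (Rmin (Rmin e1 e2) (Rmin g1 g2)) e3).
assert (Heps0 : 0 < eps0) by (unfold eps0; repeat apply Rmin_glb_lt; lra).
assert (Hle : eps0 <= e1 /\ eps0 <= e2 /\ eps0 <= g1 /\ eps0 <= g2 /\ eps0 <= e3).
{ unfold eps0.
  assert (Q1 := Rmin_l (Rmin (Rmin e1 e2) (Rmin g1 g2)) e3). assert (Q2 := Rmin_r (Rmin (Rmin e1 e2) (Rmin g1 g2)) e3).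
  assert (Q3 := Rmin_l (Rmin e1 e2) (Rmin g1 g2)). assert (Q4 := Rmin_r (Rmin e1 e2) (Rmin g1 g2)).
  assert (Q5 := Rmin_l e1 e2). assert (Q6 := Rmin_r e1 e2). assert (Q7 := Rmin_l g1 g2). assert (Q8 := Rmin_r g1 g2).
  repeat split; lra. }
clearbody eps0.
assert (Hex : forall eps, 0 < eps < eps0 -> exists zw : (R -> R) * (R -> R),
   homoclinic_to (perturbed b1 b2 a B C Om eps) (p eps) (q eps) (fst zw) (snd zw) /\
   exists t0, forall t, Rabs (fst zw t - x1 (t - t0)) <= Mz * eps /\ Rabs (snd zw t - x2 (t - t0)) <= Mz * eps).
{ intros eps He.
  destruct (Hglue eps ltac:(lra)) as (th & z & w & Hsol & Hpos & Hclose).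
  set (t0 := th / Om).
  exists (fun t => z (t - t0), fun t => w (t - t0)); simpl fst; simpl snd.
  split; [|exists t0; intros t; apply Hclose].
  specialize (Hs3 eps ltac:(lra)).
  assert (Hp0 : 0 <= Mp * eps) by nra. assert (Hz0 : 0 <= Mz * eps) by nra.
  assert (Hsolz : forall t, solves_at (forced b1 b2 a B C Om eps 0) (fun t => z (t - t0)) (fun t => w (t - t0)) t).
  { intros t. apply solves_at_shift; [lra | apply Hsol]. }
  assert (Hsolp : forall t, solves_at (forced b1 b2 a B C Om eps 0) (p eps) (q eps) t).
  { intros t. destruct Hcont as (_ & H & _). destruct (H eps ltac:(lra)) as (Hs & _).
    destruct (Hs t) as (_ & D1 & D2). rewrite perturbed_forced in D2. now split. }
  assert (Hp : forall t, Rabs (p eps t - xsa) <= b / 2 /\ Rabs (q eps t) <= b / 2).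
  { intros t. destruct (Hpq eps ltac:(lra) t). split; lra. }
  destruct (Hloop) as (_ & _ & L1 & L2 & _).
  (* The loop uses half of each radius; the other half is left to the deviation of order [eps]. *)
  destruct (is_lim_infty_bound _ _ (rho / 2) L1 ltac:(lra)) as (T1 & _ & HT1).
  destruct (is_lim_infty_bound _ _ (1 / 2) L2 ltac:(lra)) as (T2 & _ & HT2).
  set (T := Rmax T1 T2).
  assert (Hfar : forall s, T <= s -> Rabs (x1 s - xsa) < rho / 2 /\ Rabs (x2 s) < 1 / 2).
  { intros s Hs. assert (T1 <= T) by apply Rmax_l. assert (T2 <= T) by apply Rmax_r.
    assert (H2 := HT2 s ltac:(lra)). rewrite Rminus_0_r in H2. split; [apply HT1; lra | trivial]. }
  assert (Hnear : forall s u, T <= u -> x1 s = x1 u -> Rabs (x2 s) = Rabs (x2 u) ->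
     Rabs (z s - xsa) <= rho /\ Rabs (w s) <= 1).
  { intros s u Hu E1 E2. destruct (Hfar u Hu) as [F1 F2]. rewrite <- E1 in F1. rewrite <- E2 in F2.
    destruct (Hclose s) as [C1 C2].
    split.
    - replace (z s - xsa) with ((z s - x1 s) + (x1 s - xsa)) by ring.
      eapply Rle_trans; [apply Rabs_triang|]. lra.
    - replace (w s) with ((w s - x2 s) + x2 s) by ring.
      eapply Rle_trans; [apply Rabs_triang|]. lra. }
  assert (Hplus : is_lim (fun t => z (t - t0) - p eps t) p_infty 0 /\ is_lim (fun t => w (t - t0) - q eps t) p_infty 0).
  { apply (gap_tends_to_0 b1 b2 a B C Om xsa lam rho1 g1 Hrho1 Hlam Hgap1 eps 0
      (fun t => z (t - t0)) (fun t => w (t - t0)) (p eps) (q eps) (T + t0)); [lra| |].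
    - intros t Ht. destruct (Hnear (t - t0) (t - t0) ltac:(lra) eq_refl eq_refl). destruct (Hp t).
      split; [apply Hsolz|split; [apply Hsolp|]]. repeat split; lra.
    - intros t Ht. now apply (Hnear (t - t0) (t - t0) ltac:(lra)). }
  assert (Hminus : is_lim (fun t => z (- t - t0) - p eps (- t)) p_infty 0 /\
     is_lim (fun t => - w (- t - t0) - - q eps (- t)) p_infty 0).
  { assert (Hev : forall t, x1 (- t - t0) = x1 (t + t0) /\ Rabs (x2 (- t - t0)) = Rabs (x2 (t + t0))).
    { intros t. replace (- t - t0) with (- (t + t0)) by ring.
      destruct (loop_even _ _ _ _ _ _ Hloop Hx20 Hxsa (t + t0)) as [-> ->]. now rewrite Rabs_Ropp. }
    (* The phase is written [- 0] because reversal negates it. *)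
    apply (gap_tends_to_0 b1 b2 a B (- C) Om xsa lam rho2 g2 Hrho2 Hlam Hgap2 eps (- 0)
      (fun t => z (- t - t0)) (fun t => - w (- t - t0)) (fun t => p eps (- t)) (fun t => - q eps (- t)) (T - t0)); [lra| |].
    - intros t Ht. destruct (Hev t) as [E1 E2]. destruct (Hnear (- t - t0) (t + t0) ltac:(lra) E1 E2). destruct (Hp (- t)).
      split; [|split].
      + apply (solves_at_reverse b1 b2 a B C Om eps 0 (fun t => z (t - t0)) (fun t => w (t - t0))), Hsolz.
      + apply (solves_at_reverse b1 b2 a B C Om eps 0 (p eps) (q eps)), Hsolp.
      + rewrite Rabs_Ropp. repeat split; lra.
    - intros t Ht. rewrite Rabs_Ropp. destruct (Hev t) as [E1 E2].
      now apply (Hnear (- t - t0) (t + t0) ltac:(lra)). }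
  split; [|split; [|split; [|split; [|split]]]]; try apply Hplus.
  - intros t. destruct (Hsolz t) as [D1 D2]. split; [apply Hpos|]. split; [exact D1|].
    rewrite perturbed_forced. exact D2.
  - exists t0. intros E; injection E as E _. rewrite Rminus_diag in E.
    destruct (Hclose 0) as [C1 _]. destruct (Hp t0) as [P1 _]. rewrite <- E in P1.
    assert (Rabs (x1 0 - xsa) <= Rabs (z 0 - x1 0) + Rabs (z 0 - xsa)).
    { rewrite (Rabs_minus_sym (z 0)). replace (x1 0 - xsa) with ((x1 0 - z 0) + (z 0 - xsa)) by ring. apply Rabs_triang. }
    lra.
  - apply is_lim_m_infty_reverse, Hminus.
  - apply is_lim_m_infty_reverse. destruct Hminus as [_ H].
    apply is_lim_opp in H. simpl in H. rewrite Ropp_0 in H.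
    revert H. apply is_lim_ext. intros t. real_equation; ring. }
(* The branches [z] and [w] have to be functions of [eps], hence a choice over all [eps], with a
   default pair outside the range. *)
destruct (choice (fun eps zw => 0 < eps < eps0 ->
   homoclinic_to (perturbed b1 b2 a B C Om eps) (p eps) (q eps) (fst zw) (snd zw) /\
   exists t0, forall t, Rabs (fst zw t - x1 (t - t0)) <= Mz * eps /\ Rabs (snd zw t - x2 (t - t0)) <= Mz * eps)) as [zw Hzw].
{ intros eps. destruct (classic (0 < eps < eps0)) as [He|He].
  - destruct (Hex eps He) as [zw Hzw]. now exists zw.
  - exists (fun _ => 0, fun _ => 0); intros; contradiction. }
exists eps0, p, q, (fun eps => fst (zw eps)), (fun eps => snd (zw eps)).
split; [trivial|]. split; [apply (saddle_continuation_restrict _ _ _ e1); trivial; lra|].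
split; [intros eps He; now apply Hzw|].
intros eta Heta.
destruct (small_multiple Mz (eta / 2)) as (e4 & He4 & Hs4); [lra|].
assert (Q1 := Rmin_l eps0 e4). assert (Q2 := Rmin_r eps0 e4).
exists (Rmin eps0 e4); split; [now apply Rmin_glb_lt|].
intros eps He. destruct (Hzw eps ltac:(lra)) as [_ [t0 Ht0]]. specialize (Hs4 eps ltac:(lra)).
split.
- intros t; exists (t - t0). destruct (Ht0 t). split; lra.
- intros s; exists (s + t0). destruct (Ht0 (s + t0)) as [C1 C2].
  replace (s + t0 - t0) with s in C1, C2 by ring. split; lra.
Qed.
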